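(* Let $\lambda,\mu,D,L_2,\epsilon,L_1,\kappa_0$, the effective extensional modulus $E_*$ and the effective shear modulus $\mu_*$ (which depend on $\epsilon$) be as in the context, and let $$E=\frac{\mu(3\lambda+2\mu)}{\lambda+\mu}$$ be Young's modulus of the matrix. Let $\kappa_0$ be the curvature of $\partial D$ at the point of $\partial D$ closest to the line $x=L_1$. Then, as $\epsilon\to 0$, $$E_* = E\,\frac{L_1}{L_2}\,\frac{\pi}{\sqrt{\kappa_0}}\,\frac{1}{\sqrt{\epsilon}}+O(1)$$ and $$\mu_* = \mu\,\frac{L_1}{L_2}\,\frac{\pi}{\sqrt{\kappa_0}}\,\frac{1}{\sqrt{\epsilon}}+O(1),$$ where $O(1)$ denotes a quantity whose absolute value is bounded, for all sufficiently small $\epsilon>0$, by a constant independent of $\epsilon$.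
   Context: Geometry. $D\subset\mathbb{R}^2$ is a bounded strictly convex domain containing the origin, with smooth boundary, symmetric with respect to both the $x$-axis and the $y$-axis. Put $b=\max\{x:(x,y)\in\overline D\}$, so that $(b,0)$ is the point of $\partial D$ with the largest $x$-coordinate; the curvature $\kappa_0$ of $\partial D$ at $(b,0)$ is positive. Fix $L_2>\max\{y:(x,y)\in\overline D\}$ ($D$ stays away from the horizontal sides). For $\epsilon>0$ let $L_1=b+\epsilon/2$ and let $Y=(-L_1,L_1)\times(-L_2,L_2)$ be the period cell. Thus $\epsilon/2$ is the distance from $D$ to each vertical side of $Y$, and $\epsilon$ is the distance between horizontally adjacent inclusions in the periodic array. The set $D$, the number $L_2$ and the Lamé constants are independent of $\epsilon$. Elasticity. $(\lambda,\mu)$ are real constants with $\mu>0$ and $\lambda+\mu>0$. The elasticity tensor $\mathbb{C}=(C_{ijkl})$ is $C_{ijkl}=\lambda\delta_{ij}\delta_{kl}+\mu(\delta_{ik}\delta_{jl}+\delta_{il}\delta_{jk})$. For a vector field $u$, $\widehat\nabla u=\frac12(\nabla u+\nabla u^T)$ and $\mathcal{L}_{\lambda,\mu}u=\nabla\cdot\mathbb{C}\widehat\nabla u=\mu\Delta u+(\lambda+\mu)\nabla\nabla\cdot u$. The co-normal derivative is $\partial_\nu u=(\mathbb{C}\widehat\nabla u)n$, with $n$ the outward unit normal to $\partial D$ or to $\partial Y$, respectively. Poisson's ratio is $\rho=\dfrac{\lambda}{2(\lambda+\mu)}$. Let $\Psi_1=(1,0)^T$ and $\Psi_2=(0,1)^T$.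 Cell problems. For $j=1,2$, $v_j\in H^1(Y\setminus\overline D)$ (with values in $\mathbb{R}^2$) is the solution of $$\mathcal{L}_{\lambda,\mu}v_j=0\ \text{in }Y\setminus\overline D,\qquad v_j=0\ \text{on }\partial D,\qquad v_j=\pm\tfrac12\Psi_j\ \text{on }x=\pm L_1,\qquad \partial_\nu v_j=0\ \text{on }y=\pm L_2 .$$ Effective moduli. $$E_*=\frac{(1+\rho)(1-2\rho)}{1-\rho}\,\frac{L_1}{L_2}\int_{-L_2}^{L_2}\partial_\nu v_1(L_1,y)\cdot\Psi_1\,dy,\qquad \mu_*=\frac{L_1}{L_2}\int_{-L_2}^{L_2}\partial_\nu v_2(L_1,y)\cdot\Psi_2\,dy .$$ The boundary integrals are understood in the usual weak (duality) sense for normal traces. *)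

(* Defs.v *)
From HB Require Import structures.
From mathcomp Require Import all_boot all_order all_algebra.
From mathcomp Require Import all_classical all_reals all_analysis.
Set Implicit Arguments.
Unset Strict Implicit.
Unset Printing Implicit Defensive.
Import Order.TTheory GRing.Theory Num.Theory.
Import numFieldNormedType.Exports.
Local Open Scope classical_set_scope.
Local Open Scope ring_scope.

Section Plane.
Context {R : realType}.

Definition plane_measure :=
  ((@lebesgue_measure R) \x (@lebesgue_measure R))%E.

Definition axis (i : 'I_2) : R * R := if i == ord0 then (1, 0) else (0, 1).

Definition partial (i : 'I_2) (f : R * R -> R) (p : R * R) : R := 'D_(axis i) f p.

Fixpoint Cn (n : nat) (f : R * R -> R) : Prop :=
  if n is m.+1 then
    continuous f /\
    forall i, (forall p, derivable f p (axis i)) /\ Cn m (partial i f)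
  else continuous f.

Definition smooth (f : R * R -> R) : Prop := forall n, Cn n f.

Definition test_function (Om : set (R * R)) (phi : R * R -> R) : Prop :=
  smooth phi /\
  compact (closure [set p | phi p != 0]) /\
  closure [set p | phi p != 0] `<=` Om.

End Plane.

Section Inclusion.
Context {R : realType}.

Definition strictly_convex (D : set (R * R)) : Prop :=
  forall p q : R * R, closure D p -> closure D q -> p <> q ->
  forall t : R, 0 < t < 1 -> interior D (t *: p + (1 - t) *: q).

Record inclusion (D : set (R * R)) : Prop := {
  inclusion_open : open D;
  inclusion_bounded : bounded_set D;
  inclusion_strictly_convex : strictly_convex D;
  inclusion_origin : D (0, 0);
  inclusion_symm_y : forall x y, D (x, y) -> D (- x, y);
  inclusion_symm_x : forall x y, D (x, y) -> D (x, - y)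
}.

(* Smoothness of the boundary of D, as a C^oo arc-length parametrization gamma
   of that boundary by R / (T Z); for a bounded convex domain the boundary is a
   single closed curve. *)
Record boundary_param (D : set (R * R)) (gamma : R -> R * R) (T : R) : Prop := {
  boundary_period : 0 < T;
  boundary_smooth : forall n t, derivable (derive1n n gamma) t 1;
  boundary_unit_speed :
    forall t, (derive1 gamma t).1 ^+ 2 + (derive1 gamma t).2 ^+ 2 = 1;
  boundary_periodic : forall t, gamma (t + T) = gamma t;
  boundary_inj : forall s t, 0 <= s < T -> 0 <= t < T -> gamma s = gamma t -> s = t;
  boundary_range : range gamma = closure D `\` interior D
}.

(* Curvature of an arc-length parametrized curve; the absolute value makes it
   independent of the orientation. *)
Definition curvature (gamma : R -> R * R) (t : R) : R :=
  let g1 := derive1 gamma t in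
  let g2 := derive1n 2 gamma t in
  `| g1.1 * g2.2 - g1.2 * g2.1 |.

(* Maxima rather than mere suprema as soon as D is bounded and nonempty. *)
Definition xmax (D : set (R * R)) : R := sup [set p.1 | p in closure D].
Definition ymax (D : set (R * R)) : R := sup [set p.2 | p in closure D].

Definition half_width (D : set (R * R)) (eps : R) : R := xmax D + eps / 2.

Definition cell (D : set (R * R)) (L2 eps : R) : set (R * R) :=
  [set p | - half_width D eps < p.1 < half_width D eps /\ - L2 < p.2 < L2].

Definition matrix_part (D : set (R * R)) (L2 eps : R) : set (R * R) :=
  cell D L2 eps `\` closure D.

End Inclusion.

Section Sobolev.
Context {R : realType}.

Definition square_integrable (Om : set (R * R)) (f : R * R -> R) : Prop :=
  measurable_fun Om f /\
  (\int[plane_measure]_(p in Om) ((f p) ^+ 2)%:E < +oo)%E.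

Definition weak_partial (Om : set (R * R)) (i : 'I_2) (u g : R * R -> R) : Prop :=
  forall phi, test_function Om phi ->
  \int[plane_measure]_(p in Om) (u p * partial i phi p) =
  - \int[plane_measure]_(p in Om) (g p * phi p).

(* An element of H^1(Om), presented with (a representative of) its weak
   gradient, which is determined by the function up to a null set. *)
Record H1 (Om : set (R * R)) : Type := {
  H1_val :> R * R -> R;
  H1_grad : 'I_2 -> R * R -> R;
  H1_val_L2 : square_integrable Om H1_val;
  H1_grad_L2 : forall i, square_integrable Om (H1_grad i);
  H1_weak : forall i, weak_partial Om i H1_val (H1_grad i)
}.

Definition H1_sqdist (Om : set (R * R)) (phi : R * R -> R) (u : H1 Om) : \bar R :=
  (\int[plane_measure]_(p in Om)
     ((phi p - u p) ^+ 2 + \sum_(i < 2) (partial i phi p - H1_grad u i p) ^+ 2)%:E)%E.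

(* The trace operator is the H^1 -> L^2(boundary) continuous extension of the
   restriction of smooth functions.  Here it is taken on the boundary arc
   c([a, b]), parametrized by arc length, and compared with the constant g. *)
Definition has_trace (Om : set (R * R)) (c : R -> R * R) (a b : R)
    (u : H1 Om) (g : R) : Prop :=
  exists phi : nat -> R * R -> R,
    [/\ forall n, smooth (phi n),
        (fun n => H1_sqdist (phi n) u) @ \oo --> 0%E &
        (fun n => (\int[lebesgue_measure]_(t in `[a, b])
                     ((phi n (c t) - g) ^+ 2)%:E)%E) @ \oo --> 0%E].

End Sobolev.

Section Elasticity.
Context {R : realType}.
Variables (lam mu : R).

Definition kron (i j : 'I_2) : R := (i == j)%:R.

Definition elasticity_tensor (i j k l : 'I_2) : R :=
  lam * kron i j * kron k l + mu * (kron i k * kron j l + kron i l * kron j k).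

(* G i j is the j-th partial derivative of the i-th component. *)
Definition strain (G : 'I_2 -> 'I_2 -> R * R -> R) (i j : 'I_2) (p : R * R) : R :=
  (G i j p + G j i p) / 2.

Definition stress (G : 'I_2 -> 'I_2 -> R * R -> R) (i j : 'I_2) (p : R * R) : R :=
  \sum_(k < 2) \sum_(l < 2) elasticity_tensor i j k l * strain G k l p.

Definition energy (Om : set (R * R)) (G H : 'I_2 -> 'I_2 -> R * R -> R) : R :=
  \int[plane_measure]_(p in Om)
    (\sum_(i < 2) \sum_(j < 2) stress G i j p * strain H i j p).

Definition lame_equation (Om : set (R * R)) (v : 'I_2 -> H1 Om) : Prop :=
  forall phi : 'I_2 -> R * R -> R, (forall k, test_function Om (phi k)) ->
  energy Om (fun k => H1_grad (v k)) (fun k i => partial i (phi k)) = 0.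

(* By Green's formula, for a weak solution v of the Lame system this is the
   duality pairing on the boundary of Om between the co-normal derivative of v
   (for the normal pointing out of Om) and the trace of w. *)
Definition conormal_pairing (Om : set (R * R)) (v w : 'I_2 -> H1 Om) : R :=
  energy Om (fun k => H1_grad (v k)) (fun k => H1_grad (w k)).

Section Cell.
Variables (D : set (R * R)) (gamma : R -> R * R) (T L2 eps : R).
Let L1 := half_width D eps.
Let Om := matrix_part D L2 eps.

Definition trace_inclusion (v : 'I_2 -> H1 Om) (g : 'I_2 -> R) : Prop :=
  forall k, has_trace gamma 0 T (v k) (g k).

Definition trace_right (v : 'I_2 -> H1 Om) (g : 'I_2 -> R) : Prop :=
  forall k, has_trace (fun y => (L1, y)) (- L2) L2 (v k) (g k).

Definition trace_left (v : 'I_2 -> H1 Om) (g : 'I_2 -> R) : Prop :=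
  forall k, has_trace (fun y => (- L1, y)) (- L2) L2 (v k) (g k).

Definition zero_vec (k : 'I_2) : R := 0.

Definition conormal_zero_horizontal (v : 'I_2 -> H1 Om) : Prop :=
  forall w : 'I_2 -> H1 Om,
  trace_inclusion w zero_vec -> trace_left w zero_vec -> trace_right w zero_vec ->
  conormal_pairing v w = 0.

(* kron j is the constant vector field Psi_j, j = 0 standing for the
   x-direction and j = 1 for the y-direction. *)
Record cell_solution (j : 'I_2) (v : 'I_2 -> H1 Om) : Prop := {
  cell_equation : lame_equation v;
  cell_inclusion : trace_inclusion v zero_vec;
  cell_right : trace_right v (fun k => kron j k / 2);
  cell_left : trace_left v (fun k => - (kron j k / 2));
  cell_horizontal : conormal_zero_horizontal v
}.

(* The integral over the side x = L1 of (co-normal derivative of v) . Psi_j, by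
   duality: the common value of the pairing of v with all fields w equal to
   Psi_j on that side and to 0 on x = -L1 and on the boundary of D.  The values
   of w on y = L2 and y = -L2 do not matter when the co-normal derivative of v
   vanishes there. *)
Definition right_flux (j : 'I_2) (v : 'I_2 -> H1 Om) : R :=
  xget 0 [set q | forall w : 'I_2 -> H1 Om,
    trace_inclusion w zero_vec -> trace_left w zero_vec -> trace_right w (kron j) ->
    conormal_pairing v w = q].

Definition poisson_ratio : R := lam / (2 * (lam + mu)).
Definition young_modulus : R := mu * (3 * lam + 2 * mu) / (lam + mu).

Definition extensional_modulus (v1 : 'I_2 -> H1 Om) : R :=
  (1 + poisson_ratio) * (1 - 2 * poisson_ratio) / (1 - poisson_ratio)
  * (L1 / L2) * right_flux ord0 v1.

Definition shear_modulus (v2 : 'I_2 -> H1 Om) : R :=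
  L1 / L2 * right_flux ord_max v2.

End Cell.
End Elasticity.

(* Main.v *)
(** Near the two contact points the gap between the inclusion and the side x = s L1 (s = 1 or -1)
    has width close to (eps + kappa0 y^2) / 2.  The field W_s that is affine in x across the
    slightly modified gap { b - g(y) < s x < L1 }, equal to 0 on the inclusion and to 1 on the side,
    lies in H^1; with V = (W_1 - W_-1) / 2 in the direction of Psi_j, the energy of V is explicit and
    gives the leading term, since the integral of 1 / (eps + kappa0 y^2) is
    pi / sqrt(kappa0 eps) + O(1).

    The error r = v - V has zero traces, so a(r, r) = - a(V, r) and it suffices to bound a(W_s, r) by
    the L^2 norm of the strain of r, uniformly in eps.  The stress of W_s is not bounded in L^2, but
    it becomes so after subtracting a symmetric divergence-free tensor supported in the gap, built
    from zeta(y) ~ 2 / (eps + kappa0 y^2) and polynomial in the distance to the side; that tensor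
    does no work against fields with zero traces.  Coercivity is only used for the strain, so that no
    Korn inequality is needed. *)

Require Import Defs.
From mathcomp Require Import all_boot all_order all_algebra.
From mathcomp Require Import all_classical all_reals all_analysis.
From mathcomp Require Import measurable_realfun ring lra.
Set Implicit Arguments.
Unset Strict Implicit.
Unset Printing Implicit Defensive.
Import Order.TTheory GRing.Theory Num.Theory.
Import numFieldNormedType.Exports.
Local Open Scope classical_set_scope.
Local Open Scope ring_scope.

(** * Integration on the plane *)

(** With d = eps + kappa0 y^2, the gap has width of order d at height y and the ramp has strain of
    order 1/d. In the subtracted tensor a yy stress lam zeta forces the shear entry - lam zeta' X;
    symmetry repeats that entry in the first row, where lam zeta'' X^2 / 2 balances it. Since X =
    O(d), zeta' = O(|y| / d^2) and zeta'' = O(d^-2), the additional entries have bounded L^2 norm.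

    The modified boundary must match the true one up to O(y^4). On the sliver between them zeta^2 is
    of order d^-2, and a cubic mismatch would leave the integral of |y|^3 / d^2, of order
    log(1/eps). The reflection symmetry of the inclusion removes the cubic term.

    In Green's formula the obstacle is that [has_trace] supplies a separate approximating sequence
    for each arc, so no single sequence is known to be small on the whole boundary of the gap. A
    trace inequality on the side transfers smallness from one sequence to the other; its constant
    may blow up with eps because the result is an exact identity. *)

Section PlaneMeasure.
Context {R : realType}.

Notation leb := (@lebesgue_measure R).
Notation mu2 := (@plane_measure R).
Notation RR := (measurableTypeR R * measurableTypeR R)%type.
Implicit Types (f g : RR -> R) (Q : set RR).

(** The sigma-algebra is the product of two Borel ones, so openness has to be translated: an open
    set is the union of the squares with rational centre and radius that it contains. Squares not
    contained in [Q] are replaced by [set0], which keeps the index type countable. *)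
Lemma open_plane_measurable Q : open (Q : set (R * R)) -> measurable Q.
Proof.
move=> oQ.
pose B (i : rat * rat * rat) : set (R * R) :=
  `](ratr i.1.1 - ratr i.2), (ratr i.1.1 + ratr i.2)[%classic `*`
  `](ratr i.1.2 - ratr i.2), (ratr i.1.2 + ratr i.2)[%classic.
pose F i : set (R * R) := if asbool (B i `<=` Q) then B i else set0.
have -> : Q = \bigcup_i F i.
  apply/seteqP; split => [p Qp|p [i _]]; last first.
    by rewrite /F; case: asboolP => // BQ /BQ.
  have /nbhs_ballP[e /= e0 eQ] : nbhs p Q by exact: open_nbhs_nbhs.
  (* Half of [e]: two points of a square of radius [r] differ by less than [2 * r] in each
     coordinate. *)
  have [r] := @rat_in_itvoo R 0 (e / 2) ltac:(lra).
  rewrite in_itv /= => /andP[r0 re].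
  have [a] := @rat_in_itvoo R (p.1 - ratr r) (p.1 + ratr r) ltac:(lra).
  rewrite in_itv /= => /andP[a1 a2].
  have [b] := @rat_in_itvoo R (p.2 - ratr r) (p.2 + ratr r) ltac:(lra).
  rewrite in_itv /= => /andP[b1 b2].
  exists (a, b, r) => //; rewrite /F; case: asboolP => [_|].
    by rewrite /B; split; rewrite /= in_itv /=; apply/andP; split; lra.
  case=> q [] /=; rewrite !in_itv /= => /andP[? ?] /andP[? ?].
  by apply: eQ; split; rewrite /ball /= ltr_norml; apply/andP; split; lra.
apply: countable_bigcupT_measurable => [|i].
  exact: countableP.
rewrite /F; case: asboolP => // _; apply: measurableX; exact: measurable_itv.
Qed.

Lemma closed_plane_measurable Q : closed (Q : set (R * R)) -> measurable Q.
Proof.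
by move=> cQ; rewrite -(setCK Q); apply: measurableC; apply: open_plane_measurable; exact: closed_openC.
Qed.

Lemma continuous_plane_measurable (D : set RR) f : measurable D ->
  continuous (f : R * R -> R) -> measurable_fun D f.
Proof.
move=> mD cf; apply: (@measurable_funS _ _ RR _ setT D f measurableT (@subsetT _ D)).
apply: (measurability _ (measurable_realfun.RGenOInfty.measurableE R)).
move=> _ [_ [a ->] <-]; rewrite setTI; apply: open_plane_measurable.
by apply: open_comp => // x _; exact: cf.
Qed.

Definition rect (a b c d : R) : set RR := `[a, b]%classic `*` `[c, d]%classic.

Lemma rect_measurable a b c d : measurable (rect a b c d).
Proof. by apply: measurableX; exact: measurable_itv. Qed.

Lemma rectE a b c d p : rect a b c d p <-> (a <= p.1 <= b) /\ (c <= p.2 <= d).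
Proof. by rewrite /rect /= !in_itv. Qed.

Lemma lebesgue_measure_segment (a b : R) : a <= b -> leb `[a, b]%classic = (b - a)%:E.
Proof.
rewrite lebesgue_measure_itv /= lte_fin le_eqVlt => /predU1P[->|->] //.
by rewrite ltxx subrr.
Qed.

Lemma plane_measure_rect a b c d : a <= b -> c <= d ->
  mu2 (rect a b c d) = ((b - a) * (d - c))%:E.
Proof.
move=> ab cd; rewrite /plane_measure product_measure1E //.
  transitivity (leb `[a, b]%classic * leb `[c, d]%classic)%E => //.
  by rewrite !lebesgue_measure_segment // EFinM.
Qed.

Definition rect_bounded Q := exists a b c d, Q `<=` rect a b c d.

Lemma rect_bounded_lty Q : measurable Q -> rect_bounded Q -> (mu2 Q < +oo)%E.
Proof.
move=> mQ [a [b [c [d QB]]]].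
(* The endpoints given by [rect_bounded] are unordered, while [plane_measure_rect] asks for ordered
   ones. *)
have QB' : Q `<=` rect a (Num.max a b) c (Num.max c d).
  by move=> p /QB /rectE [/andP[? ?] /andP[? ?]]; apply/rectE; rewrite !le_max; split; apply/andP; split => //; apply/orP; right.
apply: (@le_lt_trans _ _ (mu2 (rect a (Num.max a b) c (Num.max c d)))).
  by apply: le_measure; rewrite ?inE //; exact: rect_measurable.
by rewrite plane_measure_rect ?le_max ?lexx // ltry.
Qed.

End PlaneMeasure.

(** * Integrable and square-integrable real functions *)

Section IntegrableReal.
Context d (T : measurableType d) (R : realType) (mu : {measure set T -> \bar R}).
Variables (A : set T) (mA : measurable A).
Implicit Types f g : T -> R.

Definition integ f := mu.-integrable A (EFin \o f).

Lemma integ_measurable f : integ f -> measurable_fun A f.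
Proof. by move=> /measurable_int /measurable_EFinP. Qed.

Lemma integ_ext f g : (forall x, A x -> f x = g x) -> integ f -> integ g.
Proof.
by move=> fg; apply: eq_integrable => // x /set_mem Ax; rewrite /= fg.
Qed.

Lemma integD f g : integ f -> integ g -> integ (fun x => f x + g x).
Proof. by move=> hf hg; apply: (integrableD mA hf hg). Qed.

Lemma integZ k f : integ f -> integ (fun x => k * f x).
Proof. by move=> hf; apply: (integrableZl mA k hf). Qed.

Lemma integB f g : integ f -> integ g -> integ (fun x => f x - g x).
Proof. by move=> hf hg; apply: (integrableB mA hf hg). Qed.

Lemma integ_norm f : integ f -> integ (fun x => `|f x|).
Proof. by move=> hf; apply: integrable_norm. Qed.

Lemma integ_dom f g : measurable_fun A f -> integ g ->
  (forall x, A x -> `|f x| <= g x) -> integ f.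
Proof.
move=> mf hg fg; apply: (le_integrable mA _ _ hg); first exact/measurable_EFinP.
by move=> x Ax; rewrite /= lee_fin (le_trans (fg x Ax)) // ler_norm.
Qed.

Lemma integ_sub (B : set T) f : measurable B -> B `<=` A -> integ f -> mu.-integrable B (EFin \o f).
Proof. by move=> mB BA hf; exact: (integrableS mA mB BA hf). Qed.

Lemma integ_bounded f C : (mu A < +oo)%E -> measurable_fun A f ->
  (forall x, A x -> `|f x| <= C) -> integ f.
Proof.
move=> fA mf fC; apply: measurable_bounded_integrable => //.
by exists C; split; [exact: num_real|move=> M CM x Ax; apply: (le_trans (fC x Ax)); exact: ltW].
Qed.

(** Measurability of [f] is a separate clause because that of its square does not imply it. *)
Definition sqint f := measurable_fun A f /\ integ (fun x => f x ^+ 2).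

Lemma sqintE f : measurable_fun A f -> (\int[mu]_(x in A) (f x ^+ 2)%:E < +oo)%E -> sqint f.
Proof.
move=> mf hf; split => //; apply/integrableP; split.
  by apply/measurable_EFinP; apply: measurable_funX.
by under eq_integral do rewrite /= ger0_norm ?sqr_ge0 //.
Qed.

Lemma sqint_lty f : sqint f -> (\int[mu]_(x in A) (f x ^+ 2)%:E < +oo)%E.
Proof.
move=> [mf] /integrableP[_].
by under eq_integral do rewrite /= ger0_norm ?sqr_ge0 //.
Qed.

Lemma sqint_mul f g : sqint f -> sqint g -> integ (fun x => f x * g x).
Proof.
move=> [mf hf] [mg hg]; apply: (integ_dom _ (integD hf hg)).
  exact: measurable_funM.
move=> x _; rewrite normrM -(real_normK (num_real (f x))) -(real_normK (num_real (g x))).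
have := sqr_ge0 (`|f x| - `|g x|); have := mulr_ge0 (normr_ge0 (f x)) (normr_ge0 (g x)).
by nra.
Qed.

Lemma sqintD f g : sqint f -> sqint g -> sqint (fun x => f x + g x).
Proof.
move=> hf hg; have hfg := sqint_mul hf hg; case: hf hg => mf hf [mg hg].
split; first exact: measurable_funD.
apply: (@integ_ext (fun x => (f x ^+ 2 + 2 * (f x * g x)) + g x ^+ 2)).
  by move=> x _; ring.
by apply: integD => //; apply: integD => //; exact: integZ.
Qed.

Lemma sqintZ k f : sqint f -> sqint (fun x => k * f x).
Proof.
move=> [mf hf]; split; first exact: measurable_funM.
apply: (@integ_ext (fun x => k ^+ 2 * f x ^+ 2)); first by move=> x _; ring.
exact: integZ.
Qed.

Lemma sqintB f g : sqint f -> sqint g -> sqint (fun x => f x - g x).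
Proof.
move=> hf hg; have := sqintD hf (sqintZ (-1) hg).
by under [X in sqint X]eq_fun do rewrite mulN1r.
Qed.

Lemma sqint_bounded f C : (mu A < +oo)%E -> measurable_fun A f ->
  (forall x, A x -> `|f x| <= C) -> sqint f.
Proof.
move=> fA mf fC; split => //; apply: (@integ_bounded _ (C ^+ 2)) => //.
  exact: measurable_funX.
move=> x Ax; rewrite normrX lerXn2r ?nnegrE //; last exact: fC.
exact: le_trans (fC x Ax).
Qed.

Lemma sqint_integ f : (mu A < +oo)%E -> sqint f -> integ f.
Proof.
move=> fA hf; have h1 : sqint (fun=> 1) by apply: (@sqint_bounded _ 1) => // x _; rewrite normr1.
by apply: (@integ_ext _ _ _ (sqint_mul h1 hf)) => x _; rewrite mul1r.
Qed.

Lemma sqint_ext f g : (forall x, A x -> f x = g x) -> sqint f -> sqint g.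
Proof.
move=> fg [mf hf]; split.
  by apply: eq_measurable_fun mf => x /set_mem /fg.
by apply: integ_ext hf => x Ax; rewrite fg.
Qed.

Lemma ge0_integ_lty f : measurable_fun A f -> (forall x, A x -> 0 <= f x) ->
  (\int[mu]_(x in A) (f x)%:E < +oo)%E -> integ f.
Proof.
move=> mf f0 h; apply/integrableP; split; first exact/measurable_EFinP.
rewrite (@eq_integral _ _ _ _ _ (fun x => (f x)%:E)) //.
by move=> x /set_mem Ax /=; rewrite ger0_norm // f0.
Qed.

Lemma integ_EFin f : integ f -> (\int[mu]_(x in A) f x)%:E = (\int[mu]_(x in A) (f x)%:E)%E.
Proof. by move=> hf; rewrite /Rintegral fineK //; exact: integrable_fin_num. Qed.

End IntegrableReal.

(** * Slicing plane integrals *)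

Section PlaneFubini.
Context {R : realType}.

Notation leb := (@lebesgue_measure R).
Notation mu2 := (@plane_measure R).
Notation RR := (measurableTypeR R * measurableTypeR R)%type.
Implicit Types (f g : RR -> R) (Q : set RR).

Lemma plane_integral_y Q f : measurable Q -> integ mu2 Q f ->
  (\int[mu2]_(p in Q) (f p)%:E = \int[leb]_y \int[leb]_x ((f \_ Q) (x, y))%:E)%E.
Proof.
move=> mQ hf; rewrite integral_mkcond restrict_EFin; symmetry.
apply: (@integral21_prod_meas1 _ _ _ _ _ leb leb (EFin \o (f \_ Q))).
by rewrite -restrict_EFin; exact: (integrable_mkcond (EFin \o f) mQ).1.
Qed.

Lemma plane_integral_x Q f : measurable Q -> integ mu2 Q f ->
  (\int[mu2]_(p in Q) (f p)%:E = \int[leb]_x \int[leb]_y ((f \_ Q) (x, y))%:E)%E.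
Proof.
move=> mQ hf; rewrite integral_mkcond restrict_EFin; symmetry.
apply: (@integral12_prod_meas1 _ _ _ _ _ leb leb (EFin \o (f \_ Q))).
by rewrite -restrict_EFin; exact: (integrable_mkcond (EFin \o f) mQ).1.
Qed.

Lemma plane_tonelli_y Q f : measurable Q -> measurable_fun Q f ->
  (forall p, Q p -> 0 <= f p) ->
  (\int[mu2]_(p in Q) (f p)%:E = \int[leb]_y \int[leb]_x ((f \_ Q) (x, y))%:E)%E.
Proof.
move=> mQ mf f0; rewrite integral_mkcond restrict_EFin.
apply: (@fubini_tonelli2 _ _ _ _ _ leb leb (EFin \o (f \_ Q))).
  by apply/measurable_EFinP; apply/(measurable_restrictT f mQ).
by move=> p /=; rewrite lee_fin patchE; case: ifPn => // /set_mem /f0.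
Qed.

Lemma measurable_tonelli_y Q f : measurable Q -> measurable_fun Q f ->
  (forall p, Q p -> 0 <= f p) ->
  measurable_fun setT (fun y => (\int[leb]_x ((f \_ Q) (x, y))%:E)%E).
Proof.
move=> mQ mf f0.
apply: (@measurable_fun_fubini_tonelli_G _ _ _ _ _ leb (EFin \o (f \_ Q))).
  by apply/measurable_EFinP; apply/(measurable_restrictT f mQ).
by move=> p /=; rewrite lee_fin patchE; case: ifPn => // /set_mem /f0.
Qed.

Lemma integral_section_bound (F : measurableTypeR R -> \bar R) (B : R -> R) (a b : R) :
  measurable_fun setT F ->
  (forall t, ~ (a <= t <= b) -> F t = 0%E) ->
  leb.-integrable `[a, b] (EFin \o B) ->
  (forall t, a <= t <= b -> (`|F t| <= (B t)%:E)%E) ->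
  (`| \int[leb]_t F t | <= \int[leb]_(t in `[a, b]) (B t)%:E)%E.
Proof.
move=> mF F0 iB FB; apply: (le_trans (le_abse_integral _ measurableT mF)).
rewrite [leRHS]integral_mkcond; apply: ge0_le_integral => //.
- exact: measurableT_comp.
- apply/(measurable_restrictT (EFin \o B)) => /=; last exact: measurable_int iB.
  exact: measurable_itv.
- move=> t _; rewrite patchE; case: ifPn => [/set_mem /=|].
    by rewrite in_itv /= => /FB.
  by move=> /negP tab; rewrite F0 ?abse0 // => tab'; apply: tab; rewrite inE /= in_itv.
Qed.

Lemma integral_patch0 f Q (g : measurableTypeR R -> RR) :
  (forall t, ~ Q (g t)) -> (\int[leb]_t ((f \_ Q) (g t))%:E = 0)%E.
Proof.
move=> nQ; under eq_integral => t _ do rewrite patchE memNset //.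
exact: integral0.
Qed.

(** The absolute value stays outside the inner integral, so that the fundamental theorem of calculus
    can be applied on each section before anything is estimated. *)
Lemma plane_bound_y Q f (B : R -> R) c d : measurable Q -> integ mu2 Q f ->
  (forall p, Q p -> c <= p.2 <= d) ->
  leb.-integrable `[c, d] (EFin \o B) ->
  (forall y, c <= y <= d -> (`| \int[leb]_x ((f \_ Q) (x, y))%:E | <= (B y)%:E)%E) ->
  `| \int[mu2]_(p in Q) f p | <= \int[leb]_(y in `[c, d]) B y.
Proof.
move=> mQ hf Qcd iB hB.
rewrite -lee_fin EFin_normr_Rintegral // (integ_EFin _ iB) // plane_integral_y //.
apply: integral_section_bound => //.
  apply: (@measurable_fubini_G _ _ _ _ _ leb leb (EFin \o (f \_ Q))).
  by rewrite -restrict_EFin; exact: (integrable_mkcond (EFin \o f) mQ).1.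
move=> y ycd; apply: (@integral_patch0 _ _ (fun x => (x, y))) => x Qx.
by apply: ycd; exact: (Qcd _ Qx).
Qed.

(** Outside [[c, d]] the inner integral is assumed to vanish, rather than the section to be empty:
    between the tip of the inclusion and the side the vertical sections of the gap are full
    intervals on which the integral cancels. *)
Lemma plane_bound_x Q f (B : R -> R) c d : measurable Q -> integ mu2 Q f ->
  (forall x, ~ (c <= x <= d) -> (\int[leb]_y ((f \_ Q) (x, y))%:E = 0)%E) ->
  leb.-integrable `[c, d] (EFin \o B) ->
  (forall x, c <= x <= d -> (`| \int[leb]_y ((f \_ Q) (x, y))%:E | <= (B x)%:E)%E) ->
  `| \int[mu2]_(p in Q) f p | <= \int[leb]_(x in `[c, d]) B x.
Proof.
move=> mQ hf Q0 iB hB.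
rewrite -lee_fin EFin_normr_Rintegral // (integ_EFin _ iB) // plane_integral_x //.
apply: integral_section_bound => //.
apply: (@measurable_fubini_F _ _ _ _ _ leb leb (EFin \o (f \_ Q))).
by rewrite -restrict_EFin; exact: (integrable_mkcond (EFin \o f) mQ).1.
Qed.

Lemma plane_section_le Q f C c d : measurable Q -> measurable_fun Q f ->
  (forall p, Q p -> 0 <= f p) -> c <= d ->
  (forall p, Q p -> c <= p.2 <= d) ->
  (forall y, c <= y <= d -> (\int[leb]_x ((f \_ Q) (x, y))%:E <= C%:E)%E) ->
  (\int[mu2]_(p in Q) (f p)%:E <= (C * (d - c))%:E)%E.
Proof.
move=> mQ mf f0 cd Qcd hC; rewrite plane_tonelli_y //.
have Fge y : (0 <= \int[leb]_x ((f \_ Q) (x, y))%:E)%E.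
  by apply: integral_ge0 => x _; rewrite lee_fin patchE; case: ifPn => // /set_mem /f0.
have iC : leb.-integrable `[c, d] (EFin \o (fun=> C)).
  apply: (@integ_bounded _ _ _ _ _ _ _ `|C|) => //.
  by rewrite /= lebesgue_measure_segment // ltry.
have I0 : (0 <= \int[leb]_y \int[leb]_x ((f \_ Q) (x, y))%:E)%E.
  by apply: integral_ge0 => y _.
rewrite -(gee0_abs I0).
apply: (@le_trans _ _ (\int[leb]_(t in `[c, d]) C%:E)%E); last first.
  by rewrite integral_cst //= lebesgue_measure_segment // EFinM.
apply: integral_section_bound => //; first exact: measurable_tonelli_y.
  move=> y ycd; apply: (@integral_patch0 _ _ (fun x => (x, y))) => x Qx.
  by apply: ycd; exact: (Qcd _ Qx).
by move=> y ycd; rewrite gee0_abs // hC.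
Qed.

End PlaneFubini.

(** * Smooth functions of two variables *)

Section SmoothFunctions.
Context {R : realType}.
Implicit Types (f g : R * R -> R) (p : R * R) (i : 'I_2).

Definition pcoord i p : R := if i == ord0 then p.1 else p.2.
Definition line i p (t : R) : R * R := if i == ord0 then (t, p.2) else (p.1, t).

Lemma line_pcoord i p : line i p (pcoord i p) = p.
Proof. by case: p => x y; rewrite /line /pcoord; case: (i == ord0). Qed.

Let quotient_line i f p :
  (fun h : R => h^-1 *: ((f \o shift p) (h *: axis i) - f p)) =
  (fun h : R => h^-1 *: (((fun t => f (line i p t)) \o shift (pcoord i p)) (h *: 1) - f (line i p (pcoord i p)))).
Proof.
apply/funext => h; rewrite line_pcoord /line /pcoord /axis /=.
case: p => x y; case: ifP => _ /=.
  rewrite (_ : h *: (1, 0) + (x, y) = (h *: 1 + x, y)) //.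
  by congr pair; rewrite -[RHS]add0r -[in RHS](mulr0 h).
rewrite (_ : h *: (0, 1) + (x, y) = (x, h *: 1 + y)) //.
by congr pair; rewrite -[RHS]add0r -[in RHS](mulr0 h).
Qed.

(** Both sides have literally the same difference quotients ([quotient_line]), so one-variable rules
    transfer to partial derivatives without differentiability on the plane. *)
Lemma is_derive_lineP i f p l :
  is_derive p (axis i) f l <-> is_derive (pcoord i p) 1 (fun t => f (line i p t)) l.
Proof.
split => -[d e]; split.
- by move: d; rewrite /derivable quotient_line.
- by move: e; rewrite /derive quotient_line.
- by rewrite /derivable quotient_line.
- by rewrite /derive quotient_line.
Qed.

Lemma is_derive_partial n f p i : Cn n.+1 f -> is_derive p (axis i) f (partial i f p).
Proof. by move=> [_ /(_ i) [df _]]; exact: derivableP. Qed.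

Lemma Cn_continuous n f : Cn n f -> continuous f.
Proof. by case: n => [//|n [cf _]]. Qed.

Lemma Cn_partial n f i : Cn n.+1 f -> Cn n (partial i f).
Proof. by case=> _ /(_ i) []. Qed.

Definition has_partials f (g : 'I_2 -> R * R -> R) :=
  forall i p, is_derive p (axis i) f (g i p).

Lemma CnS n f (g : 'I_2 -> R * R -> R) : continuous f ->
  has_partials f g -> (forall i, Cn n (g i)) -> Cn n.+1 f.
Proof.
move=> cf dg Cg; split => // i; split => [p|]; first by case: (dg i p).
rewrite (_ : partial i f = g i) //; apply/funext => p.
by rewrite /partial; case: (dg i p).
Qed.

Lemma CnW n f : Cn n.+1 f -> Cn n f.
Proof.
elim: n f => [|n IH] f; first by case.
move=> [cf hf]; split => // i; have [df Cf] := hf i; split => //; exact: IH.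
Qed.

Lemma Cn_cst n (c : R) : Cn n (fun=> c).
Proof.
elim: n c => [|n IH] c; first by move=> p; exact: cvg_cst.
apply: (@CnS _ _ (fun _ _ => 0)) => [p|i p|i]; [exact: cvg_cst| |exact: IH].
exact: is_derive_cst.
Qed.

Lemma Cn_fst n : Cn n (fun p : R * R => p.1).
Proof.
case: n => [|n]; first by move=> p; exact: cvg_fst.
apply: (@CnS _ _ (fun i _ => if i == ord0 then 1 else 0)) => [p|i p|i]; [exact: cvg_fst| |].
  apply/is_derive_lineP; rewrite /line; case: ifP => _ /=; first exact: is_derive_id.
  exact: is_derive_cst.
exact: Cn_cst.
Qed.

Lemma Cn_snd n : Cn n (fun p : R * R => p.2).
Proof.
case: n => [|n]; first by move=> p; exact: cvg_snd.
apply: (@CnS _ _ (fun i _ => if i == ord0 then 0 else 1)) => [p|i p|i]; [exact: cvg_snd| |].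
  apply/is_derive_lineP; rewrite /line; case: ifP => _ /=; last exact: is_derive_id.
  exact: is_derive_cst.
exact: Cn_cst.
Qed.

Lemma CnD n f g : Cn n f -> Cn n g -> Cn n (fun p => f p + g p).
Proof.
elim: n f g => [|n IH] f g hf hg; first by move=> p; apply: cvgD; [exact: hf|exact: hg].
apply: (@CnS _ _ (fun i p => partial i f p + partial i g p)).
- by move=> p; apply: cvgD; [exact: (Cn_continuous hf)|exact: (Cn_continuous hg)].
- move=> i p; exact: (is_deriveD (is_derive_partial p i hf) (is_derive_partial p i hg)).
- by move=> i; apply: IH; exact: Cn_partial.
Qed.

Lemma CnM n f g : Cn n f -> Cn n g -> Cn n (fun p => f p * g p).
Proof.
elim: n f g => [|n IH] f g hf hg; first by move=> p; apply: cvgM; [exact: hf|exact: hg].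
apply: (@CnS _ _ (fun i p => f p * partial i g p + g p * partial i f p)).
- by move=> p; apply: cvgM; [exact: (Cn_continuous hf)|exact: (Cn_continuous hg)].
- move=> i p; exact: (is_deriveM (is_derive_partial p i hf) (is_derive_partial p i hg)).
- by move=> i; apply: CnD; apply: IH; [exact: CnW|exact: Cn_partial|exact: CnW|exact: Cn_partial].
Qed.

Lemma CnZ n c f : Cn n f -> Cn n (fun p => c * f p).
Proof. by move=> hf; apply: CnM => //; exact: Cn_cst. Qed.

Lemma CnN n f : Cn n f -> Cn n (fun p => - f p).
Proof. by move=> /(CnZ (-1)); under eq_fun do rewrite mulN1r. Qed.

Lemma CnB n f g : Cn n f -> Cn n g -> Cn n (fun p => f p - g p).
Proof. by move=> hf hg; apply: CnD => //; exact: CnN. Qed.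

Lemma CnX n k f : Cn n f -> Cn n (fun p => f p ^+ k).
Proof.
move=> hf; elim: k => [|k IH]; first by under eq_fun do rewrite expr0; exact: Cn_cst.
by under eq_fun do rewrite exprS; exact: CnM.
Qed.

(** The gradient of the inverse contains only the inverse and the gradient of [f], both already of
    class [n], so the induction closes. *)
Lemma CnV n f : (forall p, f p != 0) -> Cn n f -> Cn n (fun p => (f p)^-1).
Proof.
move=> f0; elim: n => [|n IH] hf; first by move=> p; apply: cvgV => //; exact: hf.
have hV : Cn n (fun p => (f p)^-1) by apply: IH; exact: CnW.
apply: (@CnS _ _ (fun i p => - ((f p)^-1 * (f p)^-1 * partial i f p))).
- by move=> p; apply: cvgV => //; exact: (Cn_continuous hf).
- move=> i p; have df := is_derive_partial p i hf.
  apply: (@DeriveDef _ _ _ _ _ (fun p => (f p)^-1)).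
    by apply: derivableV => //; case: df.
  by rewrite deriveV //; case: df => // _ ->; rewrite /GRing.scale /= -expr2 exprVn mulNr.
- by move=> i; apply: CnN; apply: CnM; [exact: CnM|exact: Cn_partial].
Qed.

Lemma Cn_sqrt n f : (forall p, 0 < f p) -> Cn n f -> Cn n (fun p => Num.sqrt (f p)).
Proof.
move=> f0; have c0 : continuous f -> continuous (fun p => Num.sqrt (f p)).
  by move=> cf p; apply: continuous_comp; [exact: cf|exact: sqrt_continuous].
elim: n => [|n IH] hf; first exact: c0.
have hs : Cn n (fun p => Num.sqrt (f p)) by apply: IH; exact: CnW.
apply: (@CnS _ _ (fun i p => (2 * Num.sqrt (f p))^-1 * partial i f p)).
- exact: (c0 (Cn_continuous hf)).
- move=> i p; apply/is_derive_lineP.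
  apply: (@is_derive1_comp _ Num.sqrt (fun t => f (line i p t))).
    by rewrite line_pcoord; exact: is_derive1_sqrt.
  by apply/is_derive_lineP; exact: is_derive_partial hf.
- move=> i; apply: CnM; last exact: Cn_partial.
  apply: CnV => [p|]; last exact: CnZ.
  by rewrite mulf_neq0 ?pnatr_eq0 // gt_eqF // sqrtr_gt0.
Qed.

Lemma partialE i f p l : is_derive p (axis i) f l -> partial i f p = l.
Proof. by case. Qed.

Lemma smooth_line_derive f i p (t : R) : smooth f ->
  is_derive t 1 (fun s => f (line i p s)) (partial i f (line i p t)).
Proof.
move=> /(_ 1%N) /(is_derive_partial (line i p t) i) /is_derive_lineP.
have -> : pcoord i (line i p t) = t by rewrite /pcoord /line; case: (i == ord0).
by have -> : line i (line i p t) = line i p by rewrite /line; case: (i == ord0).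
Qed.

End SmoothFunctions.

Section CurveComponents.
Context {R : realType}.
Implicit Types (c : R -> R * R) (t : R).

Lemma is_derive_fst c t : derivable c t 1 -> is_derive t 1 (fun s => (c s).1) (derive1 c t).1.
Proof.
move=> dc; have h : (fun h : R => h^-1 *: (((fun s => (c s).1) \o shift t) (h *: 1) - (c t).1)) @ 0^' --> (derive1 c t).1.
  rewrite derive1E.
  have cf : (fun p : R * R => p.1) @ ('D_1 c t) --> ('D_1 c t).1 by exact: cvg_fst.
  exact: (cvg_comp _ _ dc cf).
split; first by apply/cvg_ex; exists (derive1 c t).1.
exact: cvg_lim h.
Qed.

Lemma is_derive_snd c t : derivable c t 1 -> is_derive t 1 (fun s => (c s).2) (derive1 c t).2.
Proof.
move=> dc; have h : (fun h : R => h^-1 *: (((fun s => (c s).2) \o shift t) (h *: 1) - (c t).2)) @ 0^' --> (derive1 c t).2.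
  rewrite derive1E.
  have cf : (fun p : R * R => p.2) @ ('D_1 c t) --> ('D_1 c t).2 by exact: cvg_snd.
  exact: (cvg_comp _ _ dc cf).
split; first by apply/cvg_ex; exists (derive1 c t).2.
exact: cvg_lim h.
Qed.

End CurveComponents.

(** * Taylor remainders by repeated integration *)

Section Taylor.
Context {R : realType}.

(** The mean value theorem between 0 and [t] gains one power of [t]. The factor 1/(n+1) of exact
    integration is given up, so that the same constant survives repeated use. *)
Lemma integrate_bigO (f f' : R -> R) (C e : R) n :
  (forall t : R, `|t| <= e -> is_derive t 1 f (f' t)) -> f 0 = 0 ->
  (forall t : R, `|t| <= e -> `|f' t| <= C * `|t| ^+ n) ->
  forall t : R, `|t| <= e -> `|f t| <= C * `|t| ^+ n.+1.
Proof.
move=> df f0 hf' t te.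
have C0 : 0 <= C * `|t| ^+ n by exact: le_trans (hf' t te).
have key (c d : R) : c <= d -> `|c| <= `|t| -> `|d| <= `|t| -> `|f d - f c| <= (C * `|t| ^+ n) * (d - c).
  move=> cd ct dt.
  have cw : {within `[c, d], continuous f}.
    apply: derivable_within_continuous => x; rewrite in_itv /= => /andP[cx xd].
    suff: is_derive x 1 f (f' x) by case.
    apply: df; apply: le_trans te; rewrite ler_norml; move: ct dt; rewrite !ler_norml => /andP[? ?] /andP[? ?].
    by apply/andP; split; lra.
  have xle x : x \in `[c, d] -> `|x| <= `|t|.
    rewrite in_itv /= => /andP[cx xd]; move: ct dt; rewrite !ler_norml => /andP[? ?] /andP[? ?].
    by apply/andP; split; lra.
  have [x xcd|x xcd ->] := @MVT_segment R f f' c d cd _ cw.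
    apply: df; apply: le_trans te; apply: xle; exact: subset_itv_oo_cc.
  rewrite normrM (ger0_norm (_ : 0 <= d - c)) ?subr_ge0 // ler_wpM2r ?subr_ge0 //.
  have xt := xle x xcd.
  apply: (le_trans (hf' x (le_trans xt te))).
  (* [C0] yields [0 <= C] only when [t] is nonzero. *)
  have [t0|t0] := eqVneq t 0.
    by move: xt; rewrite t0 normr0 normr_le0 => /eqP ->; rewrite normr0.
  have Cge : 0 <= C by move: C0; rewrite pmulr_lge0 // exprn_gt0 // normr_gt0.
  by rewrite ler_wpM2l // lerXn2r ?nnegrE.
have -> : f t = f t - f 0 by rewrite f0 subr0.
have t00 : `|0 : R| <= `|t| by rewrite normr0.
have [t0|t0] := leP 0 t.
  by apply: (le_trans (key 0 t t0 t00 (lexx _))); rewrite subr0 exprSr mulrA (ger0_norm t0).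
rewrite distrC; apply: (le_trans (key t 0 (ltW t0) (lexx _) t00)).
by rewrite sub0r exprSr mulrA (ltr0_norm t0).
Qed.

Lemma continuous_locally_bounded (f : R -> R) (e : R) : continuous f ->
  exists C, forall t : R, `|t| <= e -> `|f t| <= C.
Proof.
move=> cf; have [e0|e0] := leP 0 e; last by exists 0 => t te; move: (le_lt_trans te e0); rewrite ltNge normr_ge0.
have cn : {within `[- e, e], continuous (fun t => `|f t|)}.
  by apply: continuous_subspaceT => x; apply: continuous_comp; [exact: cf|exact: norm_continuous].
have [c _ hc] := EVT_max (ltac:(lra) : - e <= e) cn.
by exists `|f c| => t; rewrite ler_norml => te; apply: hc; rewrite in_itv.
Qed.

End Taylor.

(** * Slices of the inclusion *)

Section ClosedSlices.
Context {R : realType}.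
Implicit Types (D K : set (R * R)).

Lemma continuous_pair (T : topologicalType) (f g : T -> R) : continuous f -> continuous g ->
  continuous (fun x => (f x, g x)).
Proof. by move=> cf cg x; apply: (cvg_pair (cf x) (cg x)). Qed.

Lemma closure_image_sub D (r : R * R -> R * R) : continuous r ->
  (forall p, D p -> D (r p)) -> forall p, closure D p -> closure D (r p).
Proof.
move=> cr rD p Kp B nB.
have /Kp[q [Dq Bq]] : nbhs p (r @^-1` B) by exact: cr.
by exists (r q); split => //; exact: rD.
Qed.

Lemma closure_le D (f : R * R -> R) M : continuous f ->
  (forall p, D p -> f p <= M) -> forall p, closure D p -> f p <= M.
Proof.
move=> cf fM p Kp; rewrite leNgt; apply/negP => Mf.
have /Kp[q [Dq /=]] : nbhs p (f @^-1` [set x | M < x]).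
  by apply: cf; apply: open_nbhs_nbhs; split => //; exact: open_gt.
by rewrite ltNge fM.
Qed.

Lemma closed_slice_sup K (c : R -> R * R) (M : R) : closed K -> continuous c ->
  [set x | K (c x)] !=set0 -> (forall x, K (c x) -> x <= M) ->
  K (c (sup [set x | K (c x)])).
Proof.
move=> cK cc ne hM.
have cl : closed (c @^-1` K) by apply: preimage_closed => // x; exact: cc.
have : closure (c @^-1` K) (sup [set x | K (c x)]).
  by apply: closure_sup => //; exists M => x; exact: hM.
by rewrite -(iffLR (closure_id _) cl).
Qed.

Lemma sup_ge (S : set R) (M x : R) : (forall y, S y -> y <= M) -> S x -> x <= sup S.
Proof. by move=> hM Sx; apply: sup_upper_bound => //; split; [exists x|exists M => y; exact: hM]. Qed.

End ClosedSlices.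

(** [vert] and [horiz] describe the upper and the right part of the boundary as graphs; the
    symmetries supply the other parts. Being suprema they are total functions, meaningful only where
    the slice is nonempty. *)
Definition vert {R : realType} (D : set (R * R)) (x : R) : R := sup [set y | closure D (x, y)].
Definition horiz {R : realType} (D : set (R * R)) (y : R) : R := sup [set x | closure D (x, y)].

Section InclusionGeometry.
Context {R : realType} (D : set (R * R)).
Hypothesis hD : inclusion D.
Notation K := (closure D).
Notation b := (xmax D).

Lemma inclusion_interior : interior D = D.
Proof. exact: (iffLR (interior_id _) (inclusion_open hD)). Qed.

Lemma closure_symm_y x y : K (x, y) -> K (- x, y).
Proof.
apply: (@closure_image_sub _ _ (fun p => (- p.1, p.2))) => [|[u v]].
  exact: (continuous_pair (Cn_continuous (CnN (Cn_fst 0))) (Cn_continuous (Cn_snd 0))).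
exact: (inclusion_symm_y hD).
Qed.

Lemma closure_symm_x x y : K (x, y) -> K (x, - y).
Proof.
apply: (@closure_image_sub _ _ (fun p => (p.1, - p.2))) => [|[u v]].
  exact: (continuous_pair (Cn_continuous (Cn_fst 0)) (Cn_continuous (CnN (Cn_snd 0)))).
exact: (inclusion_symm_x hD).
Qed.

Lemma closure_bounded : exists M : R, forall p, K p -> `|p.1| <= M /\ `|p.2| <= M.
Proof.
have [M [_ /(_ (M + 1))]] := inclusion_bounded hD.
rewrite ltrDl ltr01 => /(_ isT) hM; exists (M + 1) => p Kp; split.
  apply: (closure_le (f := fun p => `|p.1|) _ _ Kp) => [q|q /hM /=].
    by apply: continuous_comp; [exact: cvg_fst|exact: norm_continuous].
  by rewrite prod_normE ge_max => /andP[].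
apply: (closure_le (f := fun p => `|p.2|) _ _ Kp) => [q|q /hM /=].
  by apply: continuous_comp; [exact: cvg_snd|exact: norm_continuous].
by rewrite prod_normE ge_max => /andP[].
Qed.

Lemma closure_xmax p : K p -> p.1 <= b.
Proof.
move=> Kp; have [M hM] := closure_bounded.
apply: (@sup_ge _ _ M); last by exists p.
by move=> _ [q /hM[h _] <-]; exact: le_trans (ler_norm _) h.
Qed.

Lemma closure_ymax p : K p -> p.2 <= ymax D.
Proof.
move=> Kp; have [M hM] := closure_bounded.
apply: (@sup_ge _ _ M); last by exists p.
by move=> _ [q /hM[_ h] <-]; exact: le_trans (ler_norm _) h.
Qed.

Lemma segment_inclusion (x1 y1 x2 y2 t : R) : K (x1, y1) -> K (x2, y2) ->
  (x1, y1) <> (x2, y2) -> 0 < t < 1 -> D (t * x1 + (1 - t) * x2, t * y1 + (1 - t) * y2).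
Proof.
by move=> K1 K2 ne ht; have := inclusion_strictly_convex hD K1 K2 ne ht; rewrite inclusion_interior.
Qed.

Lemma horizontal_inclusion (x1 x2 x y : R) : K (x1, y) -> K (x2, y) -> x1 < x < x2 -> D (x, y).
Proof.
move=> K1 K2 /andP[h1 h2]; set t := (x2 - x) / (x2 - x1).
have ne : (x1, y) <> (x2, y) by case=> e; lra.
have ht : 0 < t < 1 by rewrite /t divr_gt0 ?ltr_pdivrMr ?mul1r //=; lra.
have := segment_inclusion K1 K2 ne ht.
have -> : t * x1 + (1 - t) * x2 = x by rewrite /t; field; lra.
by have -> : t * y + (1 - t) * y = y by ring.
Qed.

Lemma vertical_inclusion (y1 y2 x y : R) : K (x, y1) -> K (x, y2) -> y1 < y < y2 -> D (x, y).
Proof.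
move=> K1 K2 /andP[h1 h2]; set t := (y2 - y) / (y2 - y1).
have ne : (x, y1) <> (x, y2) by case=> e; lra.
have ht : 0 < t < 1 by rewrite /t divr_gt0 ?ltr_pdivrMr ?mul1r //=; lra.
have := segment_inclusion K1 K2 ne ht.
have -> : t * y1 + (1 - t) * y2 = y by rewrite /t; field; lra.
by have -> : t * x + (1 - t) * x = x by ring.
Qed.

Notation X := (horiz D).
Notation Y := (vert D).

Lemma horizN y : X (- y) = X y.
Proof.
congr sup; apply/seteqP; split => x /= /closure_symm_x //; by rewrite opprK.
Qed.

Lemma horiz_mem y : K (0, y) -> K (X y, y).
Proof.
move=> K0; have [M hM] := closure_bounded.
apply: (@closed_slice_sup _ K (fun x => (x, y)) M).
- exact: closed_closure.
- by apply: continuous_pair => x; [exact: cvg_id|exact: cvg_cst].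
- by exists 0.
- by move=> x /hM[h _]; exact: le_trans (ler_norm _) h.
Qed.

Lemma horiz_ge x y : K (x, y) -> x <= X y.
Proof.
move=> Kp; have [M hM] := closure_bounded.
by apply: (@sup_ge _ _ M) => // z /hM[h _]; exact: le_trans (ler_norm _) h.
Qed.

Lemma vert_mem x : K (x, 0) -> K (x, Y x).
Proof.
move=> K0; have [M hM] := closure_bounded.
apply: (@closed_slice_sup _ K (fun y => (x, y)) M).
- exact: closed_closure.
- by apply: continuous_pair => y; [exact: cvg_cst|exact: cvg_id].
- by exists 0.
- by move=> y /hM[_ h]; exact: le_trans (ler_norm _) h.
Qed.

Lemma vert_ge x y : K (x, y) -> y <= Y x.
Proof.
move=> Kp; have [M hM] := closure_bounded.
by apply: (@sup_ge _ _ M) => // z /hM[_ h]; exact: le_trans (ler_norm _) h.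
Qed.

Lemma inclusion_closure p : D p -> K p.
Proof. by move=> Dp; exact: subset_closure. Qed.

(** Convexity makes the slice an interval, and the reflection in the y-axis makes it symmetric. *)
Lemma horiz_closureP x y : K (0, y) -> K (x, y) <-> `|x| <= X y.
Proof.
move=> K0; split => [Kx|].
  by rewrite ler_norml; have := horiz_ge Kx; have := horiz_ge (closure_symm_y Kx); lra.
have Kp := horiz_mem K0; have Km := closure_symm_y Kp.
rewrite ler_norml => /andP[h1 h2].
have [->//|n1] := eqVneq x (X y); have [->//|n2] := eqVneq x (- X y).
apply: inclusion_closure; apply: (horizontal_inclusion Km Kp).
by rewrite !lt_neqAle n1 h1 h2 eq_sym n2.
Qed.

Lemma vert_closureP x y : K (x, 0) -> K (x, y) <-> `|y| <= Y x.
Proof.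
move=> K0; split => [Kx|].
  by rewrite ler_norml; have := vert_ge Kx; have := vert_ge (closure_symm_x Kx); lra.
have Kp := vert_mem K0; have Km := closure_symm_x Kp.
rewrite ler_norml => /andP[h1 h2].
have [->//|n1] := eqVneq y (Y x); have [->//|n2] := eqVneq y (- Y x).
apply: inclusion_closure; apply: (vertical_inclusion Km Kp).
by rewrite !lt_neqAle n1 h1 h2 eq_sym n2.
Qed.

(** Strict convexity puts every point strictly between the two ends of the slice into [D], so a
    boundary point is an end. *)
Lemma boundary_horiz x y : K (0, y) -> K (x, y) -> ~ D (x, y) -> `|x| = X y.
Proof.
move=> K0 Kx nD; apply/eqP; rewrite eq_le ((horiz_closureP x K0).1 Kx) leNgt.
apply/negP; rewrite ltr_norml => h; apply: nD.
by apply: (horizontal_inclusion (closure_symm_y (horiz_mem K0)) (horiz_mem K0)).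
Qed.

Lemma boundary_vert x y : K (x, 0) -> K (x, y) -> ~ D (x, y) -> `|y| = Y x.
Proof.
move=> K0 Kx nD; apply/eqP; rewrite eq_le ((vert_closureP y K0).1 Kx) leNgt.
apply/negP; rewrite ltr_norml => h; apply: nD.
by apply: (vertical_inclusion (closure_symm_x (vert_mem K0)) (vert_mem K0)).
Qed.

(** By convexity and symmetry the condition at [h] spreads to all heights [|y| <= h]: each such
    slice meets the y-axis inside [D], so [horiz] is attained and positive there. *)
Definition good_height (h : R) := 0 < h /\ D (0, h).

Lemma good_height_exists : exists h, good_height h.
Proof.
have := open_nbhs_nbhs (conj (inclusion_open hD) (inclusion_origin hD)).
move=> /nbhs_ballP[e /= e0 eD]; exists (e / 2); split; first lra.
by apply: eD; split; rewrite /ball /= ?subrr ?normr0 // sub0r normrN ger0_norm; lra.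
Qed.

Lemma good_height_axis h y : good_height h -> `|y| <= h -> D (0, y).
Proof.
move=> [h0 Dh]; rewrite ler_norml => /andP[h1 h2].
have Dm := inclusion_symm_x hD Dh.
have [->//|n1] := eqVneq y h; have [->//|n2] := eqVneq y (- h).
apply: (vertical_inclusion (inclusion_closure Dm) (inclusion_closure Dh)).
by rewrite !lt_neqAle n1 h1 h2 eq_sym n2.
Qed.

Lemma good_heightW h h' : good_height h -> 0 < h' <= h -> good_height h'.
Proof.
move=> gh /andP[h0 hh]; split => //; apply: (good_height_axis gh).
by rewrite gtr0_norm.
Qed.

Lemma interior_room x y : D (x, y) -> exists2 d, 0 < d & D (x + d, y).
Proof.
move=> Dp; have := open_nbhs_nbhs (conj (inclusion_open hD) Dp).
move=> /nbhs_ballP[e /= e0 eD]; exists (e / 2); first lra.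
apply: eD; split; rewrite /ball /= ?subrr ?normr0 //.
by rewrite opprD addNKr normrN ger0_norm; lra.
Qed.

Lemma horiz_gt x y : D (x, y) -> x < X y.
Proof.
move=> /interior_room[d d0 /inclusion_closure /horiz_ge]; lra.
Qed.

Hypothesis hb : K (b, 0).

Lemma xmax_not_interior : ~ D (b, 0).
Proof. by move=> /interior_room[d d0 /inclusion_closure /closure_xmax /=]; lra. Qed.

Lemma horiz0 : X 0 = b.
Proof.
apply/eqP; rewrite eq_le; have := horiz_ge hb => ->; rewrite andbT.
have K0 : K (0, 0) by apply: inclusion_closure; exact: inclusion_origin.
exact: closure_xmax (horiz_mem K0).
Qed.

Lemma xmax_gt0 : 0 < b.
Proof. by rewrite -horiz0; apply: horiz_gt; exact: inclusion_origin. Qed.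

(** The chord from [(X y2, y2)] to the tip [(b, 0)] crosses height [y1] inside [D], at an abscissa
    not smaller than [X y2]; openness of [D] leaves room beyond it. *)
Lemma horiz_decreasing h y1 y2 : good_height h -> 0 <= y1 -> y1 < y2 -> y2 <= h -> X y2 < X y1.
Proof.
move=> gh y10 y12 y2h.
have K2 : K (0, y2).
  by apply: inclusion_closure; apply: (good_height_axis gh); rewrite ger0_norm //; lra.
have Kp := horiz_mem K2.
have Xb : X y2 <= b := closure_xmax Kp.
(* Otherwise [(b, y2)] and its mirror image lie in the closure, and strict convexity makes the tip
   an interior point. *)
have Xb' : X y2 < b.
  rewrite lt_neqAle Xb andbT; apply/eqP => e; apply: xmax_not_interior.
  rewrite e in Kp; apply: (vertical_inclusion (closure_symm_x Kp) Kp); lra.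
have [->|y1n] := eqVneq y1 0; first by rewrite horiz0.
have y1p : 0 < y1 by rewrite lt_neqAle eq_sym y1n.
set t := y1 / y2.
have t01 : 0 < t < 1 by rewrite /t divr_gt0 ?ltr_pdivrMr ?mul1r //=; lra.
have ne : (X y2, y2) <> (b, 0) by case=> _; lra.
have := segment_inclusion Kp hb ne t01.
have -> : t * y2 + (1 - t) * 0 = y1 by rewrite /t; field; lra.
move=> /horiz_gt; apply: le_lt_trans.
have : 0 <= (1 - t) * (b - X y2) by apply: mulr_ge0; lra.
lra.
Qed.

Lemma horiz_norm y : X `|y| = X y.
Proof. by have [h|h] := leP 0 y; [rewrite ger0_norm|rewrite ltr0_norm // horizN]. Qed.

Lemma horiz_pos h y : good_height h -> `|y| <= h -> 0 < X y.
Proof. by move=> gh yh; apply: horiz_gt; exact: good_height_axis gh yh. Qed.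

Lemma vert_lt h x : good_height h -> X h < x <= b -> 0 <= Y x < h.
Proof.
move=> gh /andP[hx xb]; have [h0 Dh] := gh.
have X0 : 0 < X h by exact: horiz_gt.
have K0 : K (x, 0).
  apply: ((horiz_closureP x _).2); first by apply: inclusion_closure; exact: inclusion_origin.
  by rewrite horiz0 ger0_norm //; lra.
rewrite (le_trans (normr_ge0 0) (((vert_closureP 0 K0).1 K0))) /= ltNge.
apply/negP => hY.
have : K (x, h) by apply: (vert_closureP _ K0).2; rewrite gtr0_norm.
by move=> /horiz_ge; lra.
Qed.

Lemma axis_closure h x : good_height h -> X h < x <= b -> K (x, 0).
Proof.
move=> [_ /horiz_gt X0] /andP[hx xb].
apply: ((horiz_closureP x _).2); first by apply: inclusion_closure; exact: inclusion_origin.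
by rewrite horiz0 ger0_norm //; lra.
Qed.

End InclusionGeometry.

(** * The boundary near its rightmost point *)

Section TaylorExpansion.
Context {R : realType} (f : nat -> R -> R).
Hypothesis df : forall n (u : R), is_derive u 1 (f n) (f n.+1 u).

Lemma taylor3 : continuous (f 3) -> exists2 C, 0 < C &
  forall u, `|u| <= 1 -> `|f 0 u - (f 0 0 + f 1 0 * u + f 2 0 * u ^+ 2 / 2)| <= C * `|u| ^+ 3.
Proof.
move=> cf; have [M hM] := continuous_locally_bounded 1 cf.
exists (`|M| + 1); first by have := normr_ge0 M; lra.
have h3 t : `|t| <= 1 -> `|f 3 t| <= (`|M| + 1) * `|t| ^+ 0.
  by move=> /hM; rewrite expr0 mulr1; have := ler_norm M; lra.
have h2 : forall t, `|t| <= 1 -> `|f 2 t - f 2 0| <= (`|M| + 1) * `|t| ^+ 1.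
  apply: (@integrate_bigO _ (fun t => f 2 t - f 2 0) (f 3)) => //; last by rewrite subrr.
  by move=> t _; apply: (is_derive_eq (is_deriveB (df 2 t) (is_derive_cst (f 2 0) t 1))); rewrite subr0.
have h1 : forall t, `|t| <= 1 -> `|f 1 t - (f 1 0 + f 2 0 * t)| <= (`|M| + 1) * `|t| ^+ 2.
  apply: (@integrate_bigO _ (fun t => f 1 t - (f 1 0 + f 2 0 * t)) (fun t => f 2 t - f 2 0)) => //; last by rewrite mulr0 addr0 subrr.
  move=> t _; apply: (is_derive_eq (is_deriveB (df 1 t) (is_deriveD (is_derive_cst (f 1 0) t 1) (is_deriveZ (f 2 0) (is_derive_id t 1))))).
  by rewrite /GRing.scale /= mulr1 add0r.
apply: (@integrate_bigO _ (fun t => f 0 t - (f 0 0 + f 1 0 * t + f 2 0 * t ^+ 2 / 2)) (fun t => f 1 t - (f 1 0 + f 2 0 * t))) => //; last first.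
  by rewrite expr0n !mulr0 mul0r !addr0 subrr.
move=> t _.
have -> : (fun t => f 0 t - (f 0 0 + f 1 0 * t + f 2 0 * t ^+ 2 / 2)) =
  (fun t => f 0 t - (f 0 0 + f 1 0 * t + (f 2 0 / 2) * (t * t))).
  by apply/funext => u; ring.
apply: (is_derive_eq (is_deriveB (df 0 t) (is_deriveD (is_deriveD (is_derive_cst (f 0 0) t 1) (is_deriveZ (f 1 0) (is_derive_id t 1)))
  (is_deriveZ (f 2 0 / 2) (is_deriveM (is_derive_id t 1) (is_derive_id t 1)))))).
by rewrite /GRing.scale /= !mulr1; field.
Qed.

End TaylorExpansion.

Lemma taylor4 {R : realType} (f : nat -> R -> R) :
  (forall n (u : R), is_derive u 1 (f n) (f n.+1 u)) -> continuous (f 4) -> exists2 C, 0 < C &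
  forall u, `|u| <= 1 ->
    `|f 0 u - (f 0 0 + f 1 0 * u + f 2 0 * u ^+ 2 / 2 + f 3 0 * u ^+ 3 / 6)| <= C * `|u| ^+ 4.
Proof.
move=> df cf; have [C C0 hC] := @taylor3 R (fun n => f n.+1) (fun n => df n.+1) cf.
exists C => //.
apply: (@integrate_bigO _ (fun t => f 0 t - (f 0 0 + f 1 0 * t + f 2 0 * t ^+ 2 / 2 + f 3 0 * t ^+ 3 / 6)) (fun t => f 1 t - (f 1 0 + f 2 0 * t + f 3 0 * t ^+ 2 / 2))) => //; last first.
  by rewrite !expr0n !mulr0 !mul0r !addr0 subrr.
move=> t _.
have -> : (fun t => f 0 t - (f 0 0 + f 1 0 * t + f 2 0 * t ^+ 2 / 2 + f 3 0 * t ^+ 3 / 6)) =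
  (fun t => f 0 t - (f 0 0 + f 1 0 * t + (f 2 0 / 2) * (t * t) + (f 3 0 / 6) * (t * (t * t)))).
  by apply/funext => u; ring.
have dt := is_derive_id t (1 : R).
apply: (is_derive_eq (is_deriveB (df 0 t) (is_deriveD (is_deriveD (is_deriveD (is_derive_cst (f 0 0) t 1) (is_deriveZ (f 1 0) dt))
  (is_deriveZ (f 2 0 / 2) (is_deriveM dt dt))) (is_deriveZ (f 3 0 / 6) (is_deriveM dt (is_deriveM dt dt)))))).
by rewrite (_ : (id * id) t = t * t) // /GRing.scale /= !mulr1; field.
Qed.

(* The cubic coefficient is cancelled by the symmetry [X (- y) = X y]. *)
Lemma even_expansion {R : realType} (X P Q : R -> R) (b kappa a sg C4 C3 h0 e : R) :
  `|sg| = 1 -> continuous Q -> 0 < kappa -> 0 < C4 -> 0 < C3 -> 0 < h0 -> 0 < e -> e <= 1 ->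
  (forall u, `|u| <= 1 -> `|P u - (b - kappa * u ^+ 2 / 2 + a * u ^+ 3)| <= C4 * `|u| ^+ 4) ->
  (forall u, `|u| <= 1 -> `|Q u - sg * u| <= C3 * `|u| ^+ 3) ->
  (forall u, `|u| <= e -> `|Q u| <= h0 -> P u = X (Q u)) ->
  (forall y, X (- y) = X y) ->
  exists C h : R, [/\ 0 < C, 0 < h, h <= h0 &
    forall y, `|y| <= h -> `|X y - (b - kappa * y ^+ 2 / 2)| <= C * y ^+ 4].
Proof.
move=> sg1 cQ k0 C40 C30 h00 e0 e1 hP hQ hX Xe.
have sg2 : sg * sg = 1 by rewrite -expr2 -real_normK ?num_real // sg1 expr1n.
(* This choice gives [C3 * f ^+ 2 <= 1 / 2], so the cubic error of [Q] is at most half of its linear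
   part. *)
pose f := Num.min e (2 * C3 + 1)^-1.
have f0 : 0 < f by rewrite lt_min e0 invr_gt0; lra.
have fe : f <= e by rewrite ge_min lexx.
have fC : C3 * f ^+ 2 <= 1 / 2.
  have h1 : f * (2 * C3 + 1) <= 1.
    by rewrite -ler_pdivlMr ?div1r; [rewrite ge_min lexx orbT|lra].
  have : f * (f * (2 * C3 + 1)) <= f * 1 by rewrite ler_pM2l.
  nra.
have near u : `|u| <= f -> `|Q u - sg * u| <= `|u| / 2.
  move=> uf; apply: (le_trans (hQ u _)); first lra.
  have := normr_ge0 u => n0.
  have : `|u| ^+ 2 <= f ^+ 2 by rewrite lerXn2r ?nnegrE //; lra.
  move=> h2; have : C3 * `|u| ^+ 2 <= 1 / 2.
    by apply: le_trans fC; rewrite ler_pM2l.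
  move=> h3; have : (C3 * `|u| ^+ 2) * `|u| <= 1 / 2 * `|u| by rewrite ler_wpM2r.
  by rewrite -mulrA -exprSr; lra.
pose h := Num.min h0 (f / 2).
have h_gt0 : 0 < h by rewrite lt_min h00 /=; lra.
have hh0 : h <= h0 by rewrite ge_min lexx.
have hf : h <= f / 2 by rewrite ge_min lexx orbT.
(* At [f] and [- f] the values of [Q] have opposite signs and size at least [f / 2], which is why
   [h] is at most [f / 2]; the intermediate value theorem does the rest. *)
have solve y : `|y| <= h -> exists2 u, `|u| <= f & Q u = y.
  move=> yh.
  have fn : `|f| <= f by rewrite gtr0_norm.
  have fn' : `|- f| <= f by rewrite normrN gtr0_norm.
  have := near _ fn; have := near _ fn'; rewrite normrN (gtr0_norm f0) !ler_norml.
  move=> /andP[a1 a2] /andP[a3 a4].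
  have cw : {within `[- f, f], continuous Q} by exact: continuous_subspaceT.
  have [||u] := @IVT _ Q (- f) f y _ cw.
  - lra.
  - move: yh; rewrite ler_norml => /andP[y1 y2]; rewrite ge_min le_max.
    have [s0|s0] : sg = 1 \/ sg = -1.
      by move: sg1; case: (leP 0 sg) => s0; [rewrite ger0_norm //; left|rewrite ltr0_norm //; right; lra].
    + by apply/andP; split; apply/orP; [left|right]; rewrite s0 in a1 a2 a3 a4; lra.
    + by apply/andP; split; apply/orP; [right|left]; rewrite s0 in a1 a2 a3 a4; lra.
  - by rewrite in_itv /= => uf Qu; exists u => //; rewrite ler_norml.
(* The 8 comes from [|u| <= 2 * |y|] in the cubic remainder of [Q]. *)
pose D := 8 * C3; have D0 : 0 < D by rewrite /D; lra.
pose C := 16 * C4 + 2 * kappa * D + 7 * `|a| * D.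
have C0 : 0 < C by rewrite /C; have := mulr_ge0 (normr_ge0 a) (ltW D0); nra.
have est y : `|y| <= h -> `|X y - (b - kappa * y ^+ 2 / 2 + a * (sg * y) ^+ 3)| <= C * y ^+ 4.
  move=> yh; have [u uf Qu] := solve y yh.
  have n_u := normr_ge0 u; have n_y := normr_ge0 y.
  have un : `|sg * u| = `|u| by rewrite normrM sg1 mul1r.
  have u2y : `|u| <= 2 * `|y|.
    have := near u uf; rewrite Qu => h1.
    have := ler_normD (sg * u - y) y; rewrite subrK distrC un => h2; lra.
  pose w := sg * y.
  have wn : `|w| = `|y| by rewrite normrM sg1 mul1r.
  have w2 : w ^+ 2 = y ^+ 2 by rewrite exprMn expr2 sg2 mul1r.
  have uw : `|u - w| <= D * `|y| ^+ 3.
    have := hQ u; rewrite Qu (_ : y - sg * u = sg * (w - u)); last by rewrite /w mulrBr mulrA sg2 mul1r.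
    rewrite normrM sg1 mul1r distrC => /(_ _) h1; apply: (le_trans (h1 _)); first lra.
    have : `|u| ^+ 3 <= (2 * `|y|) ^+ 3 by rewrite lerXn2r ?nnegrE //; lra.
    rewrite -(ler_pM2l C30) => /le_trans; apply; rewrite /D exprMn; lra.
  (* Replacing [u] by [w = sg * y] costs a factor [u - w], which is cubic in [y] because [Q] has no
     quadratic term. The other factor contributes at least one further power, so the total stays
     quartic. *)
  have -> : X y - (b - kappa * y ^+ 2 / 2 + a * (sg * y) ^+ 3) =
    (P u - (b - kappa * u ^+ 2 / 2 + a * u ^+ 3)) - kappa / 2 * ((u - w) * (u + w))
      + a * ((u - w) * (u ^+ 2 + u * w + w ^+ 2)).
    have -> : X y = P u by rewrite hX ?Qu //; lra.
    by rewrite -/w -w2; field.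
  apply: (le_trans (ler_normD _ _)); apply: (le_trans (lerD (ler_normB _ _) (lexx _))).
  have e4 : y ^+ 4 = `|y| ^+ 4 by rewrite -normrX ger0_norm // (exprM y 2 2) sqr_ge0.
  have b1 : `|P u - (b - kappa * u ^+ 2 / 2 + a * u ^+ 3)| <= 16 * C4 * y ^+ 4.
    apply: (le_trans (hP u _)); first lra.
    have : `|u| ^+ 4 <= (2 * `|y|) ^+ 4 by rewrite lerXn2r ?nnegrE //; lra.
    rewrite -(ler_pM2l C40) exprMn e4; lra.
  have b2 : `|(u - w) * (u + w)| <= D * `|y| ^+ 3 * (3 * `|y|).
    rewrite normrM; apply: ler_pM => //.
    by apply: (le_trans (ler_normD _ _)); lra.
  have b3 : `|(u - w) * (u ^+ 2 + u * w + w ^+ 2)| <= D * `|y| ^+ 3 * (7 * `|y|).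
    rewrite normrM; apply: ler_pM => //.
    apply: (le_trans (ler_normD _ _)); apply: (le_trans (lerD (ler_normD _ _) (lexx _))).
    rewrite !normrX normrM wn.
    have y1 : `|y| <= 1 by lra.
    have : `|u| ^+ 2 <= (2 * `|y|) ^+ 2 by rewrite lerXn2r ?nnegrE //; lra.
    have : `|u| * `|y| <= (2 * `|y|) * `|y| by rewrite ler_wpM2r.
    have : `|y| * `|y| <= `|y| * 1 by rewrite ler_wpM2l.
    rewrite !expr2; nra.
  have b2' : `|kappa / 2 * ((u - w) * (u + w))| <= kappa / 2 * (D * `|y| ^+ 3 * (3 * `|y|)).
    by rewrite normrM gtr0_norm ?divr_gt0 // ler_pM2l ?divr_gt0.
  have b3' : `|a * ((u - w) * (u ^+ 2 + u * w + w ^+ 2))| <= `|a| * (D * `|y| ^+ 3 * (7 * `|y|)).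
    by rewrite normrM ler_wpM2l.
  apply: (le_trans (lerD (lerD b1 b2') b3')).
  have : 0 <= kappa * (D * `|y| ^+ 4) by apply: mulr_ge0; [exact: ltW|apply: mulr_ge0; [exact: ltW|exact: exprn_ge0]].
  rewrite e4 /C !exprS expr0; lra.
(* Subtracting the estimates at [y] and [- y] leaves [|a| * y ^+ 3 <= C * y ^+ 4], which fails for
   [y <= |a| / (2 * C)] unless [a] is zero. *)
have a0 : a = 0.
  apply/eqP; rewrite -normr_le0 leNgt; apply/negP => a_gt0.
  pose y := Num.min h (`|a| / (2 * C)).
  have y0 : 0 < y by rewrite lt_min h_gt0 divr_gt0 // mulr_gt0.
  have yh : `|y| <= h by rewrite gtr0_norm // ge_min lexx.
  have yC : y * (2 * C) <= `|a| by rewrite -ler_pdivlMr ?mulr_gt0 // ge_min lexx orbT.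
  have yh' : `|- y| <= h by rewrite normrN.
  have := lerD (est _ yh) (est _ yh').
  rewrite Xe => h1.
  have := le_trans (ler_normB _ _) h1.
  rewrite (_ : _ - _ - _ = - (2 * a * (sg * y) ^+ 3)); last by rewrite mulrN sqrrN exprNn -signr_odd /=; ring.
  rewrite normrN (normrM (2 * a)) normrX (normrM sg) sg1 mul1r (gtr0_norm y0) (normrM 2) normr_nat.
  rewrite (_ : (- y) ^+ 4 = y ^+ 4); last by ring.
  move=> h2; have y3 : 0 < y ^+ 3 by rewrite exprn_gt0.
  have h3 : `|a| * y ^+ 3 <= C * y * y ^+ 3 by move: h2; rewrite (exprS y 3); lra.
  move: h3; rewrite ler_pM2r // => h3; lra.
exists C, h; split => // y yh.
by have := est y yh; rewrite a0 mul0r addr0.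
Qed.

Section BoundaryCurve.
Context {R : realType} (D : set (R * R)) (gamma : R -> R * R) (T : R).
Hypothesis hD : inclusion D.
Hypothesis hgamma : boundary_param D gamma T.
Notation K := (closure D).
Notation b := (xmax D).
Notation X := (horiz D).
Notation Y := (vert D).

Definition curve1 n t : R := (derive1n n gamma t).1.
Definition curve2 n t : R := (derive1n n gamma t).2.

Lemma is_derive_curve1 n (t : R) : is_derive t 1 (curve1 n) (curve1 n.+1 t).
Proof.
have h := is_derive_fst (@boundary_smooth _ _ _ _ hgamma n t).
by rewrite -derive1nS in h.
Qed.

Lemma is_derive_curve2 n (t : R) : is_derive t 1 (curve2 n) (curve2 n.+1 t).
Proof.
have h := is_derive_snd (@boundary_smooth _ _ _ _ hgamma n t).
by rewrite -derive1nS in h.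
Qed.

Lemma continuous_curve1 n : continuous (curve1 n).
Proof.
by move=> t; apply/differentiable_continuous/derivable1_diffP; case: (is_derive_curve1 n t).
Qed.

Lemma continuous_curve2 n : continuous (curve2 n).
Proof.
by move=> t; apply/differentiable_continuous/derivable1_diffP; case: (is_derive_curve2 n t).
Qed.

Lemma curve_unit_speed t : curve1 1 t ^+ 2 + curve2 1 t ^+ 2 = 1.
Proof. exact: (boundary_unit_speed hgamma). Qed.

Lemma curveE t : gamma t = (curve1 0 t, curve2 0 t).
Proof. by rewrite /curve1 /curve2 /=; case: (gamma t). Qed.

Lemma curve_boundary t : K (curve1 0 t, curve2 0 t) /\ ~ D (curve1 0 t, curve2 0 t).
Proof.
have : range gamma (gamma t) by exists t.
by rewrite (boundary_range hgamma) inclusion_interior // -curveE.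
Qed.

Lemma curve1_le t : curve1 0 t <= b.
Proof. by have [Kt _] := curve_boundary t; exact: (closure_xmax hD Kt). Qed.

Lemma curve_horiz h t : good_height D h -> `|curve2 0 t| <= h -> `|curve1 0 t| = X (curve2 0 t).
Proof.
move=> gh th; have [Kt nD] := curve_boundary t.
apply: boundary_horiz => //; apply: inclusion_closure; exact: (good_height_axis hD gh).
Qed.

Section Taylor.
Variables (t0 kappa : R).
Hypothesis ht0 : gamma t0 = (b, 0).
Hypothesis hkappa : kappa = curvature gamma t0.
Hypothesis kappa_gt0 : 0 < kappa.

Lemma xmax_closure : K (b, 0).
Proof. by have [] := curve_boundary t0; rewrite -curveE ht0. Qed.

Let p n u := curve1 n (t0 + u).
Let q n u := curve2 n (t0 + u).

Lemma is_derive_addl (f : R -> R) (c u l : R) : is_derive (c + u) 1 f l -> is_derive u 1 (fun v => f (c + v)) l.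
Proof.
move=> df; have dg : is_derive u 1 (fun v : R => c + v) (0 + 1).
  by apply: (is_deriveD (is_derive_cst c u 1) (is_derive_id u 1)).
by have := @is_derive1_comp _ f (fun v => c + v) u l _ df dg; rewrite add0r mulr1.
Qed.

Let dp n (u : R) : is_derive u 1 (p n) (p n.+1 u).
Proof. exact: is_derive_addl (is_derive_curve1 n (t0 + u)). Qed.

Let dq n (u : R) : is_derive u 1 (q n) (q n.+1 u).
Proof. exact: is_derive_addl (is_derive_curve2 n (t0 + u)). Qed.

Let cp n : continuous (p n).
Proof. by move=> t; apply/differentiable_continuous/derivable1_diffP; case: (dp n t). Qed.

Let cq n : continuous (q n).
Proof. by move=> t; apply/differentiable_continuous/derivable1_diffP; case: (dq n t). Qed.

Let p00 : p 0 0 = b.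
Proof. by rewrite /p addr0 /curve1 /= ht0. Qed.

Let q00 : q 0 0 = 0.
Proof. by rewrite /q addr0 /curve2 /= ht0. Qed.

Let p10 : p 1 0 = 0.
Proof.
have h : is_derive (0 : R) 1 (p 0) 0.
  apply: (@derive1_at_max _ (p 0) (- 1) 1 0); first lra.
  - by move=> t _; case: (dp 0 t).
  - by rewrite in_itv /=; apply/andP; split; lra.
  - by move=> t _; rewrite p00; exact: curve1_le.
have [_ <-] := dp 0 0; by have [_ ->] := h.
Qed.

Let q10 : q 1 0 ^+ 2 = 1.
Proof. by have := curve_unit_speed (t0 + 0); rewrite -/(p 1 0) -/(q 1 0) p10 expr0n add0r. Qed.

Let q20 : q 2 0 = 0.
Proof.
have h1 : is_derive (0 : R) 1 (fun u => p 1 u * p 1 u + q 1 u * q 1 u)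
    ((p 1 0 *: p 2 0 + p 1 0 *: p 2 0) + (q 1 0 *: q 2 0 + q 1 0 *: q 2 0)).
  exact: (is_deriveD (is_deriveM (dp 1 0) (dp 1 0)) (is_deriveM (dq 1 0) (dq 1 0))).
have e : (fun u => p 1 u * p 1 u + q 1 u * q 1 u) = cst 1.
  by apply/funext => u; rewrite -!expr2; exact: curve_unit_speed.
rewrite e in h1.
have [_ e1] := h1; have [_ e2] := is_derive_cst (1 : R) (0 : R) (1 : R).
move: e1; rewrite e2 p10 !scale0r !add0r -mulr2n => /esym/eqP.
rewrite mulrn_eq0 /= mulf_eq0 => /orP[/eqP e3|/eqP //].
by move: q10; rewrite e3 expr0n => /eqP; rewrite eq_sym oner_eq0.
Qed.

Let p20 : p 2 0 = - kappa \/ p 2 0 = kappa.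
Proof.
have : kappa ^+ 2 = p 2 0 ^+ 2.
  rewrite hkappa /curvature -(addr0 t0) -/(curve1 1 _) -/(curve2 1 _) real_normK ?num_real //.
  rewrite -/(curve1 2 (t0 + 0)) -/(curve2 2 (t0 + 0)) -/(p 1 0) -/(q 1 0) -/(p 2 0) -/(q 2 0).
  by rewrite p10 mul0r sub0r sqrrN exprMn q10 mul1r.
move=> /eqP; rewrite eq_sym eqf_sqr => /orP[/eqP ->|/eqP ->]; [by right|by left].
Qed.

(** At the rightmost point the x-component has zero first derivative, so the y-component has speed 1
    in absolute value and, differentiating the unit-speed relation, zero second derivative; the
    curvature is then the modulus of the second derivative of the x-component. Eliminating the
    parameter gives the graph. *)
Lemma horiz_taylor : exists C h : R, [/\ 0 < C, good_height D h &
  forall y, `|y| <= h -> `|X y - (b - kappa * y ^+ 2 / 2)| <= C * y ^+ 4].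
Proof.
have [C4 C40 t4] := taylor4 dp (cp (n := 4)).
have [C3 C30 t3] := taylor3 dq (cq (n := 3)).
have [C3p C3p0 t3p] := taylor3 dp (cp (n := 3)).
rewrite p00 p10 in t4 t3p; rewrite q00 q20 in t3.
have sg1 : `|q 1 0| = 1 by apply/eqP; rewrite -(@eqrXn2 _ 2) // expr1n real_normK ?num_real // q10.
(* The curvature is an absolute value and leaves the sign open. With the positive sign the curve
   would pass beyond [b] as soon as the cubic remainder is dominated, that is for
   [u <= kappa / (4 * C3p)]. *)
have p20' : p 2 0 = - kappa.
  case: p20 => // p2k; exfalso; rewrite p2k in t3p.
  pose u := Num.min 1 (kappa / (4 * C3p)).
  have u0 : 0 < u by rewrite lt_min ltr01 divr_gt0 // mulr_gt0.
  have u1 : u <= 1 by rewrite ge_min lexx.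
  have uk : u * (4 * C3p) <= kappa by rewrite -ler_pdivlMr ?mulr_gt0 // ge_min lexx orbT.
  have := t3p u; rewrite gtr0_norm // => /(_ u1); rewrite ler_norml => /andP[h _].
  have := curve1_le (t0 + u); rewrite -/(p 0 u) => pb.
  have h2 : kappa * u ^+ 2 / 2 <= C3p * u ^+ 3 by lra.
  have h3 : u * (4 * C3p) * u ^+ 2 <= kappa * u ^+ 2 by rewrite ler_wpM2r // sqr_ge0.
  have h4 : 0 < C3p * u ^+ 3 by rewrite mulr_gt0 // exprn_gt0.
  have e3 : u * (4 * C3p) * u ^+ 2 = 4 * (C3p * u ^+ 3) by ring.
  lra.
rewrite p20' in t4.
have [h0 gh] := good_height_exists hD.
have b0 := xmax_gt0 hD xmax_closure.
have [e /= e0 eP] : \forall u \near (0 : R), 0 < p 0 u.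
  have : p 0 @ (0 : R) --> p 0 0 by exact: cp.
  by move/cvgr_gt; apply; rewrite p00.
pose e' := Num.min 1 (e / 2).
have [|||||||C [h [C0 h_gt0 hh0 hX]]] := @even_expansion R X (p 0) (q 0) b kappa (p 3 0 / 6) (q 1 0) C4 C3 h0 e' sg1 (@cq 0) kappa_gt0 C40 C30.
- by case: gh.
- by rewrite lt_min ltr01 /=; lra.
- by rewrite ge_min lexx.
- move=> u u1; have := t4 u u1.
  rewrite (_ : b + 0 * u + - kappa * u ^+ 2 / 2 + p 3 0 * u ^+ 3 / 6 =
    b - kappa * u ^+ 2 / 2 + p 3 0 / 6 * u ^+ 3) //; by field.
- move=> u u1; have := t3 u u1.
  by rewrite add0r !mul0r addr0.
- move=> u ue qh; rewrite -(curve_horiz gh qh) gtr0_norm //; apply: eP.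
  rewrite /= sub0r normrN; apply: (le_lt_trans ue).
  by rewrite gt_min; apply/orP; right; lra.
- exact: horizN.
exists C, h; split => //; by apply: (good_heightW hD gh); rewrite h_gt0.
Qed.

End Taylor.
End BoundaryCurve.

(** * Integrals along monotone arcs of the boundary *)

Section LineIntegrals.
Context {R : realType}.
Notation leb := (@lebesgue_measure R).

Lemma integ_segment (f : R -> R) (a b : R) : {within `[a, b], continuous f} ->
  leb.-integrable `[a, b] (EFin \o f).
Proof. by move=> cf; apply: continuous_compact_integrable => //; exact: segment_compact. Qed.

Lemma integ_continuous (f : R -> R) (a b : R) : continuous f -> leb.-integrable `[a, b] (EFin \o f).
Proof. by move=> cf; apply: integ_segment; exact: continuous_subspaceT. Qed.

Lemma derivable_continuous (f f' : R -> R) : (forall t : R, is_derive t 1 f (f' t)) -> continuous f.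
Proof.
by move=> df t; apply/differentiable_continuous/derivable1_diffP; case: (df t).
Qed.

Lemma derivable_LRcontinuous (f f' : R -> R) (a b : R) : (forall t : R, is_derive t 1 f (f' t)) ->
  derivable_oo_LRcontinuous f a b.
Proof.
move=> df; have cf := derivable_continuous df; split.
- by move=> t _; case: (df t).
- by apply: cvg_at_right_filter; exact: cf.
- by apply: cvg_at_left_filter; exact: cf.
Qed.

Lemma derive1_funE (f f' : R -> R) : (forall t : R, is_derive t 1 f (f' t)) -> derive1 f = f'.
Proof. by move=> df; apply/funext => t; rewrite derive1E; case: (df t). Qed.

Lemma ftc_segment (f f' : R -> R) (a b : R) : a <= b ->
  (forall t : R, is_derive t 1 f (f' t)) -> continuous f' ->
  (\int[leb]_(t in `[a, b]) (f' t)%:E = (f b - f a)%:E)%E.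
Proof.
rewrite le_eqVlt => /predU1P[->|ab] df cf; first by rewrite set_itv1 integral_set1 subrr.
rewrite (@continuous_FTC2 _ f' f) //.
- exact: continuous_subspaceT.
- exact: derivable_LRcontinuous df.
- by move=> t _; rewrite (derive1_funE df).
Qed.

Lemma integral_oo_cc (f : R -> R) (a b : R) : continuous f ->
  (\int[leb]_(t in `]a, b[) (f t)%:E = \int[leb]_(t in `[a, b]) (f t)%:E)%E.
Proof.
move=> cf; have mf : measurable_fun setT f by exact: continuous_measurable_fun.
rewrite -integral_itv_obnd_cbnd -?integral_itv_bndo_bndc //.
  by apply/measurable_EFinP; exact: measurable_funTS.
by apply/measurable_EFinP; exact: measurable_funTS.
Qed.

Section Substitution.
Variables (p p' k G : R -> R) (a b : R).
Hypothesis ab : a < b.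
Hypothesis dp : forall t : R, is_derive t 1 p (p' t).
Hypothesis cp' : continuous p'.
Hypothesis p'1 : forall t, `|p' t| <= 1.
Hypothesis ck : continuous k.
Hypothesis k0 : forall t, 0 <= k t.
Hypothesis Gp : forall t, a <= t <= b -> G (p t) = k t.

Definition mono_on (s : R) := forall u v, a <= u -> u < v -> v <= b -> s * p u < s * p v.

(** An inverse of [p] on [[a, b]] chosen pointwise, with default [a]. Strict monotonicity makes it a
    continuous inverse, and [G] inherits its continuity through [k \o q]. *)
Let q z := xget a [set t | a <= t <= b /\ p t = z].

Let pK s : mono_on s -> {in `[a, b], cancel p q}.
Proof.
move=> ms t; rewrite in_itv /= => tab.
have [/andP[h1 h2] hp] : [set u | a <= u <= b /\ p u = p t] (q (p t)) by apply: xgetPex; exists t.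
case/andP: tab => t1 t2.
case: (ltgtP (q (p t)) t) => // h.
  by have := ms _ _ h1 h t2; rewrite hp ltxx.
by have := ms _ _ t1 h h2; rewrite hp ltxx.
Qed.

Let substitution_continuous (lo hi : R) : {within `[lo, hi], continuous q} ->
  (forall z, lo <= z <= hi -> exists2 t, a <= t <= b & p t = z) ->
  {within `[lo, hi], continuous G}.
Proof.
move=> cq onto.
have ckq : {within `[lo, hi], continuous (k \o q)}.
  apply: (@within_continuous_comp R R R _ q k _ cq).
  by move=> z _; exact: ck.
move: ckq; apply: (@subspace_eq_continuous _ `[lo, hi]%classic R).
move=> z /set_mem /=; rewrite in_itv /= => /onto[t tab pt].
have [h1 h2] : [set u | a <= u <= b /\ p u = z] (q z) by apply: xgetPex; exists t.
by have := Gp h1; rewrite h2 => e; exact: (esym e).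
Qed.

Let le_k' (w : R -> R) : continuous w -> (forall t, `|w t| <= 1) ->
  (\int[leb]_(t in `[a, b]) (k t * w t)%:E <= \int[leb]_(t in `[a, b]) (k t)%:E)%E.
Proof.
move=> cw w1; apply: le_integral => //.
- by apply: integ_continuous => t; apply: cvgM; [exact: ck|exact: cw].
- exact: integ_continuous.
- move=> t _; rewrite lee_fin ler_piMr //.
  exact: le_trans (ler_norm _) (w1 t).
Qed.

(** After the substitution the integrand is [k * p'], and [|p'| <= 1] with [k >= 0] gives the bound.
    An inequality is enough, since only the smallness of trace integrals is transferred. *)
Lemma substitution_incr : mono_on 1 ->
  {within `[p a, p b], continuous G} /\
  (\int[leb]_(x in `[p a, p b]) (G x)%:E <= \int[leb]_(t in `[a, b]) (k t)%:E)%E.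
Proof.
move=> ms; have cpw : {within `[a, b], continuous p}.
  by apply: continuous_subspaceT; exact: derivable_continuous dp.
have pab : p a < p b by have := ms a b (lexx _) ab (lexx _); rewrite !mul1r.
have cG : {within `[p a, p b], continuous G}.
  apply: substitution_continuous; first exact: segment_can_le_continuous (ltW ab) cpw (pK ms).
  move=> z zab; have [|t] := @IVT _ p a b z (ltW ab) cpw.
    by case/andP: zab => z1 z2; rewrite ge_min le_max z1 z2 orbT.
  by rewrite in_itv /= => tab pt; exists t.
split => //.
rewrite (@integration_by_substitution_increasing _ p G a b (ltW ab)) //.
- apply: le_trans (le_k' cp' p'1); rewrite le_eqVlt; apply/orP; left; apply/eqP.
  apply: eq_integral => t /set_mem /=; rewrite in_itv /= => tab.
  by rewrite (derive1_funE dp) /= -(Gp tab).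
- move=> u v; rewrite !in_itv /= => /andP[u1 _] /andP[_ v2] uv.
  by have := ms u v u1 uv v2; rewrite !mul1r.
- by move=> t _; rewrite (derive1_funE dp); exact: cp'.
- by rewrite (derive1_funE dp); apply/cvg_ex; exists (p' a); apply: cvg_at_right_filter; exact: cp'.
- by rewrite (derive1_funE dp); apply/cvg_ex; exists (p' b); apply: cvg_at_left_filter; exact: cp'.
- exact: derivable_LRcontinuous dp.
Qed.

Lemma substitution_decr : mono_on (-1) ->
  {within `[p b, p a], continuous G} /\
  (\int[leb]_(x in `[p b, p a]) (G x)%:E <= \int[leb]_(t in `[a, b]) (k t)%:E)%E.
Proof.
move=> ms; have cpw : {within `[a, b], continuous p}.
  by apply: continuous_subspaceT; exact: derivable_continuous dp.
have pab : p b < p a by have := ms a b (lexx _) ab (lexx _); rewrite !mulN1r ltrN2.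
have cG : {within `[p b, p a], continuous G}.
  apply: substitution_continuous; first exact: segment_can_ge_continuous (ltW ab) cpw (pK ms).
  move=> z zab; have [|t] := @IVT _ p a b z (ltW ab) cpw.
    by case/andP: zab => z1 z2; rewrite ge_min le_max z1 z2 orbT.
  by rewrite in_itv /= => tab pt; exists t.
split => //.
rewrite (@integration_by_substitution_decreasing _ p G a b (ltW ab)) //.
- have cw : continuous (fun t => - p' t) by move=> t; apply: cvgN; exact: cp'.
  have w1 t : `|- p' t| <= 1 by rewrite normrN.
  apply: le_trans (le_k' cw w1); rewrite le_eqVlt; apply/orP; left; apply/eqP.
  apply: eq_integral => t /set_mem /=; rewrite in_itv /= => tab.
  by rewrite (derive1_funE dp) /= -(Gp tab).
- move=> u v; rewrite !in_itv /= => /andP[_ u2] /andP[v1 _] uv.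
  by have := ms v u v1 uv u2; rewrite !mulN1r ltrN2.
- by move=> t _; rewrite (derive1_funE dp); exact: cp'.
- by rewrite (derive1_funE dp); apply/cvg_ex; exists (p' a); apply: cvg_at_right_filter; exact: cp'.
- by rewrite (derive1_funE dp); apply/cvg_ex; exists (p' b); apply: cvg_at_left_filter; exact: cp'.
- exact: derivable_LRcontinuous dp.
Qed.

End Substitution.
End LineIntegrals.

(** * Arcs of the boundary issuing from the two contact points *)

Section CurveTrace.
Context {R : realType} (D : set (R * R)) (gamma : R -> R * R) (T : R).
Hypothesis hD : inclusion D.
Hypothesis hgamma : boundary_param D gamma T.
Notation leb := (@lebesgue_measure R).
Notation K := (closure D).
Notation b := (xmax D).
Notation X := (horiz D).
Notation Y := (vert D).
Notation c1 := (curve1 gamma).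
Notation c2 := (curve2 gamma).
Hypothesis hb : K (b, 0).
Variable s : R.
Hypothesis hs : s = 1 \/ s = -1.

Lemma sign_sq : s * s = 1.
Proof. by case: hs => ->; rewrite ?mulrNN mulr1. Qed.

Lemma curve_periodic_int (k : int) t : gamma (t + k%:~R * T) = gamma t.
Proof.
have h (n : nat) u : gamma (u + n%:R * T) = gamma u.
  elim: n u => [|n IH] u; first by rewrite mul0r addr0.
  by rewrite -natr1 mulrDl mul1r addrA (boundary_periodic hgamma).
case: k => n; first exact: h.
by rewrite NegzE -(h n.+1 (t + _)) mulrNz mulNr subrK.
Qed.

Lemma curve_axis_point : exists t, 0 <= t < T /\ gamma t = (s * b, 0).
Proof.
have T0 := boundary_period hgamma.
have [t _ gt] : range gamma (s * b, 0).
  rewrite (boundary_range hgamma) inclusion_interior //.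
  have nb := xmax_not_interior hD.
  case: hs => ->; rewrite ?mulN1r ?mul1r; split => //.
    exact: closure_symm_y.
  by move=> /(inclusion_symm_y hD); rewrite opprK.
pose k := Num.floor (t / T).
exists (t - k%:~R * T); rewrite -mulNr -mulrNz curve_periodic_int; split => //.
have /andP[h1 h2] := floor_itv (t / T).
rewrite -/k in h1 h2.
rewrite mulrNz mulNr subr_ge0 ltrBlDl -ler_pdivlMr // h1 /=.
by move: h2; rewrite ltr_pdivrMr // intrD mulrDl mul1r.
Qed.

Lemma curve2_period n t : c2 n (t + T) = c2 n t.
Proof.
elim: n t => [|n IH] t; first by rewrite /curve2 /= (boundary_periodic hgamma).
have h1 := is_derive_addl (is_derive_curve2 hgamma n (T + t)).
have e : (fun v : R => c2 n (T + v)) = c2 n by apply/funext => v; rewrite addrC IH.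
rewrite e in h1; have [_ e1] := h1; have [_ e2] := is_derive_curve2 hgamma n t.
by rewrite addrC -e1 e2.
Qed.

Section AxisPoint.
Variable t' : R.
Hypothesis ht' : gamma t' = (s * b, 0).

Lemma curve1_axis_derive : c1 1 t' = 0.
Proof.
have c0 : c1 0 t' = s * b by rewrite /curve1 /= ht'.
have hc t : - b <= c1 0 t <= b.
  have [Kt _] := curve_boundary hD hgamma t.
  rewrite (closure_xmax hD Kt) andbT lerNl; exact: (closure_xmax hD (closure_symm_y hD Kt)).
have h : is_derive t' 1 (c1 0) 0.
  have [s1|s1] := hs.
    apply: (@derive1_at_max _ (c1 0) (t' - 1) (t' + 1) t'); first lra.
    - by move=> t _; case: (is_derive_curve1 hgamma 0 t).
    - by rewrite in_itv /=; apply/andP; split; lra.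
    - by move=> t _; rewrite c0 s1 mul1r; case/andP: (hc t).
  apply: (@derive1_at_min _ (c1 0) (t' - 1) (t' + 1) t'); first lra.
  - by move=> t _; case: (is_derive_curve1 hgamma 0 t).
  - by rewrite in_itv /=; apply/andP; split; lra.
  - by move=> t _; rewrite c0 s1 mulN1r; case/andP: (hc t).
have [_ <-] := is_derive_curve1 hgamma 0 t'; by have [_ ->] := h.
Qed.

Lemma curve2_axis_derive : c2 1 t' = 1 \/ c2 1 t' = -1.
Proof.
have := curve_unit_speed hgamma t'; rewrite curve1_axis_derive expr0n add0r => /eqP.
by rewrite -[X in _ == X](expr1n _ 2) eqf_sqr => /orP[/eqP ->|/eqP ->]; [left|right].
Qed.

(** The velocity at the contact point is vertical, with y-component 1 or -1. By continuity that
    component keeps its sign nearby, and so does the abscissa. *)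
Lemma curve_local_mono : exists2 d, 0 < d &
  (forall u, `|u - t'| <= d -> 0 < s * c1 0 u) /\
  (forall u v, `|u - t'| <= d -> `|v - t'| <= d -> u < v -> c2 1 t' * c2 0 u < c2 1 t' * c2 0 v).
Proof.
have sg2 : c2 1 t' * c2 1 t' = 1 by case: curve2_axis_derive => ->; rewrite ?mulrNN mulr1.
have [e1 /= e10 he1] : \forall u \near t', 0 < s * c1 0 u.
  have : (fun u => s * c1 0 u) @ t' --> s * c1 0 t'.
    by apply: cvgM; [exact: cvg_cst|exact: (continuous_curve1 hgamma)].
  move/cvgr_gt; apply; rewrite /curve1 /= ht' /= mulrA sign_sq mul1r; exact: xmax_gt0.
have [e2 /= e20 he2] : \forall u \near t', 0 < c2 1 t' * c2 1 u.
  have : (fun u => c2 1 t' * c2 1 u) @ t' --> c2 1 t' * c2 1 t'.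
    by apply: cvgM; [exact: cvg_cst|exact: (continuous_curve2 hgamma)].
  by move/cvgr_gt; apply; rewrite sg2.
exists (Num.min e1 e2 / 2); first by rewrite divr_gt0 // lt_min e10.
have m1 : Num.min e1 e2 <= e1 by rewrite ge_min lexx.
have m2 : Num.min e1 e2 <= e2 by rewrite ge_min lexx orbT.
have m0 : 0 < Num.min e1 e2 by rewrite lt_min e10.
split => [u hu|u v hu hv uv].
  by apply: he1; rewrite /= distrC; lra.
have dc (x : R) : is_derive x 1 (fun y => c2 1 t' * c2 0 y) (c2 1 t' * c2 1 x).
  exact: (is_deriveZ (c2 1 t') (is_derive_curve2 hgamma 0 x)).
have cc : {within `[u, v], continuous (fun y => c2 1 t' * c2 0 y)}.
  by apply: continuous_subspaceT; exact: derivable_continuous dc.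
have [x xuv e] := MVT uv (fun x _ => dc x) cc.
rewrite -subr_gt0 e mulr_gt0 ?subr_gt0 //; apply: he2 => /=.
move: xuv; rewrite in_itv /= => /andP[x1 x2].
move: hu hv; rewrite !ler_norml ltr_norml => /andP[u1 u2] /andP[v1 v2].
by clear -m0 m2 x1 x2 u1 u2 v1 v2; apply/andP; split; lra.
Qed.

End AxisPoint.

(* An arc of the curve between [(s b, 0)] and height [sg h], inside one period; the last disjunction
   leaves open whether it runs away from the axis or towards it. *)
Definition gap_arc (sg h al be : R) :=
  [/\ 0 <= al, al < be, be <= T & (forall t, al <= t <= be -> 0 < s * c1 0 t)] /\
  exists2 sig, (sig = 1 \/ sig = -1) &
    (forall u v, al <= u -> u < v -> v <= be -> sig * c2 0 u < sig * c2 0 v) /\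
    ((c2 0 al = 0 /\ c2 0 be = sg * h) \/ (c2 0 al = sg * h /\ c2 0 be = 0)).

(** [tau] is the direction of travel from [t'] and [d] the time available inside the period on that
    side. The arc ends where the intermediate value theorem meets the height [h]. *)
Lemma gap_arc_side (t' tau d : R) : gamma t' = (s * b, 0) -> (tau = 1 \/ tau = -1) -> 0 < d ->
  0 <= t' <= T -> 0 <= t' + tau * d <= T ->
  exists2 h0, 0 < h0 & forall h, 0 < h <= h0 -> exists al be, gap_arc (c2 1 t' * tau) h al be.
Proof.
move=> ht' htau d0 tT tT'.
have [d1 d10 [pos mono]] := curve_local_mono ht'.
have sg2 : c2 1 t' * c2 1 t' = 1 by case: (curve2_axis_derive ht') => ->; rewrite ?mulrNN mulr1.
have tau2 : tau * tau = 1 by case: htau => ->; rewrite ?mulrNN mulr1.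
set sig := c2 1 t' in mono sg2 *.
pose e := Num.min d d1.
have e0 : 0 < e by rewrite lt_min d0.
have ed : e <= d by rewrite ge_min lexx.
have ed1 : e <= d1 by rewrite ge_min lexx orbT.
have c2t : c2 0 t' = 0 by rewrite /curve2 /= ht'.
have range_e v : 0 <= v <= e -> 0 <= t' + tau * v <= T.
  move=> /andP[v0 ve]; case: htau tT' => -> ; rewrite ?mul1r ?mulN1r => /andP[h1 h2];
  case/andP: tT => h3 h4; apply/andP; split; lra.
pose F v := sig * tau * c2 0 (t' + tau * v).
have dist v : 0 <= v <= e -> `|t' + tau * v - t'| <= d1.
  by move=> /andP[v0 ve]; rewrite addrC addKr normrM; case: htau => ->; rewrite ?normrN normr1 mul1r ger0_norm //; lra.
have t'd1 : `|t' - t'| <= d1 by rewrite subrr normr0 ltW.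
have F0 : F 0 = 0 by rewrite /F mulr0 addr0 c2t mulr0.
have Fe : 0 < F e.
  have ee : 0 <= e <= e by apply/andP; split; lra.
  have := dist e ee; rewrite /F; case: htau => ->; rewrite ?mul1r ?mulr1 => de.
    by have := mono t' (t' + e) t'd1 de ltac:(lra); rewrite c2t mulr0.
  by have := mono (t' + - 1 * e) t' de t'd1 ltac:(lra); rewrite c2t; lra.
have cF : {within `[0, e], continuous F}.
  apply: continuous_subspaceT => v; apply: cvgM; first exact: cvg_cst.
  apply: (@continuous_comp _ _ _ (fun v => t' + tau * v) (c2 0)).
    by apply: cvgD; [exact: cvg_cst|apply: cvgM; [exact: cvg_cst|exact: cvg_id]].
  exact: (continuous_curve2 hgamma).
exists (F e) => // h /andP[h0 hF].
have [|v] := @IVT _ F 0 e h (ltW e0) cF; first by rewrite F0 ge_min le_max (ltW h0) hF orbT.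
rewrite in_itv /= => /andP[v0 ve] Fv.
have vp : 0 < v by rewrite lt_neqAle v0 andbT; apply/eqP => v0'; move: Fv; rewrite -v0' F0 => h0'; move: h0; rewrite -h0' ltxx.
have cv : c2 0 (t' + tau * v) = sig * tau * h.
  by rewrite -Fv /F mulrA mulrACA sg2 tau2 !mul1r.
have near_ u : t' - v <= u <= t' + v -> `|u - t'| <= d1.
  by move=> /andP[h1 h2]; rewrite ler_norml; apply/andP; split; lra.
have rv := range_e v ltac:(by rewrite v0 ve).
have hsig : sig = 1 \/ sig = -1 by exact: curve2_axis_derive ht'.
case: htau => tauE; rewrite tauE ?mul1r ?mulN1r in cv rv *.
- exists t', (t' + v); split.
    case/andP: rv => r1 r2; case/andP: tT => r3 r4; split => //; first lra.
    by move=> t /andP[t1 t2]; apply: pos; apply: near_; apply/andP; split; lra.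
  exists sig => //; split; last by left; rewrite c2t cv.
  move=> u w u1 uw w2; apply: mono => //; apply: near_; apply/andP; split; lra.
- exists (t' - v), t'; split.
    case/andP: rv => r1 r2; case/andP: tT => r3 r4; split => //; first lra.
    by move=> t /andP[t1 t2]; apply: pos; apply: near_; apply/andP; split; lra.
  exists sig => //; split; last by right; rewrite c2t cv.
  move=> u w u1 uw w2; apply: mono => //; apply: near_; apply/andP; split; lra.
Qed.

Lemma gap_arcs : exists2 h0, 0 < h0 & forall h sg, 0 < h <= h0 -> (sg = 1 \/ sg = -1) ->
  exists al be, gap_arc sg h al be.
Proof.
have T0 := boundary_period hgamma.
have [t' [/andP[t0 tT] ht']] := curve_axis_point.
(* The traces are integrated over [[0, T]], so both arcs must lie there. If the contact point is
   reached at time 0 there is no room before it, and the backward arc starts from the equivalent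
   time [T]. *)
pose t2 := if t' == 0 then T else t'.
have ht2 : gamma t2 = (s * b, 0).
  by rewrite /t2; case: eqP => [e|_ //]; rewrite -ht' e -{1}(add0r T) (boundary_periodic hgamma).
have t20 : 0 < t2 by rewrite /t2; case: eqP => // /eqP e; rewrite lt_neqAle t0 eq_sym e.
have t2T : t2 <= T by rewrite /t2; case: eqP => // _; exact: ltW.
have e2 : c2 1 t2 = c2 1 t'.
  by rewrite /t2; case: eqP => [->|//]; rewrite -{1}(add0r T) curve2_period.
have [||||h1 h10 H1] := @gap_arc_side t' 1 (T - t') ht'.
- by left.
- lra.
- by rewrite t0 ltW.
- by rewrite mul1r addrC subrK lexx ltW.
have [||||h2 h20 H2] := @gap_arc_side t2 (-1) t2 ht2.
- by right.
- lra.
- by rewrite ltW.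
- by rewrite mulN1r subrr lexx ltW.
exists (Num.min h1 h2); first by rewrite lt_min h10.
move=> h sg /andP[h0]; rewrite le_min => /andP[hh1 hh2] hsg.
have {}H1 := H1 h ltac:(by rewrite h0); have {}H2 := H2 h ltac:(by rewrite h0).
rewrite e2 in H2; rewrite mulr1 in H1; rewrite mulrN1 in H2.
case: (curve2_axis_derive ht') => e; rewrite e ?opprK in H1 H2; by case: hsg => ->.
Qed.

End CurveTrace.

(** * Graph integrals compared with arc-length integrals *)

Section GapTrace.
Context {R : realType}.
Notation leb := (@lebesgue_measure R).

Lemma substitution_mono (p p' k G : R -> R) (a b sig : R) : a < b ->
  (forall t : R, is_derive t 1 p (p' t)) -> continuous p' -> (forall t, `|p' t| <= 1) ->
  continuous k -> (forall t, 0 <= k t) -> (forall t, a <= t <= b -> G (p t) = k t) ->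
  (sig = 1 \/ sig = -1) -> mono_on p a b sig ->
  {within `[Num.min (p a) (p b), Num.max (p a) (p b)], continuous G} /\
  (\int[leb]_(x in `[Num.min (p a) (p b), Num.max (p a) (p b)]) (G x)%:E <=
   \int[leb]_(t in `[a, b]) (k t)%:E)%E.
Proof.
move=> ab dp cp' p'1 ck k0 Gp hsig ms; have := ms a b (lexx _) ab (lexx _).
case: hsig ms => ->; rewrite ?mul1r ?mulN1r ?ltrN2 => ms pab.
  by rewrite (min_l (ltW pab)) (max_r (ltW pab)); have := substitution_incr ab dp cp' p'1 ck k0 Gp ms.
by rewrite (min_r (ltW pab)) (max_l (ltW pab)); have := substitution_decr ab dp cp' p'1 ck k0 Gp ms.
Qed.

Lemma integ_glue (f : R -> R) (a b c : R) : a <= b -> b <= c -> (forall x, 0 <= f x) ->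
  leb.-integrable `[a, b] (EFin \o f) -> leb.-integrable `[b, c] (EFin \o f) ->
  leb.-integrable `[a, c] (EFin \o f) /\
  (\int[leb]_(x in `[a, c]) (f x)%:E =
   \int[leb]_(x in `[a, b]) (f x)%:E + \int[leb]_(x in `[b, c]) (f x)%:E)%E.
Proof.
move=> ab bc f0 i1 i2.
have mo : measurable_fun `[a, b[ f.
  by apply/measurable_fun_itv_bndo_bndcP; exact: (integ_measurable i1).
have mf : measurable_fun (`[a, b[ `|` `[b, c]) f.
  by apply/measurable_funU => //; split => //; exact: integ_measurable i2.
have e : `[a, c]%classic = `[a, b[%classic `|` `[b, c]%classic.
  by rewrite -itv_bndbnd_setU // bnd_simp.
have eI : (\int[leb]_(x in `[a, c]) (f x)%:E =
   \int[leb]_(x in `[a, b]) (f x)%:E + \int[leb]_(x in `[b, c]) (f x)%:E)%E.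
  rewrite e ge0_integral_setU //.
  - by rewrite integral_itv_bndo_bndc //; exact/measurable_EFinP.
  - exact/measurable_EFinP.
  - by move=> x _; rewrite lee_fin.
  - apply/disj_setPS => x [/=]; rewrite !in_itv /= => /andP[_ xb] /andP[bx _].
    by move: xb; rewrite ltNge bx.
split => //; apply: ge0_integ_lty => //; first by rewrite e.
by rewrite eI -(integ_EFin _ i1) // -(integ_EFin _ i2) // -EFinD ltry.
Qed.

Lemma vertN (D : set (R * R)) (hD : inclusion D) x : vert D (- x) = vert D x.
Proof.
congr sup; apply/seteqP; split => y /= /(closure_symm_y hD) //; by rewrite opprK.
Qed.

Lemma closure_axis (D : set (R * R)) (hD : inclusion D) x y : closure D (x, y) -> closure D (x, 0).
Proof.
move=> Kx; have Kx' := closure_symm_x hD Kx.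
have [y0|y0|y0] := ltgtP y 0; last by rewrite -y0.
  apply: inclusion_closure.
  by apply: (vertical_inclusion hD Kx Kx'); lra.
apply: inclusion_closure.
by apply: (vertical_inclusion hD Kx' Kx); lra.
Qed.

Variables (D : set (R * R)) (gamma : R -> R * R) (T : R).
Hypothesis hD : inclusion D.
Hypothesis hgamma : boundary_param D gamma T.
Notation K := (closure D).
Notation b := (xmax D).
Notation X := (horiz D).
Notation Y := (vert D).
Notation c1 := (curve1 gamma).
Notation c2 := (curve2 gamma).
Hypothesis hb : K (b, 0).
Variable s : R.
Hypothesis hs : s = 1 \/ s = -1.

Lemma curve_speed1 t : `|c1 1 t| <= 1.
Proof.
rewrite -(@ler_pXn2r _ 2) ?nnegrE // expr1n real_normK ?num_real //.
by rewrite -(curve_unit_speed hgamma t) lerDl sqr_ge0.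
Qed.

Lemma curve_speed2 t : `|c2 1 t| <= 1.
Proof.
rewrite -(@ler_pXn2r _ 2) ?nnegrE // expr1n real_normK ?num_real //.
by rewrite -(curve_unit_speed hgamma t) lerDr sqr_ge0.
Qed.

Section Arc.
Variables (sg h al be : R) (k : R * R -> R).
Hypothesis hsg : sg = 1 \/ sg = -1.
Hypothesis gh : good_height D h.
Hypothesis harc : gap_arc gamma T s sg h al be.
Hypothesis ck : continuous k.
Hypothesis k0 : forall p, 0 <= k p.

Let kg t := k (c1 0 t, c2 0 t).

Lemma continuous_on_curve : continuous kg.
Proof.
move=> t; apply: (@continuous_comp _ _ _ (fun t => (c1 0 t, c2 0 t)) k); last exact: ck.
exact: (cvg_pair (@continuous_curve1 _ _ _ _ hgamma 0 t) (@continuous_curve2 _ _ _ _ hgamma 0 t)).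
Qed.

Let sg2 : sg * sg = 1.
Proof. by case: hsg => ->; rewrite ?mulrNN mulr1. Qed.

Lemma arc_points t : al <= t <= be -> [/\ 0 <= sg * c2 0 t, sg * c2 0 t <= h,
  s * c1 0 t = X (c2 0 t) & sg * c2 0 t = Y (s * c1 0 t)].
Proof.
have [[a0 ab bT pos] [sig hsig [mono ends]]] := harc.
have [h0 _] := gh.
move=> tab; case/andP: (tab) => t1 t2.
have m1 : sig * c2 0 al <= sig * c2 0 t.
  by move: t1; rewrite le_eqVlt => /predU1P[<- //|t1]; exact: ltW (mono _ _ (lexx _) t1 t2).
have m2 : sig * c2 0 t <= sig * c2 0 be.
  by move: t2; rewrite le_eqVlt => /predU1P[-> //|t2]; exact: ltW (mono _ _ t1 t2 (lexx _)).
have [r1 r2] : 0 <= sg * c2 0 t /\ sg * c2 0 t <= h.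
  by case: ends m1 m2 => -[-> ->]; case: hsig hsg => -> [] -> ; rewrite ?mul1r ?mulN1r ?opprK ?oppr0; split; lra.
have nc : `|c2 0 t| = sg * c2 0 t.
  by rewrite -(ger0_norm r1) normrM; case: hsg => ->; rewrite ?normrN normr1 mul1r.
have [Kt nD] := curve_boundary hD hgamma t.
have sc : `|c1 0 t| = s * c1 0 t.
  by rewrite -(gtr0_norm (pos t tab)) normrM; case: hs => ->; rewrite ?normrN normr1 mul1r.
split => //.
- by rewrite -sc; apply: (curve_horiz hD hgamma gh); rewrite nc.
- rewrite -nc (boundary_vert hD (closure_axis hD Kt) Kt nD).
  by case: hs => ->; rewrite ?mul1r // mulN1r vertN.
Qed.

Let arc_le : (\int[leb]_(t in `[al, be]) (kg t)%:E <= \int[leb]_(t in `[0%R, T]) (kg t)%:E)%E.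
Proof.
have [[a0 ab bT _] _] := harc.
apply: ge0_subset_integral => //.
- by apply/measurable_EFinP; apply: measurable_funTS; exact: continuous_measurable_fun continuous_on_curve.
- by move=> t _; rewrite lee_fin; exact: k0.
- by move=> t /=; rewrite !in_itv /= => /andP[t1 t2]; apply/andP; split; lra.
Qed.

Lemma arc_horiz :
  {within `[Num.min 0 (sg * h), Num.max 0 (sg * h)], continuous (fun y => k (s * X y, y))} /\
  (\int[leb]_(y in `[(Num.min 0 (sg * h))%R, (Num.max 0 (sg * h))%R]) (k (s * X y, y)%R)%:E <=
   \int[leb]_(t in `[0%R, T]) (kg t)%:E)%E.
Proof.
have [[a0 ab bT pos] [sig hsig [mono ends]]] := harc.
have [|cG le] := @substitution_mono (c2 0) (c2 1) kg (fun y => k (s * X y, y)) al be sig ab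
  (is_derive_curve2 hgamma 0) (continuous_curve2 hgamma (n := 1)) curve_speed2 continuous_on_curve
  (fun t => k0 _) _ hsig mono.
  move=> t tab; have [_ _ e _] := arc_points tab.
  by rewrite /kg -e mulrA (sign_sq hs) mul1r.
have [e1 e2] : Num.min (c2 0 al) (c2 0 be) = Num.min 0 (sg * h) /\
  Num.max (c2 0 al) (c2 0 be) = Num.max 0 (sg * h).
  by case: ends => -[-> ->] //; rewrite minC maxC.
rewrite e1 e2 in cG le; split => //; exact: le_trans le arc_le.
Qed.

Lemma arc_vert :
  {within `[Num.min (s * X h) (s * b), Num.max (s * X h) (s * b)], continuous (fun x => k (x, sg * Y (s * x)))} /\
  (\int[leb]_(x in `[(Num.min (s * X h) (s * b))%R, (Num.max (s * X h) (s * b))%R]) (k (x, sg * Y (s * x))%R)%:E <=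
   \int[leb]_(t in `[0%R, T]) (kg t)%:E)%E.
Proof.
have [[a0 ab bT pos] [sig hsig [mono ends]]] := harc.
have hX y : X (sg * y) = X y by case: hsg => ->; rewrite ?mul1r // mulN1r horizN.
(* Along the arc [sig] orients the height and [sg] is its sign, so [sg * sig] says whether the
   distance to the axis grows. The abscissa [s * X] then varies in the opposite sense. *)
have hs' : - (s * (sg * sig)) = 1 \/ - (s * (sg * sig)) = -1.
  by case: hs => ->; case: hsg => ->; case: hsig => ->; rewrite !(mul1r, mulN1r, opprK); auto.
have [||cG le] := @substitution_mono (c1 0) (c1 1) kg (fun x => k (x, sg * Y (s * x))) al be _ ab
  (is_derive_curve1 hgamma 0) (continuous_curve1 hgamma (n := 1)) curve_speed1 continuous_on_curve
  (fun t => k0 _) _ hs'.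
- move=> t tab; have [_ _ _ e] := arc_points tab.
  by rewrite /kg -e mulrA sg2 mul1r.
- move=> u v u1 uv v2.
  have [u3 u4 u5 _] := @arc_points u ltac:(apply/andP; split; lra).
  have [v3 v4 v5 _] := @arc_points v ltac:(apply/andP; split; lra).
  have m := mono u v u1 uv v2.
  have xdec y1 y2 := @horiz_decreasing _ _ hD hb h y1 y2 gh.
  have key : - (sg * sig) * X (c2 0 u) < - (sg * sig) * X (c2 0 v).
    rewrite -(hX (c2 0 u)) -(hX (c2 0 v)).
    have [e|e] : sg * sig = 1 \/ sg * sig = -1.
      by case: hsg => ->; case: hsig => ->; rewrite !(mul1r, mulN1r, opprK); auto.
    + rewrite e !mulN1r ltrN2; apply: xdec => //.
      by move: m; case: hsg hsig e => -> [] -> e; lra.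
    + rewrite e opprK !mul1r; apply: xdec => //.
      by move: m; case: hsg hsig e => -> [] -> e; lra.
  move: key; rewrite -u5 -v5 !mulrA.
  by rewrite (_ : - (s * sg * sig) = - (sg * sig) * s) //; ring.
have p1 : c1 0 al = s * X (c2 0 al).
  by have [_ _ <- _] := @arc_points al ltac:(by rewrite lexx ltW); rewrite mulrA (sign_sq hs) mul1r.
have p2 : c1 0 be = s * X (c2 0 be).
  by have [_ _ <- _] := @arc_points be ltac:(by rewrite lexx ltW); rewrite mulrA (sign_sq hs) mul1r.
have [e1 e2] : Num.min (c1 0 al) (c1 0 be) = Num.min (s * X h) (s * b) /\
  Num.max (c1 0 al) (c1 0 be) = Num.max (s * X h) (s * b).
  by rewrite p1 p2; case: ends => -[-> ->]; rewrite hX (horiz0 hD hb) //; rewrite minC maxC.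
rewrite e1 e2 in cG le; split => //; exact: le_trans le arc_le.
Qed.

End Arc.

End GapTrace.

Lemma continuous_plane_bounded {R : realType} (f : R * R -> R) (L : R) : continuous f ->
  exists2 M, 0 <= M & forall p, `|p.1| <= L -> `|p.2| <= L -> `|f p| <= M.
Proof.
move=> cf; have [L0|L0] := leP 0 L; last first.
  by exists 0 => // p p1 _; move: (le_lt_trans p1 L0); rewrite ltNge normr_ge0.
pose A : set (R * R) := `[- L, L]%classic `*` `[- L, L]%classic.
have cA : compact A by apply: compact_setX; exact: segment_compact.
have A0 : A (0, 0) by split; rewrite /= in_itv /=; apply/andP; split; lra.
have cn : {within A, continuous (fun p => `|f p|)}.
  by apply: continuous_subspaceT => p; apply: continuous_comp; [exact: cf|exact: norm_continuous].
have [c _ hc] := compact_EVT_max (ex_intro _ _ A0) cA cn.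
exists `|f c| => // p p1 p2; apply: hc; rewrite inE; split; rewrite /= in_itv /=; by rewrite -ler_norml.
Qed.

(** The divergence theorem integrates one component along [y] and the other along [x], so the curved
    side of the gap is needed as a graph in both ways. The factor 2 counts the upper and the lower
    arc, each estimated by the full curve integral. *)
Definition gap_trace_bound {R : realType} (D : set (R * R)) (gamma : R -> R * R) (T s h : R) : Prop :=
  forall k : R * R -> R, continuous k -> (forall p, 0 <= k p) ->
  (lebesgue_measure.-integrable `[- h, h] (EFin \o (fun y => k (s * horiz D y, y))) /\
   \int[lebesgue_measure]_(y in `[- h, h]) k (s * horiz D y, y) <=
   2 * \int[lebesgue_measure]_(t in `[0, T]) k (gamma t)) /\
  (forall sg, (sg = 1 \/ sg = -1) ->
   let A := `[Num.min (s * horiz D h) (s * xmax D), Num.max (s * horiz D h) (s * xmax D)]%classic in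
   lebesgue_measure.-integrable A (EFin \o (fun x => k (x, sg * vert D (s * x)))) /\
   \int[lebesgue_measure]_(x in A) k (x, sg * vert D (s * x))
   <= \int[lebesgue_measure]_(t in `[0, T]) k (gamma t)).

Section GapTraceInequality.
Context {R : realType} (D : set (R * R)) (gamma : R -> R * R) (T : R).
Hypothesis hD : inclusion D.
Hypothesis hgamma : boundary_param D gamma T.
Notation leb := (@lebesgue_measure R).
Notation K := (closure D).
Notation b := (xmax D).
Notation X := (horiz D).
Notation Y := (vert D).
Hypothesis hb : K (b, 0).
Variable s : R.
Hypothesis hs : s = 1 \/ s = -1.

Lemma gap_trace : exists2 h0, 0 < h0 &
  forall h, good_height D h -> h <= h0 -> gap_trace_bound D gamma T s h.
Proof.
have [h0 h00 arcs] := gap_arcs hD hgamma hb hs.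
exists h0 => // h gh hh0 k ck k0; have [hp _] := gh.
have hr : 0 < h <= h0 by rewrite hp.
have [al [be A1]] := arcs h 1 hr (or_introl erefl).
have [al' [be' A2]] := arcs h (-1) hr (or_intror erefl).
have igam : leb.-integrable `[0, T] (EFin \o (fun t => k (gamma t))).
  under [X in EFin \o X]eq_fun do rewrite curveE.
  exact: (integ_continuous _ _ (continuous_on_curve hgamma ck)).
have egam : (\int[leb]_(t in `[0%R, T]) (k (curve1 gamma 0 t, curve2 gamma 0 t))%:E =
    (\int[leb]_(t in `[0, T]) k (gamma t))%:E)%E.
  by rewrite integ_EFin //; apply: eq_integral => t _; rewrite -curveE.
have [c1 le1] := arc_horiz hD hgamma hs (or_introl erefl) gh A1 ck k0.
have [c2 le2] := arc_horiz hD hgamma hs (or_intror erefl) gh A2 ck k0.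
rewrite egam in le1 le2.
have hp' : -1 * h <= 0 by lra.
rewrite mul1r (min_l (ltW hp)) (max_r (ltW hp)) in c1 le1.
rewrite (min_r hp') (max_l hp') mulN1r in c2 le2.
have i1 := integ_segment c1; have i2 := integ_segment c2.
have hm : - h <= 0 by lra.
have [iG eG] := integ_glue hm (ltW hp) (fun y => k0 (s * X y, y)) i2 i1.
split.
  split => //; rewrite -lee_fin (integ_EFin _ iG) // eG mulr2n mulrDl mul1r EFinD.
  exact: leeD.
move=> sg hsg A; rewrite {}/A.
have [cV leV] : {within `[Num.min (s * X h) (s * b), Num.max (s * X h) (s * b)], continuous (fun x => k (x, sg * Y (s * x)))} /\
  (\int[leb]_(x in `[(Num.min (s * X h) (s * b))%R, (Num.max (s * X h) (s * b))%R]) (k (x, sg * Y (s * x))%R)%:E <=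
    (\int[leb]_(t in `[0, T]) k (gamma t))%:E)%E.
  rewrite -egam; case: hsg => ->.
    exact: (arc_vert hD hgamma hb hs (or_introl erefl) gh A1 ck k0).
  exact: (arc_vert hD hgamma hb hs (or_intror erefl) gh A2 ck k0).
have iV := integ_segment cV; split => //.
by rewrite -lee_fin (integ_EFin _ iV).
Qed.

End GapTraceInequality.

(** * Green's formula in the gap *)

Section Sections.
Context {R : realType}.
Notation leb := (@lebesgue_measure R).
Notation mu2 := (@plane_measure R).
Notation RR := (measurableTypeR R * measurableTypeR R)%type.
Implicit Types (f F : R * R -> R) (Q : set RR).

Lemma section_integral_y f Q (A : set R) y : (forall x, Q (x, y) <-> A x) ->
  (\int[leb]_x ((f \_ Q) (x, y))%:E = \int[leb]_(x in A) (f (x, y))%:E)%E.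
Proof.
move=> QA; rewrite [RHS]integral_mkcond; apply: eq_integral => x _.
rewrite !patchE; case: ifPn => [/set_mem /QA Ax|/negP nQ]; first by rewrite mem_set.
by rewrite memNset // => /QA Qx; apply: nQ; exact: mem_set.
Qed.

Lemma section_integral_x f Q (A : set R) x : (forall y, Q (x, y) <-> A y) ->
  (\int[leb]_y ((f \_ Q) (x, y))%:E = \int[leb]_(y in A) (f (x, y))%:E)%E.
Proof.
move=> QA; rewrite [RHS]integral_mkcond; apply: eq_integral => y _.
rewrite !patchE; case: ifPn => [/set_mem /QA Ay|/negP nQ]; first by rewrite mem_set.
by rewrite memNset // => /QA Qy; apply: nQ; exact: mem_set.
Qed.

Lemma continuous_section_x f y : continuous f -> continuous (fun x => f (x, y)).
Proof.
move=> cf x; apply: (@continuous_comp _ _ _ (fun x => (x, y)) f); last exact: cf.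
exact: (cvg_pair cvg_id (cvg_cst y)).
Qed.

Lemma continuous_section_y f x : continuous f -> continuous (fun y => f (x, y)).
Proof.
move=> cf y; apply: (@continuous_comp _ _ _ (fun y => (x, y)) f); last exact: cf.
exact: (cvg_pair (cvg_cst x) cvg_id).
Qed.

Lemma smooth_continuous F : smooth F -> continuous F.
Proof. by move=> /(_ 0%N). Qed.

Lemma smooth_partial F i : smooth F -> smooth (partial i F).
Proof. by move=> sF n; apply: Cn_partial; exact: sF. Qed.

Lemma ftc_section_x F y a b : smooth F -> a <= b ->
  (\int[leb]_(x in `]a, b[) (partial ord0 F (x, y))%:E = (F (b, y) - F (a, y))%:E)%E.
Proof.
move=> sF ab.
have cp := smooth_continuous (smooth_partial ord0 sF).
rewrite integral_oo_cc; last exact: continuous_section_x cp.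
apply: (@ftc_segment _ (fun x => F (x, y))) => //; last exact: continuous_section_x cp.
by move=> t; exact: (smooth_line_derive ord0 (0, y) t sF).
Qed.

Lemma ftc_section_y F x a b : smooth F -> a <= b ->
  (\int[leb]_(y in `]a, b[) (partial ord_max F (x, y))%:E = (F (x, b) - F (x, a))%:E)%E.
Proof.
move=> sF ab.
have cp := smooth_continuous (smooth_partial ord_max sF).
rewrite integral_oo_cc; last exact: continuous_section_y cp.
apply: (@ftc_segment _ (fun y => F (x, y))) => //; last exact: continuous_section_y cp.
by move=> t; exact: (smooth_line_derive ord_max (x, 0) t sF).
Qed.

Lemma integ_plane_continuous f Q (L : R) : measurable Q -> continuous f ->
  (forall p, Q p -> `|p.1| <= L /\ `|p.2| <= L) -> integ mu2 Q f.
Proof.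
move=> mQ cf QL; have [M _ hM] := continuous_plane_bounded L cf.
apply: (@integ_bounded _ _ _ _ _ mQ _ M).
- apply: rect_bounded_lty => //; exists (- L), L, (- L), L => p /QL[p1 p2].
  by apply/rectE; rewrite -!ler_norml.
- exact: continuous_plane_measurable.
- by move=> p /QL[p1 p2]; exact: hM.
Qed.

End Sections.

(** The gap is bounded by the true inclusion and not by the modified profile, since the zero trace
    is known on the true boundary only. *)
Definition gap {R : realType} (D : set (R * R)) (s h L : R) : set (R * R) :=
  [set p | `|p.2| < h] `&` ([set p | 0 < s * p.1] `&` [set p | s * p.1 < L]) `&` ~` closure D.

Section GapGeometry.
Context {R : realType} (D : set (R * R)).
Hypothesis hD : inclusion D.
Notation leb := (@lebesgue_measure R).
Notation mu2 := (@plane_measure R).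
Notation K := (closure D).
Notation b := (xmax D).
Notation X := (horiz D).
Notation Y := (vert D).
Hypothesis hb : K (b, 0).
Variables s h L : R.
Hypothesis hs : s = 1 \/ s = -1.
Hypothesis gh : good_height D h.
Hypothesis bL : b < L.
Notation Q := (gap D s h L).

Lemma gap_open : open Q.
Proof.
have c2 : continuous (fun p : R * R => `|p.2|).
  by move=> p; apply: continuous_comp; [exact: cvg_snd|exact: norm_continuous].
have c1 : continuous (fun p : R * R => s * p.1) := Cn_continuous (CnZ s (Cn_fst 0)).
rewrite /gap; apply: openI; last by apply: closed_openC; exact: closed_closure.
apply: openI; first by apply: (open_comp (f := fun p : R * R => `|p.2|) (D := [set x | x < h])) => //; exact: open_lt.
apply: openI.
- by apply: (open_comp (f := fun p : R * R => s * p.1) (D := [set x | 0 < x])) => //; exact: open_gt.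
- by apply: (open_comp (f := fun p : R * R => s * p.1) (D := [set x | x < L])) => //; exact: open_lt.
Qed.

Lemma gap_measurable : @measurable _ (measurableTypeR R * measurableTypeR R)%type Q.
Proof. exact: open_plane_measurable gap_open. Qed.

Lemma gapP x y : Q (x, y) <-> [/\ `|y| < h, X y < s * x & s * x < L].
Proof.
have [h0 _] := gh.
have KsE : K (s * x, y) <-> K (x, y).
  case: hs => ->; rewrite ?mul1r // mulN1r; split => /(closure_symm_y hD) //; by rewrite opprK.
split => [[[/= yh [x0 xL]] nK]|[yh Xx xL]].
  have K0 : K (0, y) by apply: inclusion_closure; apply: (good_height_axis hD gh); exact: ltW.
  split => //; rewrite ltNge; apply/negP => xX; apply: nK; apply/KsE.
  by apply/(horiz_closureP hD _ K0); rewrite gtr0_norm.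
have K0 : K (0, y) by apply: inclusion_closure; apply: (good_height_axis hD gh); exact: ltW.
have X0 : 0 < X y by apply: (horiz_pos hD gh); exact: ltW.
split; last first.
  move=> /= /KsE /(horiz_closureP hD _ K0).
  by rewrite gtr0_norm ?(lt_trans X0) // leNgt Xx.
by split => //=; split => //=; exact: lt_trans Xx.
Qed.

Lemma gap_bounded p : Q p -> `|p.1| <= L + h /\ `|p.2| <= L + h.
Proof.
have [h0 _] := gh; have L0 : 0 <= L := ltW (lt_trans (xmax_gt0 hD hb) bL).
case: p => x y /gapP[yh Xx xL] /=; split; last first.
  by apply: (le_trans (ltW yh)); rewrite lerDr.
have X0 : 0 < X y by apply: (horiz_pos hD gh); exact: ltW.
have -> : `|x| = s * x.
  have : 0 < s * x by lra.
  by move=> /gtr0_norm <-; rewrite normrM; case: hs => ->; rewrite ?normrN normr1 mul1r.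
lra.
Qed.

Lemma gap_section_y F y : smooth F -> `|y| <= h ->
  (`| \int[leb]_x ((partial ord0 F \_ Q) (x, y))%:E | <= (`|F (s * L, y)| + `|F (s * X y, y)|)%:E)%E.
Proof.
move=> sF; rewrite le_eqVlt => /predU1P[ye|yh].
  rewrite (@integral_patch0 _ _ _ (fun x => (x, y))); first by rewrite abse0 lee_fin addr_ge0.
  by move=> x /gapP[]; rewrite ye ltxx.
have XL : X y <= L.
  apply/ltW/(le_lt_trans _ bL).
  have K0 : K (0, y) by apply: inclusion_closure; apply: (good_height_axis hD gh); exact: ltW.
  exact: (closure_xmax hD (horiz_mem hD K0)).
have [s1|s1] := hs.
  rewrite (@section_integral_y _ _ _ `]X y, L[%classic).
    by rewrite ftc_section_x // s1 !mul1r lee_fin ler_normB.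
  move=> x; rewrite gapP s1 mul1r /= in_itv /=.
  by split => [[_ -> ->]|/andP[]].
rewrite (@section_integral_y _ _ _ `](- L), (- X y)[%classic).
  by rewrite ftc_section_x ?lerN2 // s1 !mulN1r lee_fin distrC ler_normB.
move=> x; rewrite gapP s1 mulN1r /= in_itv /= ltrNl (ltrNr x).
by split => [[_ -> ->]|/andP[]].
Qed.

(** Here the section consists of the two intervals between the heights [w] and [h] and between [- h]
    and [- w]. [F] vanishes at the outer ends, so only the two boundary points of the inclusion
    remain. *)
Lemma gap_section_x F x : smooth F -> F (x, h) = 0 -> F (x, - h) = 0 ->
  X h <= s * x <= b ->
  (`| \int[leb]_y ((partial ord_max F \_ Q) (x, y))%:E | <=
   (`|F (x, 1 * Y (s * x))| + `|F (x, -1 * Y (s * x))|)%:E)%E.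
Proof.
move=> sF Fh Fmh /andP[]; rewrite le_eqVlt => /predU1P[xe|xh] xb.
  rewrite (@integral_patch0 _ _ _ (fun y => (x, y))); first by rewrite abse0 lee_fin addr_ge0.
  move=> y /gapP[yh Xy _]; move: Xy; rewrite -xe -(horiz_norm hD y).
  move=> /(lt_trans (horiz_decreasing hD hb gh (normr_ge0 y) yh (lexx h))).
  by rewrite ltxx.
have hxb : X h < s * x <= b by rewrite xh.
have /andP[Y0 Yh] := vert_lt hD hb gh hxb.
have Kx := axis_closure hD hb gh hxb.
set w := Y (s * x) in Y0 Yh *.
have QE y : Q (x, y) <-> (`]w, h[%classic `|` `](- h), (- w)[%classic) y.
  have -> : Q (x, y) <-> (`|y| < h /\ w < `|y|).
    split => [[[yh _] nK]|[yh wy]].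
      split => //; rewrite ltNge; apply/negP => yw; apply: nK.
      have : K (s * x, y) by apply/(vert_closureP hD _ Kx).
      by case: hs => ->; rewrite ?mul1r // mulN1r => /(closure_symm_y hD); rewrite opprK.
    apply/gapP; split => //; last exact: le_lt_trans bL.
    rewrite ltNge; apply/negP => xX.
    have K0 : K (0, y) by apply: inclusion_closure; apply: (good_height_axis hD gh); exact: ltW.
    have X0 : 0 < X h by have [_ /(horiz_gt hD)] := gh.
    have : K (s * x, y) by apply/(horiz_closureP hD _ K0); rewrite gtr0_norm // (lt_trans X0).
    by move=> /(vert_closureP hD _ Kx); rewrite leNgt wy.
  rewrite /= !in_itv /=; split => [[]|].
    rewrite ltr_norml => /andP[y1 y2]; case: (leP 0 y) => y0.
      by rewrite ger0_norm // => wy; left; rewrite wy.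
    by rewrite ltr0_norm // => wy; right; rewrite y1 ltrNr.
  case=> /andP[y1 y2].
    have y0 : 0 <= y by lra.
    by rewrite ger0_norm // y1 y2.
  have y0 : y < 0 by lra.
  by rewrite ltr0_norm // ltrNl y1 ltrNr y2.
rewrite (section_integral_x _ QE).
have cp : continuous (fun y => partial ord_max F (x, y)).
  exact: continuous_section_y (smooth_continuous (smooth_partial ord_max sF)).
have mp (A : set (measurableTypeR R)) : measurable_fun A (fun y => partial ord_max F (x, y)).
  by apply: measurable_funTS; exact: continuous_measurable_fun.
rewrite integral_setU //.
- have hmw : - h <= - w by rewrite lerN2 ltW.
  rewrite (ftc_section_y x sF (ltW Yh)) (ftc_section_y x sF hmw) Fh Fmh sub0r subr0.
  rewrite mul1r mulN1r.
  by apply: (le_trans (ler_normD _ _)); rewrite normrN.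
- by apply/measurable_EFinP; exact: mp.
- apply/disj_setPS => y [/=]; rewrite !in_itv /= => /andP[y1 _] /andP[_ y2].
  lra.
Qed.

(** Between the tip and the side the section is the whole interval, and both end values of [F] are
    zero; elsewhere outside the range it is empty. *)
Lemma gap_section_x0 F x : smooth F -> F (x, h) = 0 -> F (x, - h) = 0 ->
  ~ (X h <= s * x <= b) ->
  (\int[leb]_y ((partial ord_max F \_ Q) (x, y))%:E = 0)%E.
Proof.
have [h0 _] := gh.
move=> sF Fh Fmh hx; have [xL|xL] := ltP (s * x) L; last first.
  rewrite (@integral_patch0 _ _ _ (fun y => (x, y))) //.
  by move=> y /gapP[_ _]; rewrite ltNge xL.
have [xb|xb] := ltP b (s * x); last first.
  rewrite (@integral_patch0 _ _ _ (fun y => (x, y))) //.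
  move=> y /gapP[yh Xy _]; apply: hx; rewrite xb andbT.
  move: Xy; rewrite -(horiz_norm hD y).
  by move=> /(lt_trans (horiz_decreasing hD hb gh (normr_ge0 y) yh (lexx h))) /ltW.
rewrite (@section_integral_x _ _ _ `](- h), h[%classic).
  by rewrite ftc_section_y ?Fh ?Fmh ?subr0 //; lra.
move=> y; rewrite gapP /= in_itv /= -ltr_norml; split => [[]|yh] //; split => //.
apply: le_lt_trans xb.
have K0 : K (0, y) by apply: inclusion_closure; apply: (good_height_axis hD gh); exact: ltW.
exact: (closure_xmax hD (horiz_mem hD K0)).
Qed.

(** An estimate suffices, since all boundary terms tend to zero along the approximating functions.
    [B1] belongs to the straight side, [B2] to the curved side seen along [y], and [2 * B3] to its
    upper and lower arcs seen along [x]. *)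
Lemma gap_divergence F1 F2 (B1 B2 B3 : R) : smooth F1 -> smooth F2 ->
  (forall x, F2 (x, h) = 0) -> (forall x, F2 (x, - h) = 0) ->
  leb.-integrable `[- h, h] (EFin \o (fun y => `|F1 (s * X y, y)|)) ->
  \int[leb]_(y in `[- h, h]) `|F1 (s * L, y)| <= B1 ->
  \int[leb]_(y in `[- h, h]) `|F1 (s * X y, y)| <= B2 ->
  (forall sg, (sg = 1 \/ sg = -1) ->
    leb.-integrable `[Num.min (s * X h) (s * b), Num.max (s * X h) (s * b)]
      (EFin \o (fun x => `|F2 (x, sg * Y (s * x))|)) /\
    \int[leb]_(x in `[Num.min (s * X h) (s * b), Num.max (s * X h) (s * b)])
      `|F2 (x, sg * Y (s * x))| <= B3) ->
  `| \int[mu2]_(p in Q) (partial ord0 F1 p + partial ord_max F2 p) | <= B1 + B2 + 2 * B3.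
Proof.
move=> s1 s2 F2h F2mh iX hB1 hB2 hB3.
have mQ := gap_measurable.
have c1 := smooth_continuous (smooth_partial ord0 s1).
have c2 := smooth_continuous (smooth_partial ord_max s2).
have i1 := integ_plane_continuous mQ c1 gap_bounded.
have i2 := integ_plane_continuous mQ c2 gap_bounded.
rewrite RintegralD //; apply: (le_trans (ler_normD _ _)); apply: lerD.
- have iL : leb.-integrable `[- h, h] (EFin \o (fun y => `|F1 (s * L, y)|)).
    apply: integ_continuous => y; apply: continuous_comp; last exact: norm_continuous.
    exact: (@continuous_section_y _ F1 (s * L) (smooth_continuous s1) y).
  apply: (@le_trans _ _ (\int[leb]_(y in `[- h, h]) (`|F1 (s * L, y)| + `|F1 (s * X y, y)|))).
    apply: plane_bound_y => //.
    + by move=> [x y] /gapP[/= yh _ _]; rewrite -ler_norml; exact: ltW.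
    + exact: integD.
    + by move=> y yh; apply: gap_section_y => //; rewrite ler_norml.
  by rewrite RintegralD // lerD.
- have [j1 le1] := hB3 1 (or_introl erefl).
  have [j2 le2] := hB3 (-1) (or_intror erefl).
  have XhB : X h <= b.
    have [_ Dh] := gh; exact: (closure_xmax hD (horiz_mem hD (inclusion_closure Dh))).
  have rangeP x : (Num.min (s * X h) (s * b) <= x <= Num.max (s * X h) (s * b)) = (X h <= s * x <= b).
    case: hs => ->; rewrite ?mul1r ?mulN1r.
      by rewrite min_l ?max_r.
    by rewrite min_r ?max_l ?lerN2 // lerNl lerNr andbC.
  apply: (@le_trans _ _ (\int[leb]_(x in `[Num.min (s * X h) (s * b), Num.max (s * X h) (s * b)])
    (`|F2 (x, 1 * Y (s * x))| + `|F2 (x, -1 * Y (s * x))|))).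
    apply: plane_bound_x => //.
    + by move=> x; rewrite rangeP => hx; exact: gap_section_x0.
    + exact: integD.
    + by move=> x; rewrite rangeP => hx; apply: gap_section_x.
  by rewrite RintegralD // mulr2n mulrDl mul1r lerD.
Qed.

End GapGeometry.

(** * Smooth approximation measured in L^1 *)

Section L1Approximation.
Context d (A : measurableType d) (R : realType) (mu : {measure set A -> \bar R}).
Variables (S : set A) (mS : measurable S) (M : R).
Hypothesis muS : (mu S <= M%:E)%E.

(** Instead of the Cauchy-Schwarz inequality, integrate the pointwise bound
    [|f| <= t + t^-1 * f ^+ 2]. *)
Lemma L1_of_square (f : A -> R) (t : R) : measurable_fun S f -> 0 < t ->
  (\int[mu]_(p in S) (f p ^+ 2)%:E <= (t ^+ 2)%:E)%E ->
  integ mu S f /\ \int[mu]_(p in S) `|f p| <= (M + 1) * t.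
Proof.
move=> mf t0 ft.
have Sfin : (mu S < +oo)%E by exact: le_lt_trans muS (ltry _).
have [_ i2] := sqintE mf (le_lt_trans ft (ltry _)).
have i1 : integ mu S f by apply: sqint_integ.
split => //.
have ic : integ mu S (fun=> t) by apply: (@integ_bounded _ _ _ _ _ mS _ t) => // p _; rewrite gtr0_norm.
apply: (@le_trans _ _ (\int[mu]_(p in S) (t + t^-1 * f p ^+ 2))).
  apply: le_Rintegral => //; [exact: integ_norm|by apply: integD => //; exact: integZ|].
  move=> p _; rewrite -(@ler_pM2l _ t) // mulrDr mulrA divff ?gt_eqF // mul1r.
  rewrite -(real_normK (num_real (f p))); have := normr_ge0 (f p).
  have := sqr_ge0 (t - `|f p|); nra.
rewrite RintegralD //; last exact: integZ.
rewrite Rintegral_cst // RintegralZl // mulrDl mul1r addrC (addrC (M * t)); apply: lerD.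
  rewrite -(@ler_pM2l _ t) // mulrA divff ?gt_eqF // mul1r -expr2.
  by rewrite -lee_fin (integ_EFin _ i2).
rewrite mulrC ler_pM2r // -lee_fin fineK // ge0_fin_numE //.
Qed.

End L1Approximation.

Section MatrixPart.
Context {R : realType} (D : set (R * R)) (L2 eps : R).
Notation leb := (@lebesgue_measure R).
Notation mu2 := (@plane_measure R).
Notation RR := (measurableTypeR R * measurableTypeR R)%type.
Notation Om := (matrix_part D L2 eps).
Notation L1 := (half_width D eps).

Lemma matrix_part_open : open Om.
Proof.
have c1 : continuous (fun p : R * R => p.1) := Cn_continuous (Cn_fst 0).
have c2 : continuous (fun p : R * R => p.2) := Cn_continuous (Cn_snd 0).
apply: openI; last by apply: closed_openC; exact: closed_closure.
have -> : cell D L2 eps = (fun p : R * R => p.1) @^-1` [set x | - L1 < x] `&` (fun p : R * R => p.1) @^-1` [set x | x < L1]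
  `&` ((fun p : R * R => p.2) @^-1` [set x | - L2 < x] `&` (fun p : R * R => p.2) @^-1` [set x | x < L2]).
  apply/seteqP; split => p /=; first by move=> [/andP[? ?] /andP[? ?]].
  by move=> [[h1 h2] [h3 h4]]; split; apply/andP.
by apply: openI; apply: openI; apply: open_comp => //; (exact: open_gt || exact: open_lt).
Qed.

Lemma matrix_part_measurable : @measurable _ RR Om.
Proof. exact: open_plane_measurable matrix_part_open. Qed.

Lemma matrix_part_bounded p : Om p -> `|p.1| <= `|L1| + `|L2| /\ `|p.2| <= `|L1| + `|L2|.
Proof.
move=> [[/= h1 h2] _]; have a1 := ler_norm L1; have a2 := ler_norm L2.
have n1 := normr_ge0 L1; have n2 := normr_ge0 L2.
have := ltW (_ : `|p.1| < L1); have := ltW (_ : `|p.2| < L2).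
by rewrite !ltr_norml => /(_ h2) ? /(_ h1) ?; split; lra.
Qed.

Lemma matrix_part_finite : exists2 M, 0 <= M & (mu2 Om <= M%:E)%E.
Proof.
have mO := matrix_part_measurable.
have : (mu2 Om < +oo)%E.
  apply: rect_bounded_lty => //.
  exists (- (`|L1| + `|L2|)), (`|L1| + `|L2|), (- (`|L1| + `|L2|)), (`|L1| + `|L2|).
  by move=> p /matrix_part_bounded[p1 p2]; apply/rectE; rewrite -!ler_norml.
move=> fin; exists (fine (mu2 Om)); first by rewrite fine_ge0.
by rewrite fineK // ge0_fin_numE.
Qed.

Lemma matrix_part_lty : (mu2 Om < +oo)%E.
Proof. by have [M _ h] := matrix_part_finite; exact: le_lt_trans h (ltry _). Qed.

Lemma H1_sqint (u : H1 Om) : sqint mu2 Om u.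
Proof. by have [m f] := H1_val_L2 u; apply: sqintE => //; exact: matrix_part_measurable. Qed.

Lemma H1_grad_sqint (u : H1 Om) i : sqint mu2 Om (H1_grad u i).
Proof. by have [m f] := H1_grad_L2 u i; apply: sqintE => //; exact: matrix_part_measurable. Qed.

Lemma continuous_sqint (f : R * R -> R) : continuous f -> sqint mu2 Om f.
Proof.
move=> cf; have [M _ hM] := continuous_plane_bounded (`|L1| + `|L2|) cf.
apply: (@sqint_bounded _ _ _ _ _ matrix_part_measurable _ M).
- exact: matrix_part_lty.
- exact: continuous_plane_measurable matrix_part_measurable cf.
- by move=> p /matrix_part_bounded[p1 p2]; exact: hM.
Qed.

Lemma sum_ord2 (f : 'I_2 -> R) : \sum_(i < 2) f i = f ord0 + f ord_max.
Proof. by rewrite big_ord_recl big_ord1; congr (_ + f _); apply: val_inj. Qed.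

Lemma near_ereal0 (u : nat -> \bar R) (e : R) : u @ \oo --> 0%E -> 0 < e ->
  \forall n \near \oo, (u n <= e%:E)%E.
Proof.
move=> /fine_cvgP[uf /cvgr_lt /(_ e)] h e0.
near=> n; have fn : u n \is a fin_num by near: n.
rewrite -(fineK fn) lee_fin; apply: ltW; near: n; exact: h.
Unshelve. all: by end_near. Qed.

(** Turns the convergences hidden in [has_trace] into L^1 bounds linear in a scale [t] chosen
    beforehand, with one approximant serving for the value, the gradient and the trace. *)
Lemma trace_approx (c : R -> R * R) (a b' g : R) (u : H1 Om) : a <= b' -> continuous c ->
  has_trace c a b' u g -> exists2 C, 0 < C & forall t, 0 < t -> exists phi : R * R -> R,
  [/\ smooth phi, \int[mu2]_(p in Om) `|phi p - u p| <= C * t,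
    forall i, \int[mu2]_(p in Om) `|partial i phi p - H1_grad u i p| <= C * t &
    \int[leb]_(r in `[a, b']) `|phi (c r) - g| <= C * t].
Proof.
move=> ab cc [phi [sphi dphi tphi]].
have [M M0 hM] := matrix_part_finite; have mO := matrix_part_measurable.
exists ((M + 1) + (b' - a + 1)); first lra.
move=> t t0.
have [N1 _ hN1] : \forall n \near \oo, (H1_sqdist (phi n) u <= (t ^+ 2)%:E)%E.
  by apply: near_ereal0 dphi _; rewrite exprn_gt0.
have [N2 _ hN2] : \forall n \near \oo, (\int[leb]_(r in `[a, b']) ((phi n (c r) - g) ^+ 2)%:E <= (t ^+ 2)%:E)%E.
  by apply: near_ereal0 tphi _; rewrite exprn_gt0.
pose n := maxn N1 N2; exists (phi n).
have h1 := hN1 n (leq_maxl _ _); have h2 := hN2 n (leq_maxr _ _).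
have sv : sqint mu2 Om (fun p => phi n p - u p).
  by apply: sqintB => //; [exact: continuous_sqint (smooth_continuous (sphi n))|exact: H1_sqint].
have sg i : sqint mu2 Om (fun p => partial i (phi n) p - H1_grad u i p).
  apply: sqintB => //; last exact: H1_grad_sqint.
  exact: continuous_sqint (smooth_continuous (smooth_partial i (sphi n))).
have tot : measurable_fun Om (fun p : RR => (phi n p - u p) ^+ 2 + \sum_(i < 2) (partial i (phi n) p - H1_grad u i p) ^+ 2).
  under eq_fun do rewrite sum_ord2.
  apply: measurable_funD; first by apply: measurable_funX; case: sv.
  by apply: measurable_funD; apply: measurable_funX; [case: (sg ord0)|case: (sg ord_max)].
have sub (f : RR -> R) : sqint mu2 Om f ->
  (forall p, f p ^+ 2 <= (phi n p - u p) ^+ 2 + \sum_(i < 2) (partial i (phi n) p - H1_grad u i p) ^+ 2) ->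
  \int[mu2]_(p in Om) `|f p| <= (M + 1) * t.
  move=> [mf _] fle; have [|//] := L1_of_square mO hM mf t0.
  apply: (le_trans _ h1); apply: ge0_le_integral => //.
  - by move=> p _; rewrite lee_fin sqr_ge0.
  - by apply/measurable_EFinP; exact: measurable_funX.
  - exact/measurable_EFinP.
  - by move=> p _; rewrite lee_fin.
have le1 : (M + 1) * t <= (M + 1 + (b' - a + 1)) * t by rewrite ler_pM2r //; lra.
split => //.
- apply: (le_trans _ le1); apply: sub => // p; rewrite lerDl sumr_ge0 // => i _; exact: sqr_ge0.
- move=> i; apply: (le_trans _ le1); apply: sub => // p.
  rewrite (bigD1 i) //= addrCA lerDl addr_ge0 ?sqr_ge0 // sumr_ge0 // => j _; exact: sqr_ge0.
- have cf : continuous (fun r => phi n (c r) - g).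
    move=> r; apply: cvgB; last exact: cvg_cst.
    apply: (@continuous_comp _ _ _ c (phi n)); [exact: cc|exact: (smooth_continuous (sphi n))].
  have mab : measurable (`[a, b']%classic : set (measurableTypeR R)) by exact: measurable_itv.
  have ba : 0 <= b' - a by rewrite subr_ge0.
  have fin : (leb `[a, b']%classic <= (b' - a)%:E)%E by rewrite lebesgue_measure_segment.
  have mf : measurable_fun `[a, b']%classic (fun r => phi n (c r) - g : R).
    by apply: measurable_funTS; exact: continuous_measurable_fun.
  have [|_ le] := L1_of_square mab fin mf t0; first exact: h2.
  apply: (le_trans le); rewrite ler_pM2r //; lra.
Qed.

End MatrixPart.

Section PartialRules.
Context {R : realType}.
Implicit Types (f g : R * R -> R) (i : 'I_2).

Lemma smooth_is_derive f i p : smooth f -> is_derive p (axis i) f (partial i f p).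
Proof. by move=> sf; exact: (is_derive_partial p i (sf 1%N)). Qed.

Lemma partialM f g i p : smooth f -> smooth g ->
  partial i (fun q => f q * g q) p = f p * partial i g p + g p * partial i f p.
Proof.
move=> sf sg; apply: partialE.
exact: (is_deriveM (smooth_is_derive i p sf) (smooth_is_derive i p sg)).
Qed.

Lemma partialB f g i p : smooth f -> smooth g ->
  partial i (fun q => f q - g q) p = partial i f p - partial i g p.
Proof.
move=> sf sg; apply: partialE.
exact: (is_deriveB (smooth_is_derive i p sf) (smooth_is_derive i p sg)).
Qed.

Lemma partialD f g i p : smooth f -> smooth g ->
  partial i (fun q => f q + g q) p = partial i f p + partial i g p.
Proof.
move=> sf sg; apply: partialE.
exact: (is_deriveD (smooth_is_derive i p sf) (smooth_is_derive i p sg)).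
Qed.

Lemma partial0_fst_affine (s c : R) p : partial ord0 (fun q : R * R => s * q.1 - c) p = s.
Proof.
apply: partialE; apply/is_derive_lineP; rewrite /line /=.
apply: (is_derive_eq (is_deriveB (is_deriveZ s (is_derive_id p.1 (1 : R))) (is_derive_cst c p.1 (1 : R)))).
by rewrite subr0 /GRing.scale /= mulr1.
Qed.

Lemma smoothM f g : smooth f -> smooth g -> smooth (fun p => f p * g p).
Proof. by move=> sf sg n; apply: CnM. Qed.

Lemma smoothB f g : smooth f -> smooth g -> smooth (fun p => f p - g p).
Proof. by move=> sf sg n; apply: CnB. Qed.

Lemma smoothD f g : smooth f -> smooth g -> smooth (fun p => f p + g p).
Proof. by move=> sf sg n; apply: CnD. Qed.

Lemma smooth_affine (s c : R) : smooth (fun q : R * R => s * q.1 - c).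
Proof. by move=> n; apply: CnB; [apply: CnZ; exact: Cn_fst|exact: Cn_cst]. Qed.

End PartialRules.

Lemma sided_range {R : realType} (s x L : R) : (s = 1 \/ s = -1) -> 0 < s * x -> s * x < L -> - L < x < L.
Proof. by case=> ->; rewrite ?mul1r ?mulN1r => h1 h2; apply/andP; split; lra. Qed.

(** * Trace inequality on the straight side *)

Section GapGreen.
Context {R : realType} (D : set (R * R)) (gamma : R -> R * R) (T : R).
Hypothesis hD : inclusion D.
Hypothesis hgamma : boundary_param D gamma T.
Variables (L2 eps : R).
Hypothesis eps0 : 0 < eps.
Notation leb := (@lebesgue_measure R).
Notation mu2 := (@plane_measure R).
Notation RR := (measurableTypeR R * measurableTypeR R)%type.
Notation Om := (matrix_part D L2 eps).
Notation L1 := (half_width D eps).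
Notation K := (closure D).
Notation b := (xmax D).
Hypothesis hb : K (b, 0).
Variables s h : R.
Hypothesis hs : s = 1 \/ s = -1.
Hypothesis gh : good_height D h.
Hypothesis hL2 : h < L2.

Lemma half_widthE : L1 = b + eps / 2. Proof. by []. Qed.

(** Meant for the difference of two approximants, which is known to be small in the domain only. On
    the strip [b < s * x < L1], which has width [eps / 2] and avoids the inclusion, the x-derivative
    of [(s * x - b) * chi] integrates to plus or minus [eps / 2 * chi] on the side. *)
Lemma side_trace (chi : R * R -> R) : smooth chi ->
  eps / 2 * \int[leb]_(y in `[- h, h]) `|chi (s * L1, y)| <=
  \int[mu2]_(p in Om) (`|chi p| + eps / 2 * `|partial ord0 chi p|).
Proof.
move=> schi; have [h0 _] := gh.
have e0 := eps0; have e2 : 0 < eps / 2 by lra.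
pose f p := `|chi p| + eps / 2 * `|partial ord0 chi p|.
have f0 p : 0 <= f p by rewrite addr_ge0 // mulr_ge0 // ltW.
have cf : continuous f.
  move=> p; apply: cvgD.
    by apply: continuous_comp; [exact: (smooth_continuous schi)|exact: norm_continuous].
  apply: cvgM; first exact: cvg_cst.
  apply: continuous_comp; last exact: norm_continuous.
  exact: (smooth_continuous (smooth_partial ord0 schi)).
have sf : sqint mu2 Om f := continuous_sqint _ _ _ cf.
have mO := @matrix_part_measurable _ D L2 eps.
have lO := @matrix_part_lty _ D L2 eps.
have iO : integ mu2 Om f := sqint_integ mO lO sf.
pose S : set RR := [set p | `|p.2| <= h] `&` ([set p | b < s * p.1] `&` [set p | s * p.1 < L1]).
have mS : measurable S.
  have c2 : continuous (fun p : R * R => `|p.2|).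
    by move=> p; apply: continuous_comp; [exact: cvg_snd|exact: norm_continuous].
  have c1 : continuous (fun p : R * R => s * p.1) := Cn_continuous (CnZ s (Cn_fst 0)).
  apply: measurableI.
    by apply: closed_plane_measurable; apply: (preimage_closed (f := fun p : R * R => `|p.2|) (D := [set x | x <= h])) => //; exact: closed_le.
  apply: measurableI; apply: open_plane_measurable.
    by apply: (open_comp (f := fun p : R * R => s * p.1) (D := [set x | b < x])) => //; exact: open_gt.
  by apply: (open_comp (f := fun p : R * R => s * p.1) (D := [set x | x < L1])) => //; exact: open_lt.
have SO : S `<=` Om.
  move=> p [/= ph [bp pL]]; split.
    split; last by rewrite -ltr_norml; exact: le_lt_trans hL2.
    have b0 := xmax_gt0 hD hb.
    exact: sided_range hs (lt_trans b0 bp) pL.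
  move=> Kp; have := closure_xmax hD Kp; have := closure_xmax hD (_ : K (- p.1, p.2)).
  have Kp' : K (- p.1, p.2) by apply: (closure_symm_y hD); case: (p) Kp.
  move=> /(_ Kp') /= h1 h2; case: hs bp => ->; rewrite ?mul1r ?mulN1r => bp.
    by move: bp; rewrite ltNge h2.
  by move: bp; rewrite ltNge h1.
have iS : integ mu2 S f := integ_sub mO mS SO iO.
have cchi : continuous (fun y : R => eps / 2 * `|chi (s * L1, y)|).
  move=> z; apply: cvgM; first exact: cvg_cst.
  apply: continuous_comp; last exact: norm_continuous.
  exact: (@continuous_section_y _ chi (s * L1) (smooth_continuous schi) z).
have nchi : continuous (fun y : R => `|chi (s * L1, y)|).
  move=> z; apply: continuous_comp; last exact: norm_continuous.
  exact: (@continuous_section_y _ chi (s * L1) (smooth_continuous schi) z).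
rewrite -RintegralZl //; last exact: integ_continuous.
rewrite -lee_fin (integ_EFin _ iO) // (integ_EFin _ (integ_continuous (- h) h cchi)) //.
apply: (@le_trans _ _ (\int[mu2]_(p in S) (f p)%:E)%E); last first.
  apply: ge0_subset_integral => //; first by apply/measurable_EFinP; exact: integ_measurable iO.
  by move=> p _; rewrite lee_fin.
rewrite plane_tonelli_y //; last exact: integ_measurable iS.
apply: (@le_trans _ _ (\int[leb]_(y in `[(- h)%R, h]) \int[leb]_x ((f \_ S) (x, y))%:E)%E); last first.
  apply: ge0_subset_integral => //.
    by apply: measurable_tonelli_y => //; exact: integ_measurable iS.
  by move=> y _; apply: integral_ge0 => x _; rewrite lee_fin patchE; case: ifP.
apply: ge0_le_integral => //.
- by move=> y _; rewrite lee_fin mulr_ge0 // ltW.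
- by apply/measurable_EFinP; apply: measurable_funTS; exact: continuous_measurable_fun.
- by apply: measurable_funTS; apply: measurable_tonelli_y => //; exact: integ_measurable iS.
move=> y; rewrite /= in_itv /= -ler_norml => yh.
(* The affine factor vanishes at the tip line and is at most [eps / 2] on the strip. *)
pose F (p : R * R) := (s * p.1 - b) * chi p.
have sF : smooth F by apply: smoothM => //; exact: smooth_affine.
have pF p : partial ord0 F p = (s * p.1 - b) * partial ord0 chi p + chi p * s.
  by rewrite partialM ?partial0_fst_affine //; exact: smooth_affine.
have cpF := smooth_continuous (smooth_partial ord0 sF).
have sn : `|s| = 1 by case: hs => ->; rewrite ?normrN normr1.
have [I IE IF] : exists2 I : set (measurableTypeR R), measurable I /\ (forall x, S (x, y) <-> I x) &
    (`| \int[leb]_(x in I) (partial ord0 F (x, y))%:E | = (eps / 2 * `|chi (s * L1, y)|)%:E)%E.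
  have bL : b <= L1 by rewrite half_widthE; lra.
  have [s1|s1] := hs.
    exists `]b, L1[%classic.
      split; first exact: measurable_itv.
      move=> x; rewrite /S /= in_itv /= s1 mul1r.
      by split => [[_ [-> ->]]|/andP[? ?]].
    rewrite ftc_section_x // /F /= s1 !mul1r subrr mul0r subr0 half_widthE addrC addKr.
    by rewrite normrM gtr0_norm.
  exists `](- L1), (- b)[%classic.
    split; first exact: measurable_itv.
    move=> x; rewrite /S /= in_itv /= s1 mulN1r ltrNl ltrNr.
    by split => [[_ [-> ->]]|/andP[? ?]].
  rewrite ftc_section_x ?lerN2 // /F /= s1 !mulN1r !opprK subrr mul0r sub0r half_widthE addrC addKr.
  by rewrite normrN normrM gtr0_norm.
case: IE => mI IE.
rewrite (section_integral_y f IE) -IF.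
have mcF : measurable_fun I (fun x => partial ord0 F (x, y)).
  apply: measurable_funTS; apply: continuous_measurable_fun.
  exact: continuous_section_x cpF.
have mcf : measurable_fun I (fun x => f (x, y)).
  apply: measurable_funTS; apply: continuous_measurable_fun.
  exact: continuous_section_x cf.
apply: (le_trans (le_abse_integral _ mI _)); first exact/measurable_EFinP.
apply: ge0_le_integral => //.
- by apply: measurableT_comp => //; exact/measurable_EFinP.
- exact/measurable_EFinP.
- move=> x /IE[_ [/= bx xL]]; rewrite lee_fin pF /= addrC; apply: (le_trans (ler_normD _ _)).
  rewrite normrM sn mulr1 lerD2l normrM ler_wpM2r // ger0_norm; first by rewrite half_widthE in xL; lra.
  by rewrite subr_ge0 ltW.
Qed.

Notation Q := (gap D s h L1).

Lemma gap_sub : Q `<=` Om.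
Proof.
have [h0 _] := gh; have e0 := eps0; move=> p [[/= ph [bp pL]] nK]; split => //; split; last first.
  by rewrite -ltr_norml; exact: lt_trans hL2.
exact: sided_range hs bp pL.
Qed.

End GapGreen.

Lemma Rintegral_subset d (A : measurableType d) (R : realType) (mu : {measure set A -> \bar R})
    (S S' : set A) (f : A -> R) : measurable S -> measurable S' -> S `<=` S' ->
  integ mu S' f -> (forall x, S' x -> 0 <= f x) -> \int[mu]_(x in S) f x <= \int[mu]_(x in S') f x.
Proof.
move=> mS mS' SS' i0 f0; have i1 := integ_sub mS' mS SS' i0.
rewrite -lee_fin (integ_EFin _ i0) // (integ_EFin _ i1) //.
apply: ge0_subset_integral => //; first by apply/measurable_EFinP; exact: integ_measurable i0.

Qed.

(** * Green's formula for functions with zero traces *)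

Section ZeroTraceGreen.
Context {R : realType} (D : set (R * R)) (gamma : R -> R * R) (T : R).
Hypothesis hD : inclusion D.
Hypothesis hgamma : boundary_param D gamma T.
Variables (L2 eps : R).
Hypothesis eps0 : 0 < eps.
Notation leb := (@lebesgue_measure R).
Notation mu2 := (@plane_measure R).
Notation RR := (measurableTypeR R * measurableTypeR R)%type.
Notation Om := (matrix_part D L2 eps).
Notation L1 := (half_width D eps).
Notation K := (closure D).
Notation b := (xmax D).
Hypothesis hb : K (b, 0).
Variables s h : R.
Hypothesis hs : s = 1 \/ s = -1.
Hypothesis gh : good_height D h.
Hypothesis hL2 : h < L2.
Hypothesis htrace : gap_trace_bound D gamma T s h.
Variables (m1 m2 : R * R -> R).
Hypothesis sm1 : smooth m1.
Hypothesis sm2 : smooth m2.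
Hypothesis divm : forall p, partial ord0 m1 p + partial ord_max m2 p = 0.
Hypothesis m2h : forall x, m2 (x, h) = 0.
Hypothesis m2mh : forall x, m2 (x, - h) = 0.
Notation Q := (gap D s h L1).

Let bL1 : b < L1.
Proof. by have e0 := eps0; rewrite half_widthE; lra. Qed.

Lemma continuous_curve : continuous gamma.
Proof.
move=> t; have -> : gamma = (fun t => (curve1 gamma 0 t, curve2 gamma 0 t)) by apply/funext => r; rewrite curveE.
exact: (cvg_pair (@continuous_curve1 _ _ _ _ hgamma 0 t) (@continuous_curve2 _ _ _ _ hgamma 0 t)).
Qed.

Lemma le_Rintegral_scaled (c d : R) (f g : R -> R) (M : R) : continuous f -> continuous g ->
  (forall t, c <= t <= d -> f t <= M * g t) ->
  \int[leb]_(t in `[c, d]) f t <= M * \int[leb]_(t in `[c, d]) g t.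
Proof.
move=> cf cg fg; rewrite -RintegralZl //; last exact: integ_continuous.
apply: le_Rintegral => //; first exact: integ_continuous.
  by apply: integ_continuous => t; apply: cvgM; [exact: cvg_cst|exact: cg].
Qed.

(** As [(m1, m2)] is divergence free, the integrand is the divergence of [(m1 * phi, m2 * phi)]. The
    4 adds the 2 of the curved side along [y] and the 2 arcs along [x]. *)
Lemma smooth_green_bound (M L : R) (phi : R * R -> R) : smooth phi -> 0 <= M ->
  (forall p, `|p.1| <= L -> `|p.2| <= L -> `|m1 p| <= M /\ `|m2 p| <= M) ->
  (forall t, `|(gamma t).1| <= L /\ `|(gamma t).2| <= L) -> `|s * L1| <= L -> h <= L ->
  `| \int[mu2]_(p in Q) (m1 p * partial ord0 phi p + m2 p * partial ord_max phi p) | <=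
  M * (\int[leb]_(y in `[- h, h]) `|phi (s * L1, y)| + 4 * \int[leb]_(t in `[0, T]) `|phi (gamma t)|).
Proof.
move=> sphi M0 hM hgL hsL hhL; have [h0 _] := gh.
have cphi := smooth_continuous sphi.
pose F1 p := m1 p * phi p; pose F2 p := m2 p * phi p.
have sF1 : smooth F1 by exact: smoothM.
have sF2 : smooth F2 by exact: smoothM.
have nF (F : R * R -> R) : smooth F -> continuous (fun p => `|F p|).
  by move=> sF p; apply: continuous_comp; [exact: (smooth_continuous sF)|exact: norm_continuous].
have gF (F : R * R -> R) : smooth F -> continuous (fun t => `|F (gamma t)|).
  move=> sF t; apply: (@continuous_comp _ _ _ gamma (fun p => `|F p|)); first exact: continuous_curve.
  exact: nF.
have sideF (F : R * R -> R) : smooth F -> continuous (fun y => `|F (s * L1, y)|).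
  by move=> sF y; exact: (@continuous_section_y _ (fun p => `|F p|) (s * L1) (nF F sF) y).
have -> : \int[mu2]_(p in Q) (m1 p * partial ord0 phi p + m2 p * partial ord_max phi p) =
  \int[mu2]_(p in Q) (partial ord0 F1 p + partial ord_max F2 p).
  apply: eq_Rintegral => p _; rewrite !partialM //.
  by rewrite addrACA -mulrDr divm mulr0 addr0.
have [[i1 le1] _] := htrace (nF _ sF1) (fun p => normr_ge0 _).
have h2 := (htrace (nF _ sF2) (fun p => normr_ge0 _)).2.
have b1 : \int[leb]_(t in `[0, T]) `|F1 (gamma t)| <= M * \int[leb]_(t in `[0, T]) `|phi (gamma t)|.
  apply: le_Rintegral_scaled; [exact: gF|exact: gF|] => t _.
  by rewrite normrM ler_wpM2r //; have [g1 g2] := hgL t; have [] := hM _ g1 g2.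
have b2 : \int[leb]_(t in `[0, T]) `|F2 (gamma t)| <= M * \int[leb]_(t in `[0, T]) `|phi (gamma t)|.
  apply: le_Rintegral_scaled; [exact: gF|exact: gF|] => t _.
  by rewrite normrM ler_wpM2r //; have [g1 g2] := hgL t; have [] := hM _ g1 g2.
have b3 : \int[leb]_(y in `[- h, h]) `|F1 (s * L1, y)| <= M * \int[leb]_(y in `[- h, h]) `|phi (s * L1, y)|.
  apply: le_Rintegral_scaled; [exact: sideF|exact: sideF|] => y; rewrite -ler_norml => yh.
  by rewrite normrM ler_wpM2r //; have [] := hM (s * L1, y) hsL (le_trans yh hhL).
set g := \int[leb]_(t in `[0, T]) `|phi (gamma t)| in b1 b2 *.
have B2 : \int[leb]_(y in `[- h, h]) `|F1 (s * horiz D y, y)| <= 2 * (M * g).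
  by apply: (le_trans le1); rewrite ler_pM2l.
have e1 x : F2 (x, h) = 0 by rewrite /F2 m2h mul0r.
have e2 x : F2 (x, - h) = 0 by rewrite /F2 m2mh mul0r.
have := gap_divergence hD hb hs gh bL1 sF1 sF2 e1 e2 i1 b3 B2 (B3 := M * g).
have h2' sg : sg = 1 \/ sg = -1 -> leb.-integrable `[Num.min (s * horiz D h) (s * b), Num.max (s * horiz D h) (s * b)]
      (EFin \o (fun x => `|F2 (x, sg * vert D (s * x))|)) /\
    \int[leb]_(x in `[Num.min (s * horiz D h) (s * b), Num.max (s * horiz D h) (s * b)])
      `|F2 (x, sg * vert D (s * x))| <= M * g.
  by move=> /h2[j1 j2]; split => //; exact: le_trans j2 b2.
move=> /(_ h2') h3; apply: (le_trans h3); rewrite le_eqVlt; apply/orP; left; apply/eqP; ring.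
Qed.

(** Approximation at every scale [t] gives [|N| <= C * t], hence [N = 0]. That [C] contains
    [2 / eps] is harmless because [eps] is fixed here. *)
Lemma gap_green (u : H1 Om) : has_trace gamma 0 T u 0 ->
  has_trace (fun y => (s * L1, y)) (- L2) L2 u 0 ->
  \int[mu2]_(p in Q) (m1 p * H1_grad u ord0 p + m2 p * H1_grad u ord_max p) = 0.
Proof.
move=> tr1 tr2; have [h0 _] := gh; have e0 := eps0; have T0 := boundary_period hgamma.
have hL := hL2.
have [C1 C10 ap1] := trace_approx (ltW T0) continuous_curve tr1.
have cside : continuous (fun y : R => (s * L1, y) : R * R).
  by apply: continuous_pair => y; [exact: cvg_cst|exact: cvg_id].
have [C2 C20 ap2] := trace_approx (ltac:(lra) : - L2 <= L2) cside tr2.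
have [MK hMK] := closure_bounded hD.
pose L := `|L1| + `|s * L1| + h + `|MK|.
have [Ma Ma0 hMa] := continuous_plane_bounded L (smooth_continuous sm1).
have [Mb Mb0 hMb] := continuous_plane_bounded L (smooth_continuous sm2).
pose M := Ma + Mb.
have M0 : 0 <= M by rewrite addr_ge0.
have n1 := normr_ge0 L1; have n2 := normr_ge0 (s * L1); have n3 := normr_ge0 MK; have n4 := ler_norm MK.
have n5 := ler_norm L1.
have hM p : `|p.1| <= L -> `|p.2| <= L -> `|m1 p| <= M /\ `|m2 p| <= M.
  by move=> p1 p2; have := hMa p p1 p2; have := hMb p p1 p2; rewrite /M; split; lra.
have hgL t : `|(gamma t).1| <= L /\ `|(gamma t).2| <= L.
  have [Kt _] := curve_boundary hD hgamma t; rewrite -curveE in Kt.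
  by have [k1 k2] := hMK _ Kt; rewrite /L; split; lra.
have hsL : `|s * L1| <= L by rewrite /L; lra.
have hhL : h <= L by rewrite /L; lra.
set N := \int[mu2]_(p in Q) _.
pose C := M * (((2 / eps + 1) * (C1 + C2) + C2) + 4 * C1) + M * (C1 + C1).
have main t : 0 < t -> `|N| <= C * t.
  move=> t0.
  have [phi [sphi v1 g1 tr]] := ap1 t t0; have [psi [spsi v2 g2 trs]] := ap2 t t0.
  have mO := @matrix_part_measurable _ D L2 eps.
  have lO := @matrix_part_lty _ D L2 eps.
  have mQ := @gap_measurable _ D s h L1.
  have QO : Q `<=` Om by exact: gap_sub.
  have sq_int f : sqint mu2 Om f -> integ mu2 Om (fun p => `|f p|).
    by move=> sf; apply: integ_norm => //; exact: sqint_integ.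
  have cs f : smooth f -> sqint mu2 Om f by move=> sf; exact: continuous_sqint (smooth_continuous sf).
  have iv f : smooth f -> integ mu2 Om (fun p => `|f p - u p|).
    by move=> sf; apply: sq_int; apply: sqintB => //; [exact: cs|exact: H1_sqint].
  have ig f i : smooth f -> integ mu2 Om (fun p => `|partial i f p - H1_grad u i p|).
    move=> sf; apply: sq_int; apply: sqintB => //; [|exact: H1_grad_sqint].
    by apply: cs; exact: smooth_partial.
  (* [phi] has small trace on the inclusion and [psi] on the side. Both approximate [u], so [chi] is
     small in the domain and [side_trace] makes [phi] small on the side too. *)
  pose chi p := phi p - psi p.
  have schi : smooth chi by exact: smoothB.
  have vchi : \int[mu2]_(p in Om) `|chi p| <= (C1 + C2) * t.
    apply: (@le_trans _ _ (\int[mu2]_(p in Om) (`|phi p - u p| + `|psi p - u p|))).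
      apply: le_Rintegral => //; [by apply: sq_int; exact: cs|by apply: integD => //; exact: iv|].
      by move=> p _; rewrite /chi (_ : phi p - psi p = (phi p - u p) - (psi p - u p)) ?ler_normB //; ring.
    by rewrite RintegralD ?mulrDl ?lerD //; exact: iv.
  have gchi : \int[mu2]_(p in Om) `|partial ord0 chi p| <= (C1 + C2) * t.
    apply: (@le_trans _ _ (\int[mu2]_(p in Om) (`|partial ord0 phi p - H1_grad u ord0 p| + `|partial ord0 psi p - H1_grad u ord0 p|))).
      apply: le_Rintegral => //.
      - by apply: sq_int; apply: cs; exact: smooth_partial.
      - by apply: integD => //; exact: ig.
      - move=> p _; rewrite /chi partialB // (_ : partial ord0 phi p - _ = (partial ord0 phi p - H1_grad u ord0 p) - (partial ord0 psi p - H1_grad u ord0 p)) ?ler_normB //; ring.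
    by rewrite RintegralD ?mulrDl ?lerD //; exact: ig.
  have e2 : 0 < eps / 2 by lra.
  have cnorm (f : R * R -> R) : smooth f -> continuous (fun y => `|f (s * L1, y)|).
    move=> sf y; apply: continuous_comp; last exact: norm_continuous.
    exact: (@continuous_section_y _ f (s * L1) (smooth_continuous sf) y).
  have sideA : \int[leb]_(y in `[- h, h]) `|chi (s * L1, y)| <= (2 / eps + 1) * (C1 + C2) * t.
    rewrite -(ler_pM2l e2); apply: (le_trans (side_trace hD eps0 hb hs gh hL2 schi)).
    have in1 : integ mu2 Om (fun p => `|chi p|) by apply: sq_int; exact: cs.
    have in2 : integ mu2 Om (fun p => `|partial ord0 chi p|).
      by apply: sq_int; apply: cs; exact: smooth_partial.
    rewrite RintegralD //; last exact: integZ.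
    rewrite RintegralZl //.
    have -> : eps / 2 * ((2 / eps + 1) * (C1 + C2) * t) = (C1 + C2) * t + eps / 2 * ((C1 + C2) * t).
      by field; rewrite gt_eqF.
    by apply: lerD => //; rewrite ler_pM2l.
  have sideB : \int[leb]_(y in `[- h, h]) `|psi (s * L1, y)| <= C2 * t.
    apply: (le_trans _ trs).
    have -> : \int[leb]_(r in `[- L2, L2]) `|psi (s * L1, r) - 0| = \int[leb]_(r in `[- L2, L2]) `|psi (s * L1, r)|.
      by apply: eq_Rintegral => r _; rewrite subr0.
    apply: Rintegral_subset => //; last exact: integ_continuous (cnorm psi spsi).
    by move=> r; rewrite /= !in_itv /= => /andP[r1 r2]; apply/andP; split; lra.
  have sideC : \int[leb]_(y in `[- h, h]) `|phi (s * L1, y)| <= ((2 / eps + 1) * (C1 + C2) + C2) * t.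
    rewrite mulrDl; apply: (le_trans _ (lerD sideA sideB)).
    have i1 := integ_continuous (- h) h (cnorm chi schi).
    have i2 := integ_continuous (- h) h (cnorm psi spsi).
    rewrite -RintegralD //; apply: le_Rintegral => //.
    - exact: integ_continuous (cnorm phi sphi).
    - exact: integD.
    - by move=> y _; rewrite (_ : phi (s * L1, y) = chi (s * L1, y) + psi (s * L1, y)) ?ler_normD // /chi subrK.
  have trg : \int[leb]_(r in `[0, T]) `|phi (gamma r)| <= C1 * t.
    by apply: (le_trans _ tr); rewrite le_eqVlt; apply/orP; left; apply/eqP; apply: eq_Rintegral => r _; rewrite subr0.
  have gb := smooth_green_bound sphi M0 hM hgL hsL hhL.
  have mG m i : smooth m -> integ mu2 Q (fun p => m p * H1_grad u i p).
    by move=> sm; apply: (integ_sub mO) => //; apply: sqint_mul => //; [exact: cs|exact: H1_grad_sqint].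
  have mP m i : smooth m -> integ mu2 Q (fun p => m p * partial i phi p).
    move=> sm; apply: (integ_sub mO) => //; apply: sqint_mul => //; [exact: cs|].
    by apply: cs; exact: smooth_partial.
  set N' := \int[mu2]_(p in Q) (m1 p * partial ord0 phi p + m2 p * partial ord_max phi p) in gb.
  have diff : `|N - N'| <= M * ((C1 + C1) * t).
    rewrite /N /N' -RintegralB //; [|by apply: integD => //; exact: mG|by apply: integD => //; exact: mP].
    apply: (le_trans (le_normr_Rintegral _ _)) => //.
      by apply: integB => //; apply: integD => //; [exact: mG|exact: mG|exact: mP|exact: mP].
    have iq i : integ mu2 Q (fun p => `|partial i phi p - H1_grad u i p|) by apply: (integ_sub mO) => //; exact: ig.
    apply: (@le_trans _ _ (\int[mu2]_(p in Q) (M * (`|partial ord0 phi p - H1_grad u ord0 p| + `|partial ord_max phi p - H1_grad u ord_max p|)))).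
      apply: le_Rintegral => //.
      - by apply: integ_norm => //; apply: integB => //; apply: integD => //; [exact: mG|exact: mG|exact: mP|exact: mP].
      - by apply: integZ => //; apply: integD.
      - move=> p Qp; have bL := bL1.
        have [q1 q2] := gap_bounded hD hb hs gh bL Qp.
        have [k1 k2] := hM p ltac:(rewrite /L; lra) ltac:(rewrite /L; lra).
        rewrite (_ : _ - _ = - (m1 p * (partial ord0 phi p - H1_grad u ord0 p) + m2 p * (partial ord_max phi p - H1_grad u ord_max p))); last by ring.
        rewrite normrN; apply: (le_trans (ler_normD _ _)); rewrite !normrM mulrDr.
        by apply: lerD; apply: ler_wpM2r.
    rewrite RintegralZl //; last exact: integD.
    apply: ler_wpM2l => //; rewrite RintegralD //; [|exact: iq|exact: iq]; rewrite mulrDl; apply: lerD; apply: (le_trans _ (g1 _)).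
      by apply: Rintegral_subset => //; exact: ig.
    by apply: Rintegral_subset => //; exact: ig.
  have -> : N = N' + (N - N') by rewrite addrC subrK.
  apply: (le_trans (ler_normD _ _)).
  have -> : C * t = M * ((((2 / eps + 1) * (C1 + C2) + C2) * t) + 4 * (C1 * t)) + M * ((C1 + C1) * t) by rewrite /C; ring.
  apply: lerD => //; apply: (le_trans gb); rewrite ler_wpM2l // lerD //.
  by rewrite ler_pM2l.
(* A positive [C] allows the scale [|N| / (2 * C)], at which the bound reads [|N| <= |N| / 2]. *)
have [C0|C0] := leP C 0.
  have := main 1 ltr01; rewrite mulr1 => /le_trans /(_ C0).
  by rewrite normr_le0 => /eqP.
apply/eqP; rewrite -normr_le0 leNgt; apply/negP => N0.
have t0 : 0 < `|N| / (2 * C) by rewrite divr_gt0 // mulr_gt0.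
have := main _ t0.
have -> : C * (`|N| / (2 * C)) = `|N| / 2 by field; rewrite gt_eqF.
lra.
Qed.

End ZeroTraceGreen.

(** * The comparison profile *)

(* Agrees with the boundary up to a quartic error, while its finite limit [kap / (2 * K)] lets the
   inclusion stay in [|x| <= b - profile] globally for large [K]. *)
Definition profile {R : realType} (kap K y : R) : R := kap * y ^+ 2 / (2 * (1 + K * y ^+ 2)).

Section Profile.
Context {R : realType} (kap K : R).
Hypothesis kap0 : 0 < kap.
Hypothesis K0 : 0 < K.
Notation g := (profile kap K).
Implicit Types y : R.

Let dpos y : 0 < 1 + K * y ^+ 2.
Proof. by have k0 := K0; have := mulr_ge0 (ltW k0) (sqr_ge0 y); lra. Qed.

Lemma profile_ge0 y : 0 <= g y.
Proof.
by rewrite /profile divr_ge0 // mulr_ge0 ?sqr_ge0 ?ltW //; have := dpos y; lra.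
Qed.

Lemma profile_le y : g y <= kap * y ^+ 2 / 2.
Proof.
have d := dpos y; rewrite /profile invfM mulrA ler_pdivrMr //.
rewrite -[leLHS]mulr1 ler_wpM2l //; last by have := mulr_ge0 (ltW K0) (sqr_ge0 y); lra.
by rewrite divr_ge0 // mulr_ge0 ?sqr_ge0 // ltW.
Qed.

Lemma profile_le_lim y : g y <= kap / (2 * K).
Proof.
have d := dpos y; have k0 := K0; rewrite /profile ler_pdivrMr; last lra.
rewrite mulrAC ler_pdivlMr; last lra.
rewrite -!mulrA ler_pM2l //; nra.
Qed.

Lemma profile_mono y z : `|y| <= `|z| -> g y <= g z.
Proof.
move=> yz; have d := dpos y; have d' := dpos z; have k0 := K0.
have yz2 : y ^+ 2 <= z ^+ 2 by rewrite -[y ^+ 2](real_normK (num_real _)) -[z ^+ 2](real_normK (num_real _)) lerXn2r ?nnegrE.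
rewrite /profile ler_pdivrMr; last lra.
rewrite mulrAC ler_pdivlMr; last lra.
rewrite -!mulrA ler_pM2l //; nra.
Qed.

Lemma profile_gt0 y : y != 0 -> 0 < g y.
Proof.
move=> y0; have d := dpos y; rewrite /profile divr_gt0 //; last lra.
by rewrite mulr_gt0 // exprn_even_gt0.
Qed.

Lemma profile_defect y : kap * y ^+ 2 / 2 - g y = K * y ^+ 2 * g y.
Proof. by rewrite /profile; field; rewrite gt_eqF. Qed.

End Profile.

Section ProfileExists.
Context {R : realType} (D : set (R * R)) (gamma : R -> R * R) (T t0 kap : R).
Hypothesis hD : inclusion D.
Hypothesis hgamma : boundary_param D gamma T.
Hypothesis ht0 : gamma t0 = (xmax D, 0).
Hypothesis hkap : kap = curvature gamma t0.
Hypothesis kap0 : 0 < kap.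
Notation b := (xmax D).
Notation X := (horiz D).

(** The chord from a point at height at least [h] to the tip crosses height [h] at an abscissa not
    smaller than that of the point. *)
Lemma horiz_tail h x y : good_height D h -> closure D (x, y) -> h <= `|y| -> x <= X h.
Proof.
move=> gh; have [h0 _] := gh; have hb := xmax_closure hD hgamma ht0.
wlog y0 : y / 0 <= y => [W|].
  case: (leP 0 y) => [|yn Kxy]; first exact: W.
  rewrite -(normrN y); apply: W; first lra.
  exact: closure_symm_x hD _ _ Kxy.
move=> Kxy; rewrite ger0_norm // => hy.
have xb : x <= b := closure_xmax hD Kxy.
move: hy; rewrite le_eqVlt => /predU1P[->|hy]; first exact: (horiz_ge hD).
have ne : (x, y) <> (b, 0) by case=> _; lra.
have ty : 0 < h / y < 1 by rewrite divr_gt0 ?ltr_pdivrMr ?mul1r //; lra.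
have := segment_inclusion hD Kxy hb ne ty.
rewrite mulr0 addr0 divfK; last by rewrite gt_eqF //; lra.
move=> /inclusion_closure /(horiz_ge hD); apply: le_trans.
move/andP: ty => [u0 u1]; nra.
Qed.

(** Near the tip the profile must stay below the parabola by more than the Taylor error; away from
    it, its limit must be below the distance by which the inclusion has already receded from [b].
    Both hold once [K] is large. *)
Lemma profile_exists (h0 : R) : 0 < h0 -> exists K C h, [/\ 0 < K, 0 < C & good_height D h] /\
  [/\ h <= h0, kap / (2 * K) < b,
    forall x y, closure D (x, y) -> `|x| <= b - profile kap K y &
    forall y, `|y| <= h -> b - profile kap K y - X y <= C * y ^+ 4].
Proof.
move=> h00; have hb := xmax_closure hD hgamma ht0.
have [C1 [h1 [C10 gh1 tay]]] := horiz_taylor hD hgamma ht0 hkap kap0.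
have [h10 _] := gh1; have k0 := kap0.
(* The last two bounds give [y ^+ 2 <= |y| <= kap / (4 * C1)] for [|y| <= h]. *)
pose h := Num.min (Num.min h0 h1) (Num.min 1 (kap / (4 * C1))).
have q0 : 0 < kap / (4 * C1) by rewrite divr_gt0 //; lra.
have hpos : 0 < h by rewrite /h !lt_min h00 h10 ltr01.
have [hh0 hh1] : h <= h0 /\ h <= h1 by rewrite /h !ge_min !lexx ?orbT.
have [hh2 hh3] : h <= 1 /\ h <= kap / (4 * C1) by rewrite /h !ge_min !lexx ?orbT.
have gh : good_height D h by apply: (good_heightW hD gh1); rewrite hpos.
have Xb : X h < b.
  by rewrite -(horiz0 hD hb); apply: (horiz_decreasing hD hb gh).
have X0 : 0 < X h by apply: (horiz_pos hD gh); rewrite gtr0_norm.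
(* The first summand gives [4 * C1 <= kap * K] for the heights below [h], the second
   [kap / (2 * K) <= b - X h] for those above. *)
pose K := 4 * C1 / kap + kap / (2 * (b - X h)).
have a0 : 0 < 4 * C1 / kap by rewrite divr_gt0 //; lra.
have b0 : 0 < kap / (2 * (b - X h)) by rewrite divr_gt0 //; lra.
have K0 : 0 < K by rewrite addr_gt0.
have kK : kap / (2 * K) <= b - X h.
  rewrite ler_pdivrMr; last lra.
  have : kap / (2 * (b - X h)) * (2 * (b - X h)) = kap by rewrite divfK // gt_eqF //; lra.
  have bX : 0 < b - X h by lra.
  have := mulr_gt0 a0 bX; rewrite /K; nra.
have K1 : 4 * C1 <= kap * K.
  rewrite /K mulrDr (_ : kap * (4 * C1 / kap) = 4 * C1); last by field; rewrite gt_eqF.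
  by rewrite lerDl mulr_ge0 // ltW.
have near y : `|y| <= h -> X y <= b - profile kap K y /\ b - profile kap K y - X y <= (C1 + kap * K / 2) * y ^+ 4.
  move=> yh; have := tay y (le_trans yh hh1); rewrite ler_norml => /andP[t1 t2].
  have dy : 0 < 1 + K * y ^+ 2 by have := mulr_ge0 (ltW K0) (sqr_ge0 y); lra.
  have y2 : y ^+ 2 <= kap / (4 * C1).
    rewrite -[y ^+ 2](real_normK (num_real _)); apply: (le_trans _ hh3).
    have := normr_ge0 y; nra.
  have y2' : 4 * C1 * y ^+ 2 <= kap.
    have : 4 * C1 * (kap / (4 * C1)) = kap by field; rewrite gt_eqF.
    by move=> <-; rewrite ler_pM2l //; lra.
  have df := profile_defect kap K0 y.
  have g0 := profile_ge0 kap0 K0 y.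
  have gE : profile kap K y * (2 * (1 + K * y ^+ 2)) = kap * y ^+ 2.
    by rewrite /profile divfK // gt_eqF //; lra.
  have y0 := sqr_ge0 y.
  have gl := profile_le kap0 K0 y.
  have y4 : y ^+ 4 = y ^+ 2 * y ^+ 2 by ring.
  set G := profile kap K y in df g0 gE gl *; set z := y ^+ 2 in y4 y0 df gE gl y2' dy t1 t2 *.
  have lowG : C1 * (z * z) <= K * z * G.
    have e1 : C1 * (2 * (1 + K * z)) <= K * kap by nra.
    have : C1 * (z * z) * (2 * (1 + K * z)) <= K * z * G * (2 * (1 + K * z)).
      by rewrite -(mulrA (K * z)) gE; have := mulr_ge0 y0 y0; nra.
    by rewrite ler_pM2r //; lra.
  rewrite y4 in t1 t2 *; split; first lra.
  have : K * z * G <= K * z * (kap * z / 2) by rewrite ler_wpM2l // mulr_ge0 // ltW.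
  nra.
exists K, (C1 + kap * K / 2), h; split; split => //.
- by have := mulr_gt0 k0 K0; lra.
- lra.
- move=> x y Kxy; have [yh|yh] := leP `|y| h.
    have [l1 _] := near y yh; apply: le_trans l1.
    by apply/(horiz_closureP hD) => //; apply: inclusion_closure; exact: (good_height_axis hD gh).
  have l1 := horiz_tail gh Kxy (ltW yh); have l2 := horiz_tail gh (closure_symm_y hD Kxy) (ltW yh).
  have gl := profile_le_lim kap0 K0 y.
  rewrite ler_norml; lra.
- by move=> y /near[].
Qed.

End ProfileExists.

(** * Sobolev functions as limits of smooth functions *)

Section BoundedConvergence.
Context d (A : measurableType d) (R : realType) (mu : {measure set A -> \bar R}).
Variables (S : set A) (mS : measurable S).
Hypothesis finS : (mu S < +oo)%E.

Lemma bounded_cvg (F : nat -> A -> R) (f : A -> R) (M : R) :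
  (forall n, measurable_fun S (F n)) -> (forall x, S x -> F n x @[n --> \oo] --> f x) ->
  (forall n x, S x -> `|F n x| <= M) ->
  (fun n => \int[mu]_(x in S) (F n x)%:E)%E @ \oo --> (\int[mu]_(x in S) (f x)%:E)%E.
Proof.
move=> mF Ff FM.
apply: (@dominated_cvg _ _ _ mu S mS (fun n x => (F n x)%:E) (fun x => (f x)%:E) (fun=> M%:E)) => //.
- by move=> n; apply/measurable_EFinP; exact: mF.
- by move=> x Sx; apply: cvg_EFin; [exact: nearW|exact: Ff].
- exact: (@integ_bounded _ _ _ mu S mS (fun=> M) `|M|).
Qed.

End BoundedConvergence.

Lemma cvg_bounded {R : realType} (u : nat -> R) (l M : R) :
  u @ \oo --> l -> (forall n, `|u n| <= M) -> `|l| <= M.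
Proof.
move=> ul uM; have un : (fun n => `|u n|) @ \oo --> `|l| by exact: cvg_norm.
have <- := cvg_lim (@Rhausdorff R) un.
by apply: limr_le; [apply/cvg_ex; exists (`|l|) | exact: nearW].
Qed.

Section TestFunctions.
Context {R : realType}.
Implicit Types F : R * R -> R.

Lemma off_support F i p : ~ closure [set q | F q != 0] p -> F p = 0 /\ partial i F p = 0.
Proof.
move=> np; have nz : \forall q \near p, F q = 0.
  have : nbhs p (~` closure [set q | F q != 0]).
    by apply: open_nbhs_nbhs; split => //; apply: closed_openC; exact: closed_closure.
  apply: filterS => q nq; apply/eqP; apply: contrapT => /negP qn; apply: nq.
  exact: subset_closure.
split; first exact: nbhs_singleton nz.
rewrite /partial (near_eq_derive (g := fun=> 0)) ?derive_cst //.
Qed.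

End TestFunctions.

Section SobolevTools.
Context {R : realType} (D : set (R * R)) (L2 eps : R).
Notation leb := (@lebesgue_measure R).
Notation mu2 := (@plane_measure R).
Notation RR := (measurableTypeR R * measurableTypeR R)%type.
Notation Om := (matrix_part D L2 eps).
Notation L1 := (half_width D eps).

Lemma continuous_integ (f : R * R -> R) : continuous f -> integ mu2 Om f.
Proof.
by move=> cf; apply: sqint_integ; [exact: matrix_part_measurable|exact: matrix_part_lty|exact: continuous_sqint].
Qed.

(** Off the support both [F] and its derivative vanish, so [Om], whose sections are irregular, can
    be exchanged for a large box, where each section integral is zero by the fundamental theorem of
    calculus. *)
Lemma integral_partial_support (F : R * R -> R) i : smooth F -> closure [set p | F p != 0] `<=` Om ->
  \int[mu2]_(p in Om) partial i F p = 0.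
Proof.
move=> sF FO; have mO := @matrix_part_measurable _ D L2 eps.
pose L := `|L1| + `|L2| + 1.
have L0 : - L <= L by rewrite /L; have := normr_ge0 L1; have := normr_ge0 L2; lra.
pose B : set (R * R) := [set p | - L < p.1 < L /\ - L < p.2 < L].
have OB : Om `<=` B.
  move=> p /matrix_part_bounded[p1 p2]; rewrite /B /=.
  by rewrite -!ltr_norml; split; rewrite /L; lra.
have F0 q : ~ B q -> F q = 0.
  by move=> nB; have [] := @off_support _ F ord0 q => // /FO /OB.
have EB : (partial i F \_ Om) = (partial i F \_ B).
  apply/funext => p; rewrite !patchE; case: ifPn => [/set_mem /OB Bp|/negP nO].
    by rewrite mem_set.
  case: ifP => // _; have [] // := @off_support _ F i p.
  by move=> /FO Op; apply: nO; rewrite inE.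
have iF : integ mu2 Om (partial i F) := continuous_integ (smooth_continuous (smooth_partial i sF)).
have : (\int[mu2]_(p in Om) partial i F p)%:E = 0%E.
  rewrite integ_EFin //.
  have [i0|i1] : i = ord0 \/ i = ord_max.
    by case: i {EB iF} => -[|[|//]] hi; [left|right]; apply: val_inj.
  - rewrite plane_integral_y // EB i0.
    under eq_integral => y _.
      rewrite (_ : (\int[leb]_x _)%E = 0%E); last first.
        have [yL|yL] := boolP ((- L < y) && (y < L)).
          rewrite (@section_integral_y _ _ _ `](- L), L[%classic).
            by rewrite ftc_section_x // !F0 ?subrr // /B /= ltxx ?andbF => -[].
          by move=> x; rewrite /B /= in_itv /=; split => [[]|->].
        rewrite (@integral_patch0 _ _ _ (fun x => (x, y))) //.
        by move=> x [_ /= /andP[y1 y2]]; move/negP: yL; apply; rewrite y1.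
      over.
    exact: integral0.
  - rewrite plane_integral_x // EB i1.
    under eq_integral => x _.
      rewrite (_ : (\int[leb]_y _)%E = 0%E); last first.
        have [xL|xL] := boolP ((- L < x) && (x < L)).
          rewrite (@section_integral_x _ _ _ `](- L), L[%classic).
            by rewrite ftc_section_y // !F0 ?subrr // /B /= ltxx ?andbF => -[].
          by move=> y; rewrite /B /= in_itv /=; split => [[]|->].
        rewrite (@integral_patch0 _ _ _ (fun y => (x, y))) //.
        by move=> y [/= /andP[y1 y2] _]; move/negP: xL; apply; rewrite y1.
      over.
    exact: integral0.
by case.
Qed.

Lemma smooth_by_parts (f phi : R * R -> R) i : smooth f -> test_function Om phi ->
  \int[mu2]_(p in Om) (f p * partial i phi p) = - \int[mu2]_(p in Om) (partial i f p * phi p).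
Proof.
move=> sf [sphi [_ phiO]]; have mO := @matrix_part_measurable _ D L2 eps.
have sub : closure [set p | f p * phi p != 0] `<=` Om.
  apply: subset_trans phiO; apply: closure_subset => p /=.
  by apply: contraNN => /eqP ->; rewrite mulr0.
have := integral_partial_support i (smoothM sf sphi) sub.
under eq_Rintegral do rewrite partialM // (mulrC (phi _)).
have c1 : integ mu2 Om (fun p => f p * partial i phi p).
  by apply: continuous_integ; exact: (smooth_continuous (smoothM sf (smooth_partial i sphi))).
have c2 : integ mu2 Om (fun p => partial i f p * phi p).
  by apply: continuous_integ; exact: (smooth_continuous (smoothM (smooth_partial i sf) sphi)).
by rewrite RintegralD // => /eqP; rewrite addr_eq0 => /eqP.
Qed.

(** Dominated convergence passes to the limit both in the integration by parts and in the H^1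
    distance. Value and gradient of the result are the prescribed functions themselves, so that
    later computations are pointwise. *)
Lemma H1_limit (phi : nat -> R * R -> R) (w : R * R -> R) (G : 'I_2 -> R * R -> R) (M : R) :
  (forall n, smooth (phi n)) ->
  (forall p, Om p -> phi n p @[n --> \oo] --> w p) ->
  (forall i p, Om p -> partial i (phi n) p @[n --> \oo] --> G i p) ->
  (forall n p, Om p -> `|phi n p| <= M) ->
  (forall n i p, Om p -> `|partial i (phi n) p| <= M) ->
  exists u : H1 Om, [/\ H1_val u = w, H1_grad u = G &
    (fun n => H1_sqdist (phi n) u) @ \oo --> 0%E].
Proof.
move=> sphi phiw phiG phiM phiGM.
have mO := @matrix_part_measurable _ D L2 eps.
have lO := @matrix_part_lty _ D L2 eps.
have mphi n : @measurable_fun _ _ RR _ Om (phi n).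
  exact: continuous_plane_measurable mO (smooth_continuous (sphi n)).
have mdphi n i : @measurable_fun _ _ RR _ Om (partial i (phi n)).
  exact: continuous_plane_measurable mO (smooth_continuous (smooth_partial i (sphi n))).
have mw : @measurable_fun _ _ RR _ Om w by apply: measurable_fun_cvg; [exact: mphi|exact: phiw].
have mG i : @measurable_fun _ _ RR _ Om (G i).
  by apply: measurable_fun_cvg; [move=> n; exact: (mdphi n i)|exact: phiG].
have wM p : Om p -> `|w p| <= M by move=> Op; apply: cvg_bounded (phiw p Op) _ => n; exact: phiM.
have GM i p : Om p -> `|G i p| <= M.
  by move=> Op; apply: cvg_bounded (phiG i p Op) _ => n; exact: phiGM.
have sqw : square_integrable Om w.
  by split => //; apply: sqint_lty; exact: (sqint_bounded mO lO mw wM).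
have sqG i : square_integrable Om (G i).
  split; first exact: mG.
  by apply: sqint_lty; exact: (sqint_bounded mO lO (mG i) (GM i)).
have wk i : weak_partial Om i w (G i).
  move=> f tf; have [sf _] := tf.
  have [N1 N10 hN1] := continuous_plane_bounded (`|L1| + `|L2|) (smooth_continuous sf).
  have [N2 N20 hN2] := continuous_plane_bounded (`|L1| + `|L2|) (smooth_continuous (smooth_partial i sf)).
  have mf : @measurable_fun _ _ RR _ Om f := continuous_plane_measurable mO (smooth_continuous sf).
  have mdf : @measurable_fun _ _ RR _ Om (partial i f).
    exact: continuous_plane_measurable mO (smooth_continuous (smooth_partial i sf)).
  have bd (a c x y : R) : `|a| <= x -> `|c| <= y -> `|a * c| <= x * y.
    by move=> ax cy; rewrite normrM; apply: ler_pM.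
  have bO p : Om p -> `|f p| <= N1 /\ `|partial i f p| <= N2.
    by move=> /matrix_part_bounded[p1 p2]; split; [exact: hN1|exact: hN2].
  have c1 := @bounded_cvg _ _ _ mu2 Om mO lO (fun n p => phi n p * partial i f p)
    (fun p => w p * partial i f p) (M * N2).
  have c2 := @bounded_cvg _ _ _ mu2 Om mO lO (fun n p => partial i (phi n) p * f p)
    (fun p => G i p * f p) (M * N1).
  have {}c1 : (fun n => (\int[mu2]_(p in Om) (phi n p * partial i f p)%:E)%E) @ \oo -->
      (\int[mu2]_(p in Om) (w p * partial i f p)%:E)%E.
    apply: c1 => [n|p Op|n p Op]; first exact: measurable_funM.
      by apply: cvgM; [exact: phiw|exact: cvg_cst].
    by apply: bd; [exact: phiM|have [] := bO p Op].
  have {}c2 : (fun n => (\int[mu2]_(p in Om) (partial i (phi n) p * f p)%:E)%E) @ \oo -->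
      (\int[mu2]_(p in Om) (G i p * f p)%:E)%E.
    apply: c2 => [n|p Op|n p Op]; first exact: measurable_funM.
      by apply: cvgM; [exact: phiG|exact: cvg_cst].
    by apply: bd; [exact: phiGM|have [] := bO p Op].
  have i1 n : integ mu2 Om (fun p => phi n p * partial i f p).
    by apply: continuous_integ; exact: (smooth_continuous (smoothM (sphi n) (smooth_partial i sf))).
  have i2 n : integ mu2 Om (fun p => partial i (phi n) p * f p).
    by apply: continuous_integ; exact: (smooth_continuous (smoothM (smooth_partial i (sphi n)) sf)).
  have j1 : integ mu2 Om (fun p => w p * partial i f p).
    apply: (@integ_bounded _ _ _ mu2 Om mO _ (M * N2)) => //; first exact: measurable_funM.
    by move=> p Op; apply: bd; [exact: wM|have [] := bO p Op].
  have j2 : integ mu2 Om (fun p => G i p * f p).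
    apply: (@integ_bounded _ _ _ mu2 Om mO _ (M * N1)) => //; first exact: measurable_funM.
    by move=> p Op; apply: bd; [exact: GM|have [] := bO p Op].
  rewrite -(integ_EFin mO j1) in c1; rewrite -(integ_EFin mO j2) in c2.
  have {}c1 := fine_cvg (FF := @eventually_filter) c1.
  have {}c2 := fine_cvg (FF := @eventually_filter) c2.
  apply: (cvg_unique (@Rhausdorff R) c1).
  rewrite (_ : _ \o _ = - (fine \o (fun n => (\int[mu2]_(p in Om) (partial i (phi n) p * f p)%:E)%E))).
    exact: cvgN c2.
  apply/funext => n; rewrite /= /GRing.opp /=.
  exact: smooth_by_parts.
exists (Build_H1 sqw sqG wk); split => //.
rewrite /H1_sqdist /=.
have -> : 0%E = (\int[mu2]_(p in Om) (0:R)%:E)%E by rewrite integral0.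
apply: (@bounded_cvg _ _ _ mu2 Om mO lO _ _ ((2 * M) ^+ 2 + ((2 * M) ^+ 2 + (2 * M) ^+ 2))).
- move=> n; under eq_fun do rewrite sum_ord2.
  apply: measurable_funD; first by apply: measurable_funX; exact: measurable_funB.
  by apply: measurable_funD; apply: measurable_funX; exact: measurable_funB.
- move=> p Op; under eq_fun do rewrite sum_ord2.
  have z (u : nat -> R) l : u @ \oo --> l -> (fun n => (u n - l) ^+ 2) @ \oo --> (0 : R).
    move=> ul; have c : (fun n => u n - l) @ \oo --> l - l by apply: cvgB => //; exact: cvg_cst.
    rewrite subrr in c; under eq_fun do rewrite expr2.
    by have cc := cvgM c c; rewrite mulr0 in cc; exact: cc.
  have cc := cvgD (z _ _ (phiw p Op)) (cvgD (z _ _ (phiG ord0 p Op)) (z _ _ (phiG ord_max p Op))).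
  by rewrite !addr0 in cc; exact: cc.
- move=> n p Op; rewrite sum_ord2.
  have sq (a c : R) : `|a| <= M -> `|c| <= M -> (a - c) ^+ 2 <= (2 * M) ^+ 2.
    move=> aM cM; rewrite -(real_normK (num_real (a - c))); apply: lerXn2r; rewrite ?nnegrE //.
      by have := normr_ge0 a; lra.
    by apply: (le_trans (ler_normB _ _)); lra.
  rewrite ger0_norm; last by rewrite addr_ge0 ?sqr_ge0 // addr_ge0 ?sqr_ge0.
  by apply: lerD; [exact: sq (phiM n p Op) (wM p Op)|apply: lerD; apply: sq (phiGM _ _ _ Op) (GM _ _ Op)].
Qed.

End SobolevTools.

Section Combination.
Context {R : realType} (D : set (R * R)) (L2 eps : R).
Notation leb := (@lebesgue_measure R).
Notation mu2 := (@plane_measure R).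
Notation RR := (measurableTypeR R * measurableTypeR R)%type.
Notation Om := (matrix_part D L2 eps).
Variables (a b : R) (u w : H1 Om).

Lemma sqint_square_integrable (f : R * R -> R) : sqint mu2 Om f -> square_integrable Om f.
Proof. by move=> sf; split; [case: sf|exact: sqint_lty]. Qed.

Lemma comb_sqint (f g : R * R -> R) : sqint mu2 Om f -> sqint mu2 Om g ->
  square_integrable Om (fun p => a * f p + b * g p).
Proof.
have mO := @matrix_part_measurable _ D L2 eps.
by move=> sf sg; apply: sqint_square_integrable; apply: sqintD => //; exact: sqintZ.
Qed.

Lemma comb_weak i : weak_partial Om i (fun p => a * u p + b * w p)
  (fun p => a * H1_grad u i p + b * H1_grad w i p).
Proof.
have mO := @matrix_part_measurable _ D L2 eps.
move=> f tf; have [sf _] := tf.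
have s1 : sqint mu2 Om f := continuous_sqint _ _ _ (smooth_continuous sf).
have s2 : sqint mu2 Om (partial i f) := continuous_sqint _ _ _ (smooth_continuous (smooth_partial i sf)).
have lin (f1 f2 h : R * R -> R) : sqint mu2 Om f1 -> sqint mu2 Om f2 -> sqint mu2 Om h ->
    \int[mu2]_(p in Om) ((a * f1 p + b * f2 p) * h p) =
    a * \int[mu2]_(p in Om) (f1 p * h p) + b * \int[mu2]_(p in Om) (f2 p * h p).
  move=> h1 h2 hh; have k1 := sqint_mul mO h1 hh; have k2 := sqint_mul mO h2 hh.
  rewrite -!RintegralZl // -RintegralD //; [|exact: integZ|exact: integZ].
  by apply: eq_Rintegral => p _; ring.
rewrite lin //; [|exact: H1_sqint|exact: H1_sqint].
rewrite lin //; [|exact: H1_grad_sqint|exact: H1_grad_sqint].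
have := H1_weak u i tf; have := H1_weak w i tf => -> ->; ring.
Qed.

(** Built with an explicit gradient, so that the gradient of a combination reduces by
    computation. *)
Definition H1_comb : H1 Om :=
  Build_H1 (comb_sqint (H1_sqint u) (H1_sqint w))
    (fun i => comb_sqint (H1_grad_sqint u i) (H1_grad_sqint w i)) comb_weak.

Lemma H1_comb_grad i p : H1_grad H1_comb i p = a * H1_grad u i p + b * H1_grad w i p.
Proof. by []. Qed.

Lemma comb_sq (x y : R) : (a * x + b * y) ^+ 2 <= 2 * a ^+ 2 * x ^+ 2 + 2 * b ^+ 2 * y ^+ 2.
Proof. have := sqr_ge0 (a * x - b * y); nra. Qed.

Lemma ge0_integral_comb_le d (A : measurableType d) (m : {measure set A -> \bar R}) (S : set A)
    (f g h : A -> R) : measurable S -> measurable_fun S f -> measurable_fun S g -> measurable_fun S h ->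
  (forall x, S x -> 0 <= h x) -> (forall x, S x -> 0 <= f x) -> (forall x, S x -> 0 <= g x) ->
  (forall x, S x -> h x <= 2 * a ^+ 2 * f x + 2 * b ^+ 2 * g x) ->
  (\int[m]_(x in S) (h x)%:E <= (2 * a ^+ 2)%:E * \int[m]_(x in S) (f x)%:E
    + (2 * b ^+ 2)%:E * \int[m]_(x in S) (g x)%:E)%E.
Proof.
move=> mS mf mg mh h0 f0 g0 hfg.
have a2 : 0 <= 2 * a ^+ 2 by rewrite mulr_ge0 ?sqr_ge0.
have b2 : 0 <= 2 * b ^+ 2 by rewrite mulr_ge0 ?sqr_ge0.
rewrite -!ge0_integralZl_EFin //; [|exact/measurable_EFinP|exact/measurable_EFinP].
rewrite -ge0_integralD //.
- apply: ge0_le_integral => //.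
  + exact/measurable_EFinP.
  + by apply: emeasurable_funD; apply: emeasurable_funM => //; exact/measurable_EFinP.
- by move=> x Sx; rewrite -EFinM lee_fin mulr_ge0 // f0.
- by apply: emeasurable_funM => //; exact/measurable_EFinP.
- by move=> x Sx; rewrite -EFinM lee_fin mulr_ge0 // g0.
- by apply: emeasurable_funM => //; exact/measurable_EFinP.
Qed.

Lemma cvg_comb0 (f g h : nat -> \bar R) (c1 c2 : R) : f @ \oo --> 0%E -> g @ \oo --> 0%E ->
  (forall n, 0 <= h n)%E -> (forall n, h n <= c1%:E * f n + c2%:E * g n)%E -> h @ \oo --> 0%E.
Proof.
move=> f0 g0 h0 hfg.
apply: (@squeeze_cvge _ _ _ _ (fun=> 0%E) _ (fun n => c1%:E * f n + c2%:E * g n)%E).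
- by apply: nearW => n; rewrite h0 hfg.
- exact: cvg_cst.
- have c : (fun n => c1%:E * f n + c2%:E * g n)%E @ \oo --> (c1%:E * 0 + c2%:E * 0)%E.
    by apply: cvgeD; [rewrite !mule0|exact: cvgeZl|exact: cvgeZl].
  by rewrite !mule0 adde0 in c.
Qed.

Lemma has_trace_comb (c : R -> R * R) (t1 t2 g1 g2 : R) : continuous c ->
  has_trace c t1 t2 u g1 -> has_trace c t1 t2 w g2 ->
  has_trace c t1 t2 H1_comb (a * g1 + b * g2).
Proof.
have mO := @matrix_part_measurable _ D L2 eps.
move=> cc [phi [sphi dphi tphi]] [psi [spsi dpsi tpsi]].
have cm n : smooth (fun p => a * phi n p + b * psi n p) 
  by move=> k; apply: CnD; apply: CnZ; [exact: sphi|exact: spsi].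
exists (fun n p => a * phi n p + b * psi n p).
have pc n i p : partial i (fun p => a * phi n p + b * psi n p) p = a * partial i (phi n) p + b * partial i (psi n) p.
  apply: partialE.
  exact: (is_deriveD (is_deriveZ a (smooth_is_derive i p (sphi n))) (is_deriveZ b (smooth_is_derive i p (spsi n)))).
have ms (f : nat -> R * R -> R) (v : H1 Om) n : (forall n, smooth (f n)) ->
    @measurable_fun _ _ RR _ Om (fun p => (f n p - v p) ^+ 2 + \sum_(i < 2) (partial i (f n) p - H1_grad v i p) ^+ 2).
  move=> sf; under eq_fun do rewrite sum_ord2.
  have mG i : @measurable_fun _ _ RR _ Om (H1_grad v i) by have [] := H1_grad_sqint v i.
  have mv : @measurable_fun _ _ RR _ Om v by have [] := H1_sqint v.
  have mp i : @measurable_fun _ _ RR _ Om (partial i (f n)).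
    exact: continuous_plane_measurable mO (smooth_continuous (smooth_partial i (sf n))).
  have mf : @measurable_fun _ _ RR _ Om (f n).
    exact: continuous_plane_measurable mO (smooth_continuous (sf n)).
  apply: measurable_funD; first by apply: measurable_funX; exact: measurable_funB.
  by apply: measurable_funD; apply: measurable_funX; exact: measurable_funB.
have pos (f : nat -> R * R -> R) (v : H1 Om) n p :
    0 <= (f n p - v p) ^+ 2 + \sum_(i < 2) (partial i (f n) p - H1_grad v i p) ^+ 2.
  by rewrite sum_ord2 addr_ge0 ?sqr_ge0 // addr_ge0 ?sqr_ge0.
have mt (f : nat -> R * R -> R) g n : (forall n, smooth (f n)) ->
    measurable_fun `[t1, t2]%classic (fun t => (f n (c t) - g) ^+ 2 : R).
  move=> sf; apply: measurable_funTS; apply: continuous_measurable_fun => t.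
  have ct : {for t, continuous (fun t => f n (c t) - g)}.
    apply: cvgB; last exact: cvg_cst.
    by apply: (@continuous_comp _ _ _ c (f n)); [exact: cc|exact: (smooth_continuous (sf n))].
  by under eq_fun do rewrite expr2; exact: (cvgM ct ct).
split => //.
- apply: cvg_comb0 dphi dpsi _ _ => n.
    by apply: integral_ge0 => p _; rewrite lee_fin (pos (fun n p => a * phi n p + b * psi n p)).
  apply: ge0_integral_comb_le => //; [exact: ms|exact: ms|exact: (ms (fun n p => a * phi n p + b * psi n p))| |].
    by move=> p _; exact: (pos (fun n p => a * phi n p + b * psi n p)).
  move=> p _; rewrite !sum_ord2 !pc /=.
  have e1 (x y z t : R) : a * x + b * y - (a * z + b * t) = a * (x - z) + b * (y - t) by ring.
  rewrite !e1 !mulrDr.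
  have h1 := comb_sq (phi n p - u p) (psi n p - w p).
  have h2 := comb_sq (partial ord0 (phi n) p - H1_grad u ord0 p) (partial ord0 (psi n) p - H1_grad w ord0 p).
  have h3 := comb_sq (partial ord_max (phi n) p - H1_grad u ord_max p) (partial ord_max (psi n) p - H1_grad w ord_max p).
  lra.
- apply: cvg_comb0 tphi tpsi _ _ => n.
    by apply: integral_ge0 => p _; rewrite lee_fin sqr_ge0.
  apply: ge0_integral_comb_le.
  + exact: measurable_itv.
  + exact: mt.
  + exact: mt.
  + exact: (mt (fun n p => a * phi n p + b * psi n p)).
  + by move=> p _; exact: sqr_ge0.
  + by move=> p _; exact: sqr_ge0.
  + by move=> p _; exact: sqr_ge0.
  + move=> t _; have := comb_sq (phi n (c t) - g1) (psi n (c t) - g2).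
    by apply: le_trans; rewrite le_eqVlt; apply/orP; left; apply/eqP; congr (_ ^+ 2); ring.
Qed.

End Combination.

(** * The ramp across the gap *)

(* Smooth approximation of [Num.max t 0].  Thanks to the shift [c], much larger than the smoothing
   length [a], its derivative also converges at [t = 0], so that gradients of ramps converge at every
   point and no null set has to be discarded. *)
Definition soft {R : realType} (a c t : R) : R := ((t - c) + Num.sqrt ((t - c) ^+ 2 + a ^+ 2)) / 2.
Definition dsoft {R : realType} (a c t : R) : R := (1 + (t - c) / Num.sqrt ((t - c) ^+ 2 + a ^+ 2)) / 2.

Section SmoothPositivePart.
Context {R : realType} (a c : R).
Hypothesis a0 : 0 < a.
Hypothesis c0 : 0 < c.
Implicit Types t : R.

Let S t := Num.sqrt ((t - c) ^+ 2 + a ^+ 2).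

Let S_bounds t : [/\ 0 < S t, `|t - c| <= S t & S t <= `|t - c| + a].
Proof.
have a2 : 0 < a ^+ 2 by rewrite exprn_gt0.
have u2 := sqr_ge0 (t - c).
split.
- by rewrite sqrtr_gt0; lra.
- by rewrite -sqrtr_sqr ler_sqrt; lra.
- have n0 := normr_ge0 (t - c); have p : 0 <= `|t - c| + a by have := a0; lra.
  rewrite -[leRHS](ger0_norm p) -sqrtr_sqr; apply: ler_wsqrtr.
  rewrite -[(t - c) ^+ 2](real_normK (num_real _)); have := a0; nra.
Qed.

Lemma soft_close t : `|soft a c t - Num.max t 0| <= a + c.
Proof.
have [_ s1 s2] := S_bounds t; rewrite /soft -/(S t).
have c1 := c0; have a1 := a0; rewrite ler_norml; move: s1; rewrite ler_norml => /andP[s3 s4].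
have [t0|t0] := leP t 0; first by rewrite ler0_norm in s2; lra.
have [tc|tc] := leP 0 (t - c); first by rewrite ger0_norm in s2; lra.
by rewrite ltr0_norm in s2; lra.
Qed.

Lemma dsoft_range t : 0 <= dsoft a c t <= 1.
Proof.
have [s0 s1 _] := S_bounds t; rewrite /dsoft -/(S t).
have : `|(t - c) / S t| <= 1 by rewrite normrM normfV (gtr0_norm s0) ler_pdivrMr // mul1r.
rewrite ler_norml; lra.
Qed.

Lemma dsoft_neg t : t <= 0 -> `|dsoft a c t| <= a / c.
Proof.
move=> t0; have [s0 s1 s2] := S_bounds t; have /andP[d0 _] := dsoft_range t.
rewrite ger0_norm // /dsoft -/(S t); have c1 := c0; have a1 := a0.
rewrite ler0_norm in s1 s2; try lra.
rewrite ler_pdivlMr // (_ : _ * c = (S t + (t - c)) * c / (2 * S t)); last by field; rewrite gt_eqF.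
rewrite ler_pdivrMr; last lra.
nra.
Qed.

Lemma dsoft_pos t : 2 * c <= t -> `|dsoft a c t - 1| <= a / t.
Proof.
move=> tc; have [s0 s1 s2] := S_bounds t; have /andP[_ d1] := dsoft_range t.
rewrite distrC ger0_norm ?subr_ge0 // /dsoft -/(S t); have c1 := c0; have a1 := a0.
rewrite ger0_norm in s1 s2; try lra.
rewrite ler_pdivlMr; last lra.
rewrite (_ : _ * t = (S t - (t - c)) * t / (2 * S t)); last by field; rewrite gt_eqF.
rewrite ler_pdivrMr; last lra.
nra.
Qed.

Lemma soft_is_derive t : is_derive t 1 (soft a c) (dsoft a c t).
Proof.
have [s0 _ _] := S_bounds t.
have pos : 0 < (t - c) ^+ 2 + a ^+ 2 by rewrite -sqrtr_gt0.
have d1 : is_derive t 1 (fun t : R => t - c) 1.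
  apply: (is_derive_eq (is_deriveB (is_derive_id t (1 : R)) (is_derive_cst c t (1 : R)))).
  by rewrite subr0.
have d2 : is_derive t 1 (fun t : R => (t - c) ^+ 2 + a ^+ 2) (2 * (t - c)).
  apply: (is_derive_eq (is_deriveD (is_deriveM d1 d1) (is_derive_cst (a ^+ 2) t (1 : R)))).
  by rewrite /GRing.scale /=; ring.
have d3 := is_derive1_comp (g := fun r : R => (r - c) ^+ 2 + a ^+ 2) (is_derive1_sqrt pos) d2.
have := is_deriveZ (2^-1) (is_deriveD d1 d3).
rewrite (_ : _ \*: _ = soft a c).
  move=> d4; apply: (is_derive_eq d4).
  by rewrite /dsoft /GRing.scale /= -/(S t); field; exact/lt0r_neq0.
by apply/funext => r; rewrite /soft /= mulrC.
Qed.

End SmoothPositivePart.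

Section Ramp.
Context {R : realType}.
Notation delta := (@harmonic R).

Lemma harmonic_cvg (u : nat -> R) (l C : R) (N : nat) :
  (forall n, (N <= n)%N -> `|u n - l| <= C * delta n) -> u @ \oo --> l.
Proof.
move=> h; apply/cvgrPdist_le => e e0.
have c : (fun n => C * delta n) @ \oo --> C * 0 by apply: cvgM; [exact: cvg_cst|exact: cvg_harmonic].
rewrite mulr0 in c; have /cvgr_lt /(_ e e0) c' := c.
near=> n; rewrite distrC; apply: le_trans (h n _) _.
  by near: n; exact: nbhs_infty_ge.
by apply: ltW; near: n.
Unshelve. all: by end_near. Qed.

Lemma harmonic_le1 n : 0 < delta n <= 1.
Proof. by rewrite /harmonic /= invr_gt0 ltr0n /= invf_le1 ?ltr0n // ler1n. Qed.

Variables (f : R * R -> R).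
Hypothesis sf : smooth f.

(** Smoothing length [delta n ^+ 2] and shift [delta n]: both tend to zero, and so does their
    quotient [delta n], which bounds the derivative at nonpositive arguments. *)
Definition soft_ramp n p := soft (delta n ^+ 2) (delta n) (f p).

Lemma soft_ramp_smooth n : smooth (soft_ramp n).
Proof.
have /andP[d0 _] := harmonic_le1 n.
have -> : soft_ramp n = (fun p => 2^-1 * ((f p - delta n) + Num.sqrt ((f p - delta n) ^+ 2 + (delta n ^+ 2) ^+ 2))).
  by apply/funext => p; rewrite /soft_ramp /soft mulrC.
move=> k; apply: CnZ; have hf : Cn k (fun p => f p - delta n) by apply: CnB => //; exact: Cn_cst.
apply: CnD => //; apply: Cn_sqrt => [p|]; last by apply: CnD; [exact: CnX|exact: Cn_cst].
by rewrite ltr_wpDl ?sqr_ge0 // !exprn_gt0.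
Qed.

Lemma soft_ramp_partial n i p : partial i (soft_ramp n) p = dsoft (delta n ^+ 2) (delta n) (f p) * partial i f p.
Proof.
have /andP[d0 _] := harmonic_le1 n.
apply: partialE; apply/is_derive_lineP.
have d2 : 0 < delta n ^+ 2 by rewrite exprn_gt0.
apply: (is_derive1_comp (g := fun t => f (line i p t)) (f := soft (delta n ^+ 2) (delta n))).
  by rewrite line_pcoord; exact: soft_is_derive.
by apply/is_derive_lineP; exact: smooth_is_derive.
Qed.

Lemma soft_ramp_close n p : `|soft_ramp n p - Num.max (f p) 0| <= 2 * delta n.
Proof.
have /andP[d0 d1] := harmonic_le1 n.
have d2 : 0 < delta n ^+ 2 by rewrite exprn_gt0.
apply: (le_trans (soft_close d2 d0 (f p))); nra.
Qed.

Lemma soft_ramp_grad_cvg i p :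
  (fun n => partial i (soft_ramp n) p) @ \oo --> (0 < f p)%R%:R * partial i f p.
Proof.
have c : (fun n => dsoft (delta n ^+ 2) (delta n) (f p)) @ \oo --> ((0 < f p)%R%:R : R).
  have [fp|fp] := ltP 0 (f p).
    have [N _ hN] : \forall n \near \oo, delta n < f p / 2.
      by apply: (cvgr_lt 0); [exact: cvg_harmonic|lra].
    apply: (@harmonic_cvg _ _ (f p)^-1 N) => n Nn.
    have := hN n Nn => dn; have /andP[d0 d1] := harmonic_le1 n.
    have d2 : 0 < delta n ^+ 2 by rewrite exprn_gt0.
    apply: (le_trans (dsoft_pos d2 d0 _)); first lra.
    rewrite mulrC; apply: ler_wpM2l; first by rewrite invr_ge0 ltW.
    nra.
  apply: (@harmonic_cvg _ _ 1 0%N) => n _; rewrite subr0.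
  have /andP[d0 d1] := harmonic_le1 n; have d2 : 0 < delta n ^+ 2 by rewrite exprn_gt0.
  apply: (le_trans (dsoft_neg d2 d0 fp)).
  by rewrite expr2 mulfK ?mul1r // gt_eqF.
under eq_fun do rewrite soft_ramp_partial.
exact: (cvgM c (cvg_cst _)).
Qed.

Variables (D : set (R * R)) (L2 eps : R).
Notation Om := (matrix_part D L2 eps).
Notation mu2 := (@plane_measure R).

(** The convergence to the positive part is uniform, with error at most [2 * delta n]. Hence the
    same sequence realizes the trace on every arc along which the positive part is constant. *)
Lemma ramp_H1 : exists W : H1 Om,
  (forall i p, H1_grad W i p = (0 < f p)%R%:R * partial i f p) /\
  (forall (c : R -> R * R) (t1 t2 g : R), t1 <= t2 -> continuous c ->
    (forall t, t1 <= t <= t2 -> Num.max (f (c t)) 0 = g) -> has_trace c t1 t2 W g).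
Proof.
have [M0 M00 hM0] := continuous_plane_bounded (`|half_width D eps| + `|L2|) (smooth_continuous sf).
have [M1 M10 hM1] := continuous_plane_bounded (`|half_width D eps| + `|L2|) (smooth_continuous (smooth_partial ord0 sf)).
have [M2 M20 hM2] := continuous_plane_bounded (`|half_width D eps| + `|L2|) (smooth_continuous (smooth_partial ord_max sf)).
have cG i p : Om p -> (fun n => partial i (soft_ramp n) p) @ \oo --> (0 < f p)%R%:R * partial i f p.
  by move=> _; exact: soft_ramp_grad_cvg.
have [||W [_ WG dW]] := @H1_limit _ D L2 eps soft_ramp (fun p => Num.max (f p) 0)
  (fun i p => (0 < f p)%R%:R * partial i f p) (M0 + 2 + M1 + M2) soft_ramp_smooth
  (fun p _ => @harmonic_cvg _ _ 2 0%N (fun n _ => soft_ramp_close n p))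
  cG.
- move=> n p /matrix_part_bounded[p1 p2]; have := hM0 p p1 p2; have := soft_ramp_close n p.
  have /andP[d0 d1] := harmonic_le1 n.
  rewrite !ler_norml => /andP[a1 a2] /andP[a3 a4].
  by move: a1 a2; have [m0|m0] := leP (f p) 0; lra.
- move=> n i p /matrix_part_bounded[p1 p2]; rewrite soft_ramp_partial normrM.
  have /andP[d0 d1] := harmonic_le1 n; have d2 : 0 < delta n ^+ 2 by rewrite exprn_gt0.
  have /andP[s0 s1] := dsoft_range (delta n) d2 (f p).
  apply: (@le_trans _ _ `|partial i f p|).
    by rewrite -[leRHS]mul1r ler_wpM2r // ger0_norm.
  have h1 := hM1 p p1 p2; have h2 := hM2 p p1 p2.
  have [->|->] : i = ord0 \/ i = ord_max; last lra; last lra.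
  by case: i => -[|[|//]] hi; [left|right]; apply: val_inj.
exists W; split => [i p|]; first by rewrite WG.
move=> c t1 t2 g t12 cc hg; exists soft_ramp; split => //; first exact: soft_ramp_smooth.
have bd n t : t1 <= t <= t2 -> (soft_ramp n (c t) - g) ^+ 2 <= 4 * delta n.
  move=> ht; have := soft_ramp_close n (c t); rewrite (hg t ht) => h1.
  have /andP[d0 d1] := harmonic_le1 n; have n0 := normr_ge0 (soft_ramp n (c t) - g).
  by rewrite -(real_normK (num_real _)); nra.
apply: (@squeeze_cvge _ _ _ _ (fun=> 0%E) _ (fun n => (4 * (t2 - t1) * delta n)%:E)).
- apply: nearW => n; apply/andP; split; first by apply: integral_ge0 => t _; rewrite lee_fin sqr_ge0.
  apply: (@le_trans _ _ (\int[@lebesgue_measure R]_(t in `[t1, t2]) (4 * delta n)%:E)%E).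
    apply: ge0_le_integral => //.
    + by move=> t _; rewrite lee_fin sqr_ge0.
    + apply/measurable_EFinP; apply: measurable_funTS; apply: continuous_measurable_fun => t.
      have ct : {for t, continuous (fun t => soft_ramp n (c t) - g)}.
        apply: cvgB; last exact: cvg_cst.
        by apply: (@continuous_comp _ _ _ c (soft_ramp n)); [exact: cc|exact: (smooth_continuous (soft_ramp_smooth n))].
      by under eq_fun do rewrite expr2; exact: (cvgM ct ct).
    + by move=> t ht; rewrite lee_fin bd //; move: ht; rewrite /= in_itv.
  by rewrite integral_cst //= lebesgue_measure_segment // -EFinM lee_fin mulrAC.
- exact: cvg_cst.
- apply: cvg_EFin; first exact: nearW.
  have c0 : (fun n => 4 * (t2 - t1) * delta n) @ \oo --> 4 * (t2 - t1) * 0.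
    by apply: cvgM; [exact: cvg_cst|exact: cvg_harmonic].
  by rewrite mulr0 in c0; exact: c0.
Qed.

End Ramp.

Section CoordinatePartials.
Context {R : realType}.
Implicit Types (p : R * R) (i : 'I_2).

Lemma ord2_cases i : i = ord0 \/ i = ord_max.
Proof. by case: i => -[|[|//]] hi; [left|right]; apply: val_inj. Qed.

Lemma smooth_fst : smooth (fun p : R * R => p.1). Proof. by move=> n; exact: Cn_fst. Qed.
Lemma smooth_snd : smooth (fun p : R * R => p.2). Proof. by move=> n; exact: Cn_snd. Qed.
Lemma smooth_cst (c : R) : smooth (fun _ : R * R => c). Proof. by move=> n; exact: Cn_cst. Qed.
Lemma smoothV f : (forall p, f p != 0) -> smooth f -> smooth (fun p : R * R => (f p)^-1).
Proof. by move=> f0 sf n; exact: CnV. Qed.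

Lemma partial_cst i (c : R) p : partial i (fun=> c) p = 0.
Proof. by apply: partialE; exact: is_derive_cst. Qed.

Lemma partial_fst i p : partial i (fun q : R * R => q.1) p = (i == ord0)%:R.
Proof.
apply: partialE; apply/is_derive_lineP; rewrite /line /pcoord.
by have [->|->] := ord2_cases i => /=; [exact: is_derive_id|exact: is_derive_cst].
Qed.

Lemma partial_snd i p : partial i (fun q : R * R => q.2) p = (i == ord_max)%:R.
Proof.
apply: partialE; apply/is_derive_lineP; rewrite /line /pcoord.
by have [->|->] := ord2_cases i => /=; [exact: is_derive_cst|exact: is_derive_id].
Qed.

Lemma partial_snd_fun i (u : R -> R) l p : is_derive p.2 1 u l ->
  partial i (fun q : R * R => u q.2) p = (i == ord_max)%:R * l.
Proof.
move=> du; apply: partialE; apply/is_derive_lineP; rewrite /line /pcoord.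
have [->|->] := ord2_cases i => /=; rewrite ?mul0r ?mul1r //; exact: is_derive_cst.
Qed.

Lemma partialZ i c (F : R * R -> R) p : smooth F -> partial i (fun q : R * R => c * F q) p = c * partial i F p.
Proof.
by move=> sF; rewrite partialM ?partial_cst ?mulr0 ?addr0 //; exact: smooth_cst.
Qed.

End CoordinatePartials.

Definition dprofile {R : realType} (kap K y : R) : R := kap * y / (1 + K * y ^+ 2) ^+ 2.
Definition width {R : realType} (kap K eps y : R) : R := eps / 2 + profile kap K y.
(** Zero on the modified boundary [s * x = b - profile] and one on the side [s * x = L1], because
    [width] is the distance between them. The ramp is its positive part. *)
Definition ramp_arg {R : realType} (b kap K eps s : R) (p : R * R) : R :=
  (s * p.1 - b + profile kap K p.2) / width kap K eps p.2.

Section RampArgument.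
Context {R : realType} (b kap K eps s : R).
Hypothesis kap0 : 0 < kap.
Hypothesis K0 : 0 < K.
Hypothesis eps0 : 0 < eps.
Notation g := (profile kap K).
Notation q := (width kap K eps).
Notation f := (ramp_arg b kap K eps s).
Implicit Types p : R * R.

Let dpos (y : R) : 0 < 1 + K * y ^+ 2.
Proof. by have k0 := K0; have := mulr_ge0 (ltW k0) (sqr_ge0 y); lra. Qed.

Lemma width_gt0 y : 0 < q y.
Proof. have e0 := eps0; have := profile_ge0 kap0 K0 y; rewrite /width; lra. Qed.

Lemma smooth_profile : smooth (fun p : R * R => g p.2).
Proof.
move=> n; apply: CnM; first by apply: CnZ; apply: CnX; exact: Cn_snd.
apply: CnV => [p|]; first by have := dpos p.2; move=> h; rewrite gt_eqF //; lra.
by apply: CnZ; apply: CnD; [exact: Cn_cst|apply: CnZ; apply: CnX; exact: Cn_snd].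
Qed.

Let smooth_sq : smooth (fun p : R * R => p.2 * p.2).
Proof. exact: smoothM smooth_snd smooth_snd. Qed.

Let partial_sq i p : partial i (fun p : R * R => p.2 * p.2) p = (i == ord_max)%:R * (2 * p.2).
Proof. by rewrite partialM ?partial_snd; [ring|exact: smooth_snd|exact: smooth_snd]. Qed.

Lemma partial_profile i p : partial i (fun p => g p.2) p = (i == ord_max)%:R * dprofile kap K p.2.
Proof.
have sd : smooth (fun p : R * R => 2 * (1 + K * (p.2 * p.2))).
  apply: smoothM; first exact: smooth_cst.
  by apply: smoothD; [exact: smooth_cst|apply: smoothM => //; exact: smooth_cst].
have pd : partial i (fun p : R * R => 2 * (1 + K * (p.2 * p.2))) p = (i == ord_max)%:R * (4 * K * p.2).
  rewrite partialZ; last by apply: smoothD; [exact: smooth_cst|apply: smoothM => //; exact: smooth_cst].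
  rewrite partialD; [|exact: smooth_cst|apply: smoothM => //; exact: smooth_cst].
  by rewrite partial_cst partialZ // partial_sq; ring.
(* The derivative is read off from the product rule applied to this polynomial identity, in place of
   a quotient rule; [partial_ramp_arg] proceeds likewise. *)
have e : (fun p : R * R => g p.2 * (2 * (1 + K * (p.2 * p.2)))) = (fun p => kap * (p.2 * p.2)).
  by apply/funext => r; rewrite /profile divfK // gt_eqF // mulr_gt0.
have := partialM i p smooth_profile sd; rewrite e partialZ // partial_sq pd => h.
have d0 := dpos p.2.
have n0 : 2 * (1 + K * (p.2 * p.2)) != 0 by rewrite -expr2 gt_eqF // mulr_gt0.
apply: (mulfI n0); rewrite -[LHS](addrK (g p.2 * ((i == ord_max)%:R * (4 * K * p.2)))).
rewrite [X in X - _]addrC -h /dprofile /profile; field.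
by rewrite -?expr2 gt_eqF.
Qed.

Lemma smooth_width : smooth (fun p => q p.2).
Proof. by apply: smoothD; [exact: smooth_cst|exact: smooth_profile]. Qed.

Lemma smooth_ramp_arg : smooth f.
Proof.
apply: smoothM; first by apply: smoothD; [exact: smooth_affine|exact: smooth_profile].
by apply: smoothV; [move=> p; rewrite gt_eqF // width_gt0|exact: smooth_width].
Qed.

Lemma partial_ramp_arg i p : partial i f p =
  ((i == ord0)%:R * s + (i == ord_max)%:R * (dprofile kap K p.2 * (1 - f p))) / q p.2.
Proof.
have e : (fun p => f p * q p.2) = (fun p => s * p.1 - b + g p.2).
  by apply/funext => r; rewrite /ramp_arg divfK // gt_eqF // width_gt0.
have := partialM i p smooth_ramp_arg smooth_width; rewrite e.
rewrite partialD; [|exact: smooth_affine|exact: smooth_profile].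
rewrite partialB; [|by apply: smoothM; [exact: smooth_cst|exact: smooth_fst]|exact: smooth_cst].
rewrite partialZ; last exact: smooth_fst.
rewrite (partialD i p (smooth_cst (eps / 2)) smooth_profile) !partial_cst partial_fst partial_profile.
have q0 := width_gt0 p.2 => h.
apply: (mulfI (lt0r_neq0 q0)); rewrite [RHS]mulrC divfK ?(lt0r_neq0 q0) //.
have -> : q p.2 * partial i f p = s * (i == ord0)%:R - 0 + (i == ord_max)%:R * dprofile kap K p.2 -
  f p * (0 + (i == ord_max)%:R * dprofile kap K p.2) by rewrite h; ring.
ring.
Qed.

End RampArgument.

Section RampField.
Context {R : realType} (D : set (R * R)) (gamma : R -> R * R) (T L2 kap K eps s : R).
Hypothesis hD : inclusion D.
Hypothesis hgamma : boundary_param D gamma T.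
Notation b := (xmax D).
Notation L1 := (half_width D eps).
Notation Om := (matrix_part D L2 eps).
Notation g := (profile kap K).
Notation q := (width kap K eps).
Notation f := (ramp_arg b kap K eps s).
Hypothesis kap0 : 0 < kap.
Hypothesis K0 : 0 < K.
Hypothesis eps0 : 0 < eps.
Hypothesis L20 : 0 < L2.
Hypothesis hs : s = 1 \/ s = -1.
Hypothesis hK : kap / (2 * K) < b.
Hypothesis support : forall x y, closure D (x, y) -> `|x| <= b - g y.

Lemma ramp_exists : exists W : H1 Om, [/\
  forall p, H1_grad W ord0 p = (0 < f p)%R%:R * (s / q p.2),
  forall p, H1_grad W ord_max p = (0 < f p)%R%:R * (dprofile kap K p.2 * (1 - f p) / q p.2),
  has_trace gamma 0 T W 0, has_trace (fun y => (s * L1, y)) (- L2) L2 W 1 &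
  has_trace (fun y => (- (s * L1), y)) (- L2) L2 W 0].
Proof.
have [W [WG Wtr]] := ramp_H1 (smooth_ramp_arg b s kap0 K0 eps0) D L2 eps.
have sf : s * s = 1 by case: hs => ->; rewrite ?mulrNN mulr1.
have e0 := eps0; have l0 := L20.
have q0 y : 0 < q y := width_gt0 kap0 K0 eps0 y.
exists W; split.
- by move=> p; rewrite WG partial_ramp_arg // mul1r mul0r addr0.
- by move=> p; rewrite WG partial_ramp_arg // mul0r mul1r add0r.
- apply: Wtr; [exact: ltW (boundary_period hgamma)|exact: continuous_curve hgamma|].
  move=> t _; apply/max_idPr; rewrite /ramp_arg ler_pdivrMr // mul0r.
  have [Kt _] := curve_boundary hD hgamma t; have : `|(gamma t).1| <= b - g (gamma t).2 := support Kt.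
  rewrite ler_norml => /andP[k1 k2] /=.
  by case: hs => ->; rewrite ?mul1r ?mulN1r; lra.
- apply: Wtr; [lra|by apply: continuous_pair => y; [exact: cvg_cst|exact: cvg_id]|].
  move=> t _; rewrite (_ : f _ = 1); first by rewrite max_l.
  have qt := q0 t; rewrite /ramp_arg /= mulrA sf mul1r.
  apply: (mulIf (lt0r_neq0 qt)); rewrite divfK ?gt_eqF // mul1r /width /half_width; ring.
(* On the opposite side [s * x] equals [- L1], and the argument is negative because the profile
   stays below [b]. *)
- apply: Wtr; [lra|by apply: continuous_pair => y; [exact: cvg_cst|exact: cvg_id]|].
  move=> t _; apply/max_idPr; rewrite /ramp_arg ler_pdivrMr //= mul0r mulrN mulrA sf mul1r.
  have := profile_le_lim kap0 K0 t; have := profile_ge0 kap0 K0 t; have h := hK; rewrite /half_width; lra.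
Qed.

End RampField.

(** * Divergence-free tensors in the gap *)

Section RealDerivatives.
Context {R : realType}.
Implicit Types (u v : R -> R) (a b c y : R).

Lemma is_derive_mulr u v a b y : is_derive y 1 u a -> is_derive y 1 v b ->
  is_derive y 1 (fun t => u t * v t) (u y * b + v y * a).
Proof. by move=> du dv; exact: (is_deriveM du dv). Qed.

Lemma is_derive_scaler u a c y : is_derive y 1 u a -> is_derive y 1 (fun t => c * u t) (c * a).
Proof. by move=> du; exact: (is_deriveZ c du). Qed.

End RealDerivatives.

Section GapProfile.
Context {R : realType} (kap eps h : R).
Hypothesis kap0 : 0 < kap.
Hypothesis eps0 : 0 < eps.
Hypothesis h0 : 0 < h.
Implicit Types (y t : R) (p : R * R).

Definition cutoff y := 1 - y ^+ 2 / h ^+ 2.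
Definition gapd y := eps + kap * y ^+ 2.

(* [zeta] approximates the x-derivative [1 / width] of the ramp; the cutoff makes it vanish to second
   order at the ends [y = h] and [y = - h] of the gap. *)
Definition zeta y := 2 * (cutoff y * cutoff y) * (gapd y)^-1.
Definition zeta1 y := - (8 / h ^+ 2) * (cutoff y * y) * (gapd y)^-1
  - 4 * kap * (cutoff y * cutoff y * y) * ((gapd y)^-1 * (gapd y)^-1).
Definition zeta2 y := - (8 / h ^+ 2) * (1 - 3 * (y ^+ 2 / h ^+ 2)) * (gapd y)^-1
  + 32 * kap / h ^+ 2 * (cutoff y * y ^+ 2) * ((gapd y)^-1 * (gapd y)^-1)
  - 4 * kap * (cutoff y * cutoff y) * ((gapd y)^-1 * (gapd y)^-1)
  + 16 * kap ^+ 2 * (cutoff y * cutoff y * y ^+ 2) * ((gapd y)^-1 * (gapd y)^-1 * (gapd y)^-1).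

Lemma gapd_gt0 y : 0 < gapd y.
Proof. have e := eps0; have := mulr_ge0 (ltW kap0) (sqr_ge0 y); rewrite /gapd; lra. Qed.

Let hn : h != 0. Proof. by rewrite gt_eqF. Qed.

Let dcut y : is_derive y 1 cutoff (- (2 * y / h ^+ 2)).
Proof.
have d2 := is_deriveZ ((h ^+ 2)^-1) (is_deriveM (is_derive_id y (1 : R)) (is_derive_id y (1 : R))).
have d1 := is_deriveB (is_derive_cst (1 : R) y (1 : R)) d2.
rewrite (_ : cutoff = cst 1 - (h ^+ 2)^-1 \*: (id * id)).
  by apply: (is_derive_eq d1); rewrite /GRing.scale /=; field.
by apply/funext => r; rewrite /cutoff mulrC expr2.
Qed.

Let dgapd y : is_derive y 1 gapd (2 * kap * y).
Proof.
have d2 := is_deriveZ kap (is_deriveM (is_derive_id y (1 : R)) (is_derive_id y (1 : R))).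
have d1 := is_deriveD (is_derive_cst eps y (1 : R)) d2.
rewrite (_ : gapd = cst eps + kap \*: (id * id)); last by apply/funext => r; rewrite /gapd expr2.
by apply: (is_derive_eq d1); rewrite /GRing.scale /=; ring.
Qed.

Let dinv y : is_derive y 1 (fun t => (gapd t)^-1) (- (2 * kap * y * ((gapd y)^-1 * (gapd y)^-1))).
Proof.
have n0 : gapd y != 0 by rewrite gt_eqF // gapd_gt0.
apply: (@DeriveDef _ _ _ _ _ (fun t => (gapd t)^-1)).
  by apply: derivableV => //; case: (dgapd y).
rewrite deriveV //; case: (dgapd y) => _ ->; rewrite /GRing.scale /= -exprVn; ring.
Qed.

Lemma zeta_is_derive y : is_derive y 1 zeta (zeta1 y).
Proof.
have d := is_derive_mulr (is_derive_scaler 2 (is_derive_mulr (dcut y) (dcut y))) (dinv y).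
apply: (is_derive_eq d); rewrite /zeta1.
by have := gt_eqF (gapd_gt0 y) => /negbT dn; set c := cutoff y; field; rewrite dn hn.
Qed.

Lemma zeta1_is_derive y : is_derive y 1 zeta1 (zeta2 y).
Proof.
have d1 := is_derive_mulr (is_derive_scaler (- (8 / h ^+ 2)) (is_derive_mulr (dcut y) (is_derive_id y (1 : R)))) (dinv y).
have d2 := is_derive_mulr (is_derive_scaler (4 * kap) (is_derive_mulr (is_derive_mulr (dcut y) (dcut y)) (is_derive_id y (1 : R))))
  (is_derive_mulr (dinv y) (dinv y)).
apply: (is_derive_eq (is_deriveB d1 d2)); rewrite /= /zeta2 /cutoff.
by have := gt_eqF (gapd_gt0 y) => /negbT dn; field; rewrite dn hn.
Qed.

Lemma smooth_cutoff : smooth (fun p : R * R => cutoff p.2).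
Proof.
apply: smoothB; first exact: smooth_cst.
by apply: smoothM; [move=> n; apply: CnX; exact: Cn_snd|exact: smooth_cst].
Qed.

Lemma smooth_gapd_inv : smooth (fun p : R * R => (gapd p.2)^-1).
Proof.
apply: smoothV => [p|]; first by rewrite gt_eqF // gapd_gt0.
apply: smoothD; first exact: smooth_cst.
by apply: smoothM; [exact: smooth_cst|move=> n; apply: CnX; exact: Cn_snd].
Qed.

Let sc := smooth_cutoff.
Let si := smooth_gapd_inv.

Lemma smooth_zeta : smooth (fun p : R * R => zeta p.2).
Proof.
apply: smoothM => //; apply: smoothM; first exact: smooth_cst.
exact: smoothM.
Qed.

Lemma smooth_zeta1 : smooth (fun p : R * R => zeta1 p.2).
Proof.
have s0 (c : R) := @smooth_cst R c; have sy := @smooth_snd R.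
by apply: smoothB; do ![exact: s0|exact: sy|exact: sc|exact: si|apply: smoothM].
Qed.

Lemma smooth_zeta2 : smooth (fun p : R * R => zeta2 p.2).
Proof.
have s0 (c : R) := @smooth_cst R c; have sy : smooth (fun p : R * R => p.2 ^+ 2).
  by move=> n; apply: CnX; exact: Cn_snd.
by do ![exact: s0|exact: sy|exact: sc|exact: si|apply: smoothB|apply: smoothD|apply: smoothM].
Qed.

Lemma cutoff_end : cutoff h = 0 /\ cutoff (- h) = 0.
Proof. by rewrite /cutoff sqrrN divff ?subrr // expf_neq0. Qed.

Lemma zeta_end : zeta h = 0 /\ zeta (- h) = 0.
Proof. by have [c1 c2] := cutoff_end; rewrite /zeta c1 c2 !(mul0r, mulr0). Qed.

Lemma zeta1_end : zeta1 h = 0 /\ zeta1 (- h) = 0.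
Proof. by have [c1 c2] := cutoff_end; rewrite /zeta1 c1 c2 !(mul0r, mulr0, subr0). Qed.

Section Bounds.
Variable y : R.
Hypothesis yh : `|y| <= h.
Hypothesis eps1 : eps <= 1.
Notation d := (gapd y).

Let y2h : y ^+ 2 <= h ^+ 2.
Proof. by rewrite -[y ^+ 2](real_normK (num_real _)) lerXn2r ?nnegrE // ltW. Qed.

Lemma cutoff_range : 0 <= cutoff y <= 1.
Proof.
have h2 : 0 < h ^+ 2 by rewrite exprn_gt0.
have : y ^+ 2 / h ^+ 2 <= 1 by rewrite ler_pdivrMr ?mul1r.
have : 0 <= y ^+ 2 / h ^+ 2 by rewrite divr_ge0 ?sqr_ge0.
rewrite /cutoff; lra.
Qed.

Lemma sq_le_gapd : kap * y ^+ 2 <= d.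
Proof. by have e := eps0; rewrite /gapd; lra. Qed.

Lemma gapd_le : d <= 1 + kap * h ^+ 2.
Proof. by have e := eps1; rewrite /gapd lerD // ler_pM2l. Qed.

Lemma zeta_range : 0 <= zeta y <= 2 / d.
Proof.
have /andP[c0 c1] := cutoff_range; have d0 := gapd_gt0 y.
have i0 : 0 <= d^-1 by rewrite invr_ge0 ltW.
rewrite /zeta ler_wpM2r // ?mulr_ge0 //=; nra.
Qed.

(** Where the cutoff departs from 1 it does so by [y ^+ 2 / h ^+ 2], and [y ^+ 2 / d <= 1 / kap]. *)
Lemma zeta_defect : `|2 / d - zeta y| <= 4 / (kap * h ^+ 2).
Proof.
have /andP[c0 c1] := cutoff_range; have d0 := gapd_gt0 y; have k0 := kap0.
have h2 : 0 < h ^+ 2 by rewrite exprn_gt0.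
have kh : 0 < kap * h ^+ 2 by rewrite mulr_gt0.
rewrite (_ : _ - _ = (2 * (1 - cutoff y * cutoff y)) / d); last by rewrite /zeta; ring.
have c2 : 0 <= 1 - cutoff y * cutoff y by nra.
rewrite ger0_norm; last by rewrite divr_ge0 ?mulr_ge0 // ltW.
rewrite ler_pdivrMr // mulrAC ler_pdivlMr //.
have : (1 - cutoff y) * (kap * h ^+ 2) = kap * y ^+ 2 by rewrite /cutoff; field.
have := sq_le_gapd; nra.
Qed.

Let c1 := 8 * (1 + kap * h ^+ 2) / h ^+ 2 + 4 * kap.
(** The term with a single factor [d^-1] is raised to two factors by [d <= 1 + kap * h ^+ 2], where
    [eps <= 1] enters. *)
Lemma zeta1_bound : `|zeta1 y| <= c1 * (`|y| * (d^-1 * d^-1)).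
Proof.
have /andP[u0 u1] := cutoff_range; have d0 := gapd_gt0 y; have k0 := kap0.
have h2 : 0 < h ^+ 2 by rewrite exprn_gt0.
have i0 : 0 < d^-1 by rewrite invr_gt0.
have id : d^-1 * d = 1 by rewrite mulVf // gt_eqF.
have dle := gapd_le; have y0 := normr_ge0 y.
have H0 : 0 < 8 / h ^+ 2 by rewrite divr_gt0.
rewrite [leRHS]mulrDl; apply: (le_trans (ler_normB _ _)); apply: lerD.
  rewrite !normrM normrN (gtr0_norm H0) (ger0_norm u0) (gtr0_norm i0).
  have -> : 8 * (1 + kap * h ^+ 2) / h ^+ 2 * (`|y| * (d^-1 * d^-1)) = 8 / h ^+ 2 * (`|y| * d^-1 * (d^-1 * (1 + kap * h ^+ 2))).
    by field; rewrite gt_eqF // gt_eqF.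
  rewrite (_ : 8 / h ^+ 2 * (cutoff y * `|y|) * d^-1 = 8 / h ^+ 2 * (cutoff y * (`|y| * d^-1))); last by ring.
  apply: ler_wpM2l; first exact: ltW.
  have : 1 <= d^-1 * (1 + kap * h ^+ 2) by rewrite -{1}id ler_pM2l.
  move=> e1; have : `|y| * d^-1 <= `|y| * d^-1 * (d^-1 * (1 + kap * h ^+ 2)).
    by rewrite -[leLHS]mulr1 ler_wpM2l // mulr_ge0 // ltW.
  have : cutoff y * (`|y| * d^-1) <= `|y| * d^-1 by rewrite -[leRHS]mul1r ler_wpM2r // mulr_ge0 // ltW.
  by lra.
rewrite !normrM (gtr0_norm k0) (ger0_norm u0) (gtr0_norm i0) ger0_norm //.
rewrite (_ : 4 * kap * (cutoff y * cutoff y * `|y|) * (d^-1 * d^-1) = 4 * kap * (cutoff y * cutoff y * (`|y| * (d^-1 * d^-1)))); last by ring.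
rewrite ler_pM2l ?mulr_gt0 //.
have p0 : 0 <= `|y| * (d^-1 * d^-1) by rewrite !mulr_ge0 // ltW.
have c2 : cutoff y * cutoff y <= 1 by nra.
by rewrite -[leRHS]mul1r; apply: ler_wpM2r.
Qed.

Let c2 := 16 * (1 + kap * h ^+ 2) / h ^+ 2 + 52 * kap.
(** In the last term of [zeta2], [kap * y ^+ 2 <= d] cancels one of the three factors [d^-1]; the
    single factor of the first term is doubled as in [zeta1_bound]. *)
Lemma zeta2_bound : `|zeta2 y| <= c2 * (d^-1 * d^-1).
Proof.
have /andP[u0 u1] := cutoff_range; have d0 := gapd_gt0 y; have k0 := kap0.
have h2 : 0 < h ^+ 2 by rewrite exprn_gt0.
have i0 : 0 < d^-1 by rewrite invr_gt0.
have id : d^-1 * d = 1 by rewrite mulVf // gt_eqF.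
have dle := gapd_le.
have H0 : 0 < 8 / h ^+ 2 by rewrite divr_gt0.
have z0 : 0 <= y ^+ 2 / h ^+ 2 by rewrite divr_ge0 ?sqr_ge0.
have z1 : y ^+ 2 / h ^+ 2 = 1 - cutoff y by rewrite /cutoff; ring.
have kd : kap * y ^+ 2 * d^-1 <= 1 by rewrite -id mulrC ler_pM2l // sq_le_gapd.
have kd0 : 0 <= kap * y ^+ 2 * d^-1 by apply: mulr_ge0; [apply: mulr_ge0; [exact: ltW|exact: sqr_ge0]|exact: ltW].
set w := kap * y ^+ 2 * d^-1 in kd kd0.
have e1 : 1 <= d^-1 * (1 + kap * h ^+ 2) by rewrite -{1}id ler_pM2l.
set v := d^-1 * (1 + kap * h ^+ 2) in e1.
set c := cutoff y in u0 u1 z1 *; set z := y ^+ 2 / h ^+ 2 in z0 z1 *.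
have -> : zeta2 y = - (8 / h ^+ 2) * (1 - 3 * z) * d^-1 + kap * ((32 * (c * z) - 4 * (c * c) + 16 * (c * c * w)) * (d^-1 * d^-1)).
  by rewrite /zeta2 -/c -/z /w /z; field; rewrite gt_eqF // gt_eqF.
have -> : c2 * (d^-1 * d^-1) = 8 / h ^+ 2 * (2 * v) * d^-1 + kap * (52 * (d^-1 * d^-1)).
  by rewrite /c2 /v; field; rewrite gt_eqF // gt_eqF.
apply: (le_trans (ler_normD _ _)); apply: lerD.
  rewrite !normrM normrN (gtr0_norm H0) (gtr0_norm i0); apply: ler_wpM2r; first exact: ltW.
  apply: ler_wpM2l; first exact: ltW.
  by rewrite ler_norml; lra.
rewrite normrM (gtr0_norm k0) ler_pM2l // normrM [X in _ * X]gtr0_norm ?mulr_gt0 //.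
apply: ler_wpM2r; first by rewrite mulr_ge0 // ltW.
have cz : 0 <= c * z <= 1 by nra.
have cc : 0 <= c * c <= 1 by nra.
have cw : 0 <= c * c * w <= 1 by nra.
rewrite ler_norml; lra.
Qed.

End Bounds.

End GapProfile.

Section GapDivergenceFree.
Context {R : realType} (D : set (R * R)) (gamma : R -> R * R) (T L2 kap K C h : R).

(** No field mentions [eps], so every constant extracted from this record is uniform in [eps]. *)
Record gap_data : Prop := {
  gap_inclusion : inclusion D;
  gap_param : boundary_param D gamma T;
  gap_xmax : closure D (xmax D, 0);
  gap_kap : 0 < kap;
  gap_K : 0 < K;
  gap_C : 0 < C;
  gap_height : good_height D h;
  gap_L2 : h < L2;
  gap_profile_lt : kap / (2 * K) < xmax D;
  gap_support : forall x y, closure D (x, y) -> `|x| <= xmax D - profile kap K y;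
  gap_defect : forall y, `|y| <= h -> xmax D - profile kap K y - horiz D y <= C * y ^+ 4;
  gap_bound : forall s, s = 1 \/ s = -1 -> gap_trace_bound D gamma T s h
}.

Hypothesis H : gap_data.
Variables eps s : R.
Hypothesis eps0 : 0 < eps.
Hypothesis hs : s = 1 \/ s = -1.
Notation mu2 := (@plane_measure R).
Notation RR := (measurableTypeR R * measurableTypeR R)%type.
Notation Om := (matrix_part D L2 eps).
Notation L1 := (half_width D eps).
Notation Q := (gap D s h L1).
Notation Z := (zeta kap eps h).
Notation Z1 := (zeta1 kap eps h).
Notation Z2 := (zeta2 kap eps h).
Notation f := (ramp_arg (xmax D) kap K eps s).

Let kap0 := gap_kap H.
Let h0 : 0 < h := (gap_height H).1.

(** Signed, and not multiplied by [s], so that its x-derivative is 1 for both sides. *)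
Definition side_dist (p : R * R) : R := p.1 - s * L1.

Lemma smooth_side_dist : smooth side_dist.
Proof. by apply: smoothB; [exact: smooth_fst|exact: smooth_cst]. Qed.

Lemma partial_side_dist i p : partial i side_dist p = (i == ord0)%:R.
Proof.
rewrite partialB; [|exact: smooth_fst|exact: smooth_cst].
by rewrite partial_fst partial_cst subr0.
Qed.

Let pZ i p : partial i (fun q : R * R => Z q.2) p = (i == ord_max)%:R * Z1 p.2.
Proof. by apply: partial_snd_fun; exact: zeta_is_derive. Qed.

Let pZ1 i p : partial i (fun q : R * R => Z1 q.2) p = (i == ord_max)%:R * Z2 p.2.
Proof. by apply: partial_snd_fun; exact: zeta1_is_derive. Qed.

Let pZ2 p : partial ord0 (fun q : R * R => Z2 q.2) p = 0.
Proof.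
apply: partialE; apply/is_derive_lineP; rewrite /line /pcoord /=; exact: is_derive_cst.
Qed.

(* The three null fields [(zeta, 0)], [(- zeta' X, zeta)] and [(zeta'' X^2 / 2, - zeta' X)], with
   [X = side_dist], are the building blocks of the divergence-free stress. *)
Section Identities.
Variable u : H1 Om.
Hypothesis trace_incl : has_trace gamma 0 T u 0.
Hypothesis trace_side : has_trace (fun y => (s * L1, y)) (- L2) L2 u 0.

Let green m1 m2 sm1 sm2 dv e1 e2 := @gap_green _ _ _ _ (gap_inclusion H) (gap_param H) L2 eps eps0 (gap_xmax H) s h hs
  (gap_height H) (gap_L2 H) (gap_bound H hs) m1 m2 sm1 sm2 dv e1 e2 u trace_incl trace_side.

Let sZ := smooth_zeta h kap0 eps0.
Let sZ1 := smooth_zeta1 h kap0 eps0.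
Let sZ2 := smooth_zeta2 h kap0 eps0.
Let sX := smooth_side_dist.

Lemma gap_identity0 : \int[mu2]_(p in Q) (Z p.2 * H1_grad u ord0 p) = 0.
Proof.
rewrite -(green (m1 := fun p => Z p.2) (m2 := fun=> 0)) //; last 2 first.
- exact: smooth_cst.
- by move=> p; rewrite pZ partial_cst mul0r addr0.
by apply: eq_Rintegral => p _; rewrite mul0r addr0.
Qed.

Lemma gap_identity1 : \int[mu2]_(p in Q) (Z p.2 * H1_grad u ord_max p - Z1 p.2 * side_dist p * H1_grad u ord0 p) = 0.
Proof.
have [z1 z2] := zeta_end kap eps h0.
have sm : smooth (fun p => Z1 p.2 * side_dist p) by exact: smoothM.
rewrite -(green (m1 := fun p => -1 * (Z1 p.2 * side_dist p)) (m2 := fun p => Z p.2)) //; last 2 first.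
- by apply: smoothM => //; exact: smooth_cst.
- move=> p; rewrite partialZ // partialM // pZ pZ1 partial_side_dist /=; ring.
by apply: eq_Rintegral => p _; ring.
Qed.

Lemma gap_identity2 : \int[mu2]_(p in Q)
  (Z2 p.2 * side_dist p ^+ 2 / 2 * H1_grad u ord0 p - Z1 p.2 * side_dist p * H1_grad u ord_max p) = 0.
Proof.
have [z1 z2] := zeta1_end kap eps h0.
have sm : smooth (fun p => Z1 p.2 * side_dist p) by exact: smoothM.
have sXX : smooth (fun p => side_dist p * side_dist p) by exact: smoothM.
have sm2 : smooth (fun p => Z2 p.2 * (side_dist p * side_dist p)) by exact: smoothM.
rewrite -(green (m1 := fun p => 2^-1 * (Z2 p.2 * (side_dist p * side_dist p)))
  (m2 := fun p => -1 * (Z1 p.2 * side_dist p))).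
- by apply: eq_Rintegral => p _; rewrite expr2; ring.
- by apply: smoothM => //; exact: smooth_cst.
- by apply: smoothM => //; exact: smooth_cst.
- move=> p; rewrite partialZ // partialZ // [partial ord_max _ _]partialM // pZ1 partial_side_dist.
  by rewrite partialM // partialM // partial_side_dist pZ2 /=; field.
- by move=> x; rewrite z1 mul0r mulr0.
- by move=> x; rewrite z2 mul0r mulr0.
Qed.

End Identities.

Definition ramp_grad0 (p : R * R) : R := (0 < f p)%R%:R * (s / width kap K eps p.2).
Definition ramp_grad1 (p : R * R) : R := (0 < f p)%R%:R * (dprofile kap K p.2 * (1 - f p) / width kap K eps p.2).
(** [resid0] is what remains of the x-derivative of the ramp after [s * zeta] is removed. [resid2]
    and [resid3] are the entries that the divergence-free tensors bring in and that no part of the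
    ramp compensates. *)
Definition resid0 (p : R * R) : R := ramp_grad0 p - s * (\1_Q p * Z p.2).
Definition resid2 (p : R * R) : R := \1_Q p * (Z1 p.2 * side_dist p).
Definition resid3 (p : R * R) : R := \1_Q p * (Z2 p.2 * side_dist p ^+ 2).

Lemma Rintegral_indic d (A : measurableType d) (m : {measure set A -> \bar R}) (S S' : set A) (F : A -> R) :
  S `<=` S' -> \int[m]_(p in S') (\1_S p * F p) = \int[m]_(p in S) F p.
Proof.
move=> SS; rewrite /Rintegral; congr fine; rewrite integral_mkcond [RHS]integral_mkcond.
apply: eq_integral => p _; rewrite !patchE indicE; case: ifPn => [/set_mem pS'|/negP pS'].
  by case: ifP => _; rewrite ?mul1r ?mul0r.
by rewrite memNset // => /SS p'; apply: pS'; rewrite inE.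
Qed.

End GapDivergenceFree.

(** * Uniform bounds for the residual stress *)

Section StripBound.
Context {R : realType}.
Notation leb := (@lebesgue_measure R).
Notation mu2 := (@plane_measure R).
Notation RR := (measurableTypeR R * measurableTypeR R)%type.

(** At height [y] the section has length at most [w y] and the integrand is at most [B y]. In the
    gap [B y] may blow up as [eps] tends to zero while the product with the width stays bounded. For
    [s = -1] the section is reflected. *)
Lemma strip_bound (s : R) (S : set RR) (F : RR -> R) (lo w B : R -> R) (c d M : R) :
  s = 1 \/ s = -1 -> measurable S -> measurable_fun S F -> c <= d ->
  (forall p, S p -> [/\ c <= p.2 <= d, 0 <= F p <= B p.2 & lo p.2 <= s * p.1 <= lo p.2 + w p.2]) ->
  (forall y, c <= y <= d -> [/\ 0 <= w y, 0 <= B y & w y * B y <= M]) ->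
  (\int[mu2]_(p in S) (F p)%:E <= (M * (d - c))%:E)%E.
Proof.
move=> hs mS mF cd hS hw; apply: plane_section_le => //.
- by move=> p /hS[_ /andP[]].
- by move=> p /hS[].
move=> y ycd; have [w0 B0 wB] := hw y ycd.
pose a := if s == 1 then lo y else - (lo y + w y).
apply: (@le_trans _ _ (\int[leb]_(x in `[a, (a + w y)%R]) (B y)%:E)%E); last first.
  rewrite integral_cst //= lebesgue_measure_segment ?lerDl // -EFinM lee_fin.
  by rewrite addrAC subrr add0r mulrC.
rewrite [leRHS]integral_mkcond; apply: ge0_le_integral => //.
- by move=> x _; rewrite lee_fin patchE; case: ifPn => // /set_mem /hS[_ /andP[]].
- apply/measurable_EFinP.
  apply: (@measurableT_comp _ _ _ _ _ _ (F \_ S) _ (fun x => (x, y))).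
    exact/(measurable_restrictT F mS).
  exact: pair2_measurable.
- by apply/(measurable_restrictT (fun=> (B y)%:E)) => //; exact: measurable_itv.
move=> x _; rewrite !patchE; case: ifPn => [/set_mem Sx|_]; last first.
  by case: ifPn => //; rewrite lee_fin.
have [_ /andP[_ FB] /andP[x1 x2]] := hS _ Sx.
rewrite mem_set ?lee_fin //= in_itv /= /a.
case: hs x1 x2 => -> /= x1 x2; first by rewrite eqxx; apply/andP; split; lra.
have -> : (-1 == 1 :> R) = false by apply/eqP => h; have := @ltr01 R; lra.
by apply/andP; split; lra.
Qed.

End StripBound.

Section ResidualBounds.
Context {R : realType} (D : set (R * R)) (gamma : R -> R * R) (T L2 kap K C h : R).
Hypothesis H : gap_data D gamma T L2 kap K C h.
Variables eps s : R.
Hypothesis eps0 : 0 < eps.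
Hypothesis eps1 : eps <= 1.
Hypothesis hs : s = 1 \/ s = -1.
Notation mu2 := (@plane_measure R).
Notation RR := (measurableTypeR R * measurableTypeR R)%type.
Notation Om := (matrix_part D L2 eps).
Notation b := (xmax D).
Notation L1 := (half_width D eps).
Notation Q := (gap D s h L1).
Notation g := (profile kap K).
Notation q := (width kap K eps).
Notation d := (gapd kap eps).
Notation f := (ramp_arg b kap K eps s).
Notation X := (horiz D).

Let hD := gap_inclusion H.
Let kap0 : 0 < kap := gap_kap H.
Let K0 : 0 < K := gap_K H.
Let C0 : 0 < C := gap_C H.
Let h0 : 0 < h := (gap_height H).1.
Let hL2 : h < L2 := gap_L2 H.
Let q0 y : 0 < q y := width_gt0 kap0 K0 eps0 y.
Let d0 y : 0 < d y := gapd_gt0 kap0 eps0 y.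
Let mO := @matrix_part_measurable _ D L2 eps.
Let mQ := @gap_measurable _ D s h L1.
Let QO : Q `<=` Om := gap_sub eps0 hs (gap_height H) hL2.

Lemma ramp_pos p : (0 < f p) = (b - g p.2 < s * p.1).
Proof.
rewrite /ramp_arg pmulr_lgt0 ?invr_gt0 //; apply/idP/idP; lra.
Qed.

Lemma matrix_part_side p : Om p -> s * p.1 < L1.
Proof.
move=> [[/andP[h1 h2] _] _]; case: hs => ->; rewrite ?mul1r ?mulN1r; lra.
Qed.

Lemma ramp_le1 p : Om p -> f p <= 1.
Proof.
move=> /matrix_part_side; rewrite /ramp_arg ler_pdivrMr // mul1r /width /half_width; lra.
Qed.

Lemma matrix_part_vert p : Om p -> - L2 <= p.2 <= L2.
Proof. by move=> [[_ /andP[h1 h2]] _]; apply/andP; split; exact: ltW. Qed.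

(** The difference [d - 2 * q] is twice the defect [K * y ^+ 2 * g], and [kap * y ^+ 2 <= d],
    [g <= q] cancel the denominators. *)
Lemma width_gapd y : `|1 / q y - 2 / d y| <= 2 * K / kap.
Proof.
have k0 := kap0; have k1 := K0; have e := profile_defect kap K0 y; have g0 := profile_ge0 kap0 K0 y.
have qq := q0 y; have dd := d0 y; have kd := sq_le_gapd kap eps0 y.
have qg : g y <= q y by rewrite /width; have := eps0; lra.
have dE : d y - 2 * q y = 2 * (K * y ^+ 2 * g y) by rewrite -e /gapd /width; field.
rewrite (_ : _ - _ = (d y - 2 * q y) / (q y * d y)); last by field; rewrite !gt_eqF.
have y0 := sqr_ge0 y.
have n0 : 0 <= 2 * (K * y ^+ 2 * g y).
  by apply: mulr_ge0 => //; apply: mulr_ge0 => //; apply: mulr_ge0 => //; exact: ltW.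
rewrite dE ger0_norm; last by rewrite divr_ge0 // mulr_ge0 // ltW.
rewrite ler_pdivrMr ?mulr_gt0 // [leRHS]mulrAC ler_pdivlMr //.
have : y ^+ 2 * kap * g y <= d y * q y by apply: ler_pM => //; rewrite 1?mulrC //; apply: mulr_ge0 => //; exact: ltW.
nra.
Qed.

(** The square of the derivative equals [2 * kap * g / (1 + K * y ^+ 2) ^+ 3]. *)
Lemma dprofile_sq y : dprofile kap K y ^+ 2 <= 2 * kap * q y.
Proof.
have k0 := kap0; have k1 := K0; have qg : g y <= q y by rewrite /width; have := eps0; lra.
have y0 := sqr_ge0 y; have g0 := profile_ge0 kap0 K0 y.
set u := 1 + K * y ^+ 2; have u1 : 1 <= u by rewrite /u lerDl mulr_ge0 // ltW.
apply: (@le_trans _ _ (2 * kap * g y)); last by rewrite ler_pM2l // mulr_gt0.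
rewrite (_ : dprofile kap K y ^+ 2 = 2 * kap * g y / u ^+ 3); last first.
  by rewrite /dprofile /profile -/u; field; rewrite gt_eqF //; lra.
rewrite ler_pdivrMr; last by rewrite exprn_gt0 //; lra.
by rewrite -[leLHS]mulr1 ler_wpM2l ?exprn_ege1 // mulr_ge0 // mulr_ge0 // ltW.
Qed.

Lemma gap_width y : `|y| <= h -> L1 - X y <= (1 / 2 + C * h ^+ 2 / kap) * d y.
Proof.
move=> yh; have df := gap_defect H yh; have gl := profile_le kap0 K0 y; have kd := sq_le_gapd kap eps0 y.
have y2 : y ^+ 2 <= h ^+ 2 by rewrite -[y ^+ 2](real_normK (num_real _)) lerXn2r ?nnegrE // ltW.
have y4 : C * y ^+ 4 <= C * h ^+ 2 / kap * d y.
  rewrite mulrAC ler_pdivlMr // (_ : C * y ^+ 4 * kap = C * (y ^+ 2 * (kap * y ^+ 2))); last by ring.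
  rewrite -(mulrA C) ler_pM2l //.
  by apply: ler_pM => //; [exact: sqr_ge0|apply: mulr_ge0; [exact: ltW|exact: sqr_ge0]].
rewrite mulrDl /=; apply: (@le_trans _ _ (1 / 2 * d y + C * y ^+ 4)); last by rewrite lerD2l.
rewrite /half_width /gapd in gl *; lra.
Qed.

Lemma side_dist_bound p : Q p -> `|side_dist D eps s p| <= (1 / 2 + C * h ^+ 2 / kap) * d p.2.
Proof.
case: p => x y /(gapP hD _ hs (gap_height H))[yh Xx xL].
have -> : `|side_dist D eps s (x, y)| = L1 - s * x.
  rewrite /side_dist /=; case: hs Xx xL => -> ; rewrite ?mul1r ?mulN1r => Xx xL.
    by rewrite distrC ger0_norm // subr_ge0 ltW.
  by rewrite ger0_norm; lra.
by apply: le_trans (gap_width (ltW yh)); rewrite lerD2l lerN2 ltW.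
Qed.

Lemma ramp_grad_sqint : sqint mu2 Om (ramp_grad0 D kap K eps s) /\ sqint mu2 Om (ramp_grad1 D kap K eps s).
Proof.
have L20 : 0 < L2 := lt_trans h0 hL2.
have [W [W0 W1 _ _ _]] := ramp_exists hD (gap_param H) kap0 K0 eps0 L20 hs (gap_profile_lt H) (gap_support H).
split; [apply: (sqint_ext mO _ (H1_grad_sqint W ord0))|apply: (sqint_ext mO _ (H1_grad_sqint W ord_max))] => p _.
  by rewrite W0.
by rewrite W1.
Qed.

Let mIQ : @measurable_fun _ _ RR _ Om (\1_Q : RR -> R).
Proof. by apply: measurable_funTS; exact: measurable_indic. Qed.

Lemma indic_sqint F : smooth F -> sqint mu2 Om (fun p => \1_Q p * F p).
Proof.
move=> sF; have [M M0 hM] := continuous_plane_bounded (`|L1| + `|L2|) (smooth_continuous sF).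
apply: (@sqint_bounded _ _ _ _ _ mO _ M).
- exact: matrix_part_lty.
- apply: measurable_funM => //; exact: continuous_plane_measurable mO (smooth_continuous sF).
- move=> p /matrix_part_bounded[p1 p2]; rewrite normrM indicE; have := hM p p1 p2.
  by case: (p \in Q); rewrite ?normr1 ?mul1r // normr0 mul0r.
Qed.

Lemma resid_sqint : [/\ sqint mu2 Om (resid0 D kap K h eps s), sqint mu2 Om (resid2 D kap h eps s) &
  sqint mu2 Om (resid3 D kap h eps s)].
Proof.
have [s0 s1] := ramp_grad_sqint; have sX := smooth_side_dist D eps s.
split.
- apply: sqintB => //; apply: sqintZ => //; apply: indic_sqint; exact: smooth_zeta.
- by apply: indic_sqint; apply: smoothM => //; exact: smooth_zeta1.
- apply: indic_sqint; apply: smoothM; first exact: smooth_zeta2.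
  by move=> n; apply: CnX; exact: sX.
Qed.

Definition sq_bounded (F : R * R -> R) (M : R) := sqint mu2 Om F /\ \int[mu2]_(p in Om) F p ^+ 2 <= M.

(** [E] is the part where the bound depends on the height. The rest costs at most [M0] times the
    area of the cell, whose sides are at most [2 * b + 1], as [eps <= 1], and [2 * L2]. *)
Lemma sq_bounded_cover (F : R * R -> R) (E : set RR) (lo w B : R -> R) (c e M0 M : R) :
  sqint mu2 Om F -> measurable E -> E `<=` Om -> 0 <= M0 -> c <= e ->
  (forall p, Om p -> ~ E p -> F p ^+ 2 <= M0) ->
  (forall p, E p -> [/\ c <= p.2 <= e, F p ^+ 2 <= B p.2 & lo p.2 <= s * p.1 <= lo p.2 + w p.2]) ->
  (forall y, c <= y <= e -> [/\ 0 <= w y, 0 <= B y & w y * B y <= M]) ->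
  sq_bounded F (M * (e - c) + (2 * b + 1) * M0 * (2 * L2)).
Proof.
move=> sF mE EO M00 ce hO hE hB; split => //; have [mF iF] := sF.
rewrite -lee_fin integ_EFin // -{1}(setDUK EO).
have mOE : measurable (Om `\` E : set RR) by exact: measurableD.
have mF2 : @measurable_fun _ _ RR _ Om (fun p => F p ^+ 2) by exact: measurable_funX.
rewrite ge0_integral_setU //; last 3 first.
- by rewrite setDUK //; exact/measurable_EFinP.
- by move=> p _; rewrite lee_fin sqr_ge0.
- by apply/disj_setPS => p [Ep [_ nE]].
have bp : 0 < b := xmax_gt0 hD (gap_xmax H).
have L2p : 0 < L2 := lt_trans h0 hL2.
rewrite EFinD; apply: leeD.
  apply: (@strip_bound _ s E (fun p => F p ^+ 2) lo w B c e M hs mE _ ce _ hB) => [|p /hE[p1 p2 p3]]; last by split => //; rewrite sqr_ge0 p2.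
  exact: measurable_funS mF2.
rewrite (_ : 2 * L2 = L2 - (- L2)); last by ring.
apply: (@strip_bound _ s (Om `\` E) (fun p => F p ^+ 2) (fun=> - L1) (fun=> 2 * b + 1) (fun=> M0)) => //.
- exact: measurable_funS mF2.
- lra.
- move=> p [Op nE]; split; [exact: matrix_part_vert|by rewrite sqr_ge0 hO|].
  have e1 := eps1; case: Op => -[/andP[h1 h2] _] _; rewrite /half_width in h1 h2 *.
  by case: hs => ->; rewrite ?mul1r ?mulN1r; apply/andP; split; lra.
- by move=> y _; split => //; lra.
Qed.

(** Bounded pointwise: [zeta2] is of order [d^-1 * d^-1] and the squared distance to the side of
    order [d ^+ 2]. The exceptional set is therefore empty. *)
Lemma resid3_bounded : sq_bounded (resid3 D kap h eps s)
  ((2 * b + 1) * ((16 * (1 + kap * h ^+ 2) / h ^+ 2 + 52 * kap) * (1 / 2 + C * h ^+ 2 / kap) ^+ 2) ^+ 2 * (2 * L2)).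
Proof.
have [_ _ s3] := resid_sqint.
set M0 := (_ * _ ^+ 2) ^+ 2.
have -> : (2 * b + 1) * M0 * (2 * L2) = 0 * (1 - 0) + (2 * b + 1) * M0 * (2 * L2) by rewrite mul0r add0r.
apply: (@sq_bounded_cover _ set0 (fun=> 0) (fun=> 0) (fun=> 0)) => //; first exact: sqr_ge0.
  move=> p Op _; rewrite /resid3 indicE; case: (boolP (p \in Q)) => [/set_mem Qp|_]; last first.
    by rewrite mul0r expr0n /=; exact: sqr_ge0.
  rewrite mul1r -(real_normK (num_real _)); apply: lerXn2r; rewrite ?nnegrE //.
    rewrite mulr_ge0 ?sqr_ge0 // addr_ge0 // ?mulr_ge0 // ?invr_ge0 ?sqr_ge0 ?addr_ge0 // ?mulr_ge0 ?sqr_ge0 // ltW //.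
  have p2h : `|p.2| <= h by case: Qp => -[/= /ltW].
  have z2 := zeta2_bound kap0 eps0 h0 p2h eps1; have x2 := side_dist_bound Qp.
  rewrite normrM normrX.
  set A := _ + 52 * kap in z2 *; set U := 1 / 2 + _ in x2 *.
  have -> : A * U ^+ 2 = A * ((d p.2)^-1 * (d p.2)^-1) * (U * d p.2) ^+ 2 by field; rewrite gt_eqF.
  apply: ler_pM => //; apply: lerXn2r => //; rewrite nnegrE //; exact: le_trans (normr_ge0 _) x2.
Qed.

Let U : R := 1 / 2 + C * h ^+ 2 / kap.
Let U0 : 0 < U.
Proof. by rewrite /U ltr_wpDr ?divr_gt0 // divr_ge0 ?(ltW kap0) // mulr_ge0 ?sqr_ge0 // ltW. Qed.

(** The square is of order [y ^+ 2 / d ^+ 2] and the width of order [d]; their product is controlled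
    by [y ^+ 2 / d <= 1 / kap]. *)
Lemma resid2_bounded (A := 8 * (1 + kap * h ^+ 2) / h ^+ 2 + 4 * kap) :
  sq_bounded (resid2 D kap h eps s) (U * (A * U) ^+ 2 / kap * (h - - h) + (2 * b + 1) * 0 * (2 * L2)).
Proof.
have [_ s2 _] := resid_sqint.
apply: (@sq_bounded_cover _ Q (fun y => X y) (fun y => U * d y) (fun y => (A * U) ^+ 2 * (y ^+ 2 / (d y * d y)))) => //.
- by have := h0; lra.
- by move=> p Op nQ; rewrite /resid2 indicE memNset // mul0r expr0n.
- case=> x y Qp; have [yh Xx xL] := (gapP hD _ hs (gap_height H) _ _).1 Qp; split => /=.
  + by rewrite -ler_norml ltW.
  + rewrite /resid2 indicE mem_set // mul1r -(real_normK (num_real _)) normrM /=.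
    have z1 := zeta1_bound kap0 eps0 h0 (ltW yh) eps1; have x1 := side_dist_bound Qp.
    rewrite -/A in z1; rewrite -/U /= in x1.
    have -> : (A * U) ^+ 2 * (y ^+ 2 / (d y * d y)) = (A * (`|y| * ((d y)^-1 * (d y)^-1)) * (U * d y)) ^+ 2.
      rewrite -[y ^+ 2](real_normK (num_real _)); field; by rewrite gt_eqF.
    apply: lerXn2r; last exact: ler_pM.
      by rewrite nnegrE; apply: mulr_ge0.
    by rewrite nnegrE; apply: mulr_ge0; [exact: le_trans z1|exact: le_trans x1].
  + apply/andP; split; first exact: ltW.
    by have := gap_width (ltW yh); rewrite -/U; lra.
- move=> y _; have dd := d0 y; have kd := sq_le_gapd kap eps0 y; split.
  + by rewrite mulr_ge0 // ltW.
  + by rewrite mulr_ge0 ?sqr_ge0 // divr_ge0 ?sqr_ge0 // mulr_ge0 // ltW.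
  + rewrite (_ : U * d y * _ = U * (A * U) ^+ 2 * (y ^+ 2 / d y)); last by field; rewrite gt_eqF.
    apply: ler_wpM2l; first by rewrite mulr_ge0 ?sqr_ge0 // ltW.
    by rewrite ler_pdivrMr // mulrC ler_pdivlMr // mulrC.
Qed.

Let ramp_set : set RR := Om `&` [set p | 0 < f p].
Let ramp_set_measurable : measurable ramp_set.
Proof.
apply: measurableI => //; apply: open_plane_measurable.
have cf := smooth_continuous (smooth_ramp_arg b s kap0 K0 eps0).
by apply: (open_comp (f := f) (D := [set x | 0 < x])) => //; exact: open_gt.
Qed.

(** By [dprofile_sq] the square is at most [2 * kap / q], on a section of length at most [q]. *)
Lemma ramp_grad1_bounded :
  sq_bounded (ramp_grad1 D kap K eps s) (2 * kap * (L2 - - L2) + (2 * b + 1) * 0 * (2 * L2)).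
Proof.
have [_ s1] := ramp_grad_sqint; have L20 : 0 < L2 := lt_trans h0 hL2.
apply: (@sq_bounded_cover _ ramp_set (fun y => b - g y) (fun y => q y) (fun y => 2 * kap / q y)) => //.
- by move=> p [].
- lra.
- move=> p Op nE; rewrite /ramp_grad1; case: (boolP (0 < f p)) => [fp|_]; first by case: nE.
  by rewrite mul0r expr0n.
- move=> p [Op /= fp]; have f1 := ramp_le1 Op; split; first exact: matrix_part_vert.
    rewrite /ramp_grad1 fp mul1r; have qq := q0 p.2; have dp := dprofile_sq p.2.
    rewrite (_ : _ ^+ 2 = dprofile kap K p.2 ^+ 2 * (1 - f p) ^+ 2 / (q p.2 * q p.2)); last by field; rewrite gt_eqF.
    rewrite (_ : 2 * kap / q p.2 = 2 * kap * q p.2 * 1 / (q p.2 * q p.2)); last by field; rewrite gt_eqF.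
    rewrite ler_pM2r; last by rewrite invr_gt0 mulr_gt0.
    by apply: ler_pM; rewrite ?sqr_ge0 //; nra.
  move: fp; rewrite ramp_pos => fp; have := matrix_part_side Op.
  by rewrite /width /half_width => xL; apply/andP; split; lra.
- move=> y _; have qq := q0 y; split; first exact: ltW.
    by rewrite divr_ge0 ?mulr_ge0 // ltW.
  by rewrite mulrC divfK ?gt_eqF.
Qed.

(** The exceptional set is the sliver between the inclusion and the modified boundary, where [zeta]
    is present but the ramp vanishes. Its width is at most [C * y ^+ 4] while the square is at most
    [(2 / d) ^+ 2], so the quartic contact is exactly what keeps the product bounded. *)
Lemma resid0_bounded :
  sq_bounded (resid0 D kap K h eps s) (4 * C / kap ^+ 2 * (h - - h) +
    (2 * b + 1) * (2 * K / kap + 4 / (kap * h ^+ 2) + 1 / g h) ^+ 2 * (2 * L2)).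
Proof.
have [s0 _ _] := resid_sqint; have k0 := kap0; have hp := h0; have kK := K0.
have gh : 0 < g h by apply: profile_gt0 => //; rewrite gt_eqF.
have a1 : 0 <= 2 * K / kap by rewrite divr_ge0 ?mulr_ge0 // ltW.
have a2 : 0 <= 4 / (kap * h ^+ 2) by rewrite divr_ge0 ?mulr_ge0 ?sqr_ge0 // ltW.
have a3 : 0 <= 1 / g h by rewrite divr_ge0 // ltW.
have sn : `|s| = 1 by case: hs => ->; rewrite ?normrN normr1.
set M0 := 2 * K / kap + 4 / (kap * h ^+ 2) + 1 / g h.
have M00 : 0 <= M0 by rewrite /M0; lra.
have mE : measurable (Q `\` ramp_set : set RR) by exact: measurableD.
apply: (@sq_bounded_cover _ (Q `\` ramp_set) (fun y => X y) (fun y => C * y ^+ 4) (fun y => (2 / d y) ^+ 2)) => //.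
- by move=> p [/QO].
- exact: sqr_ge0.
- lra.
- move=> p Op nE; rewrite /resid0 /ramp_grad0 indicE.
  rewrite -(real_normK (num_real (_ - _))); apply: lerXn2r; rewrite ?nnegrE //.
  case: (boolP (p \in Q)) => [/set_mem Qp|nQ].
    (* In the gap off the sliver the ramp is active, and [1 / q], [2 / d] and [zeta] differ by
       constants. *)
    have fp : 0 < f p by apply: contrapT => nf; apply: nE; split => // -[].
    have yh : `|p.2| <= h by case: (Qp) => -[/= /ltW].
    rewrite fp !mul1r (_ : _ - _ = s * ((1 / q p.2 - 2 / d p.2) + (2 / d p.2 - zeta kap eps h p.2))); last by ring.
    rewrite normrM sn [leLHS]mul1r; apply: (le_trans (ler_normD _ _)).
    have := width_gapd p.2; have := zeta_defect kap0 eps0 h0 yh; rewrite /M0; lra.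
  rewrite mul0r mulr0 subr0; case: (boolP (0 < f p)) => [fp|_]; last by rewrite mul0r normr0.
  rewrite mul1r normrM sn mul1r gtr0_norm ?invr_gt0 //.
  (* An active ramp outside the gap occurs only at heights at least [h], where the width is bounded
     below by [g h]. *)
  have yh : h <= `|p.2|.
    rewrite leNgt; apply/negP => yh; move/negP: nQ; apply; apply/mem_set.
    case: p yh fp Op {nE} => x y /= yh fp Op; apply/(gapP hD _ hs (gap_height H)); split => //.
      move: fp; rewrite ramp_pos /= => fp; apply: le_lt_trans fp.
      have K0y : closure D (0, y) by apply: inclusion_closure; apply: (good_height_axis hD (gap_height H)); exact: ltW.
      by apply: (le_trans (ler_norm _)); exact: (gap_support H (horiz_mem hD K0y)).
    exact: matrix_part_side Op.
  have gy : g h <= q p.2.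
    apply: (@le_trans _ _ (g p.2)); first by apply: profile_mono => //; rewrite gtr0_norm.
    by rewrite /width; have := eps0; lra.
  apply: (@le_trans _ _ (1 / g h)); last by rewrite /M0; lra.
  by rewrite div1r lef_pV2 ?posrE.
- case=> x y [Qp nf]; have [yh Xx xL] := (gapP hD _ hs (gap_height H) _ _).1 Qp.
  have fp : ~~ (0 < f (x, y)) by apply/negP => fp; apply: nf; split => //; exact: QO.
  have /andP[z1 z2] := zeta_range kap0 eps0 h0 (ltW yh).
  split => /=; first by rewrite -ler_norml ltW.
    rewrite /resid0 /ramp_grad0 (negbTE fp) mul0r sub0r indicE mem_set // mul1r sqrrN exprMn.
    have -> : s ^+ 2 = 1 by case: hs => ->; rewrite ?sqrrN expr1n.
    by rewrite mul1r; apply: lerXn2r; rewrite ?nnegrE //; exact: le_trans z2.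
  move: fp; rewrite ramp_pos -leNgt /= => fp; have := gap_defect H (ltW yh) => df.
  by apply/andP; split; [exact: ltW|lra].
- move=> y _; have dd := d0 y; have kd := sq_le_gapd kap eps0 y; have C1 := C0; have y0 := sqr_ge0 y.
  split; first by rewrite mulr_ge0 ?(ltW C1) // (_ : y ^+ 4 = (y ^+ 2) ^+ 2) ?sqr_ge0 // -exprM.
    exact: sqr_ge0.
  rewrite (_ : C * y ^+ 4 * (2 / d y) ^+ 2 = 4 * C * (y ^+ 2 / d y) ^+ 2); last by field; rewrite gt_eqF.
  rewrite (_ : 4 * C / kap ^+ 2 = 4 * C * kap^-1 ^+ 2); last by field; rewrite gt_eqF.
  apply: ler_wpM2l; first by rewrite mulr_ge0 // ltW.
  apply: lerXn2r; rewrite ?nnegrE ?invr_ge0 ?(ltW kap0) //; first by rewrite divr_ge0 // ltW.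
  by rewrite ler_pdivrMr // mulrC ler_pdivlMr // mulrC.
Qed.

End ResidualBounds.

(** * Energy of the ramp *)

Section Arctan.
Context {R : realType}.
Notation leb := (@lebesgue_measure R).

Lemma atan_le (t : R) : 0 <= t -> atan t <= t.
Proof.
rewrite le_eqVlt => /predU1P[<-|t0]; first by rewrite atan0.
have [c _] := MVT t0 (fun x _ => is_derive1_atan x) (continuous_subspaceT (@continuous_atan R)).
rewrite atan0 !subr0 => ->.
rewrite -[leRHS]mul1r ler_pM2r // invf_le1.
  by rewrite lerDl sqr_ge0.
by have := sqr_ge0 c; lra.
Qed.

(** The left side is the arctangent of [1 / z]. *)
Lemma atan_compl (z : R) : 0 < z -> pi / 2 - atan z <= 1 / z.
Proof.
move=> z0; have [/andP[a1 a2] tz] := atan_def z.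
have a0 : 0 < atan z by rewrite -(atan0 R) lt_atan.
have phi : tan (pi / 2 - atan z) = 1 / z.
  rewrite -[in RHS]tz /tan sinB cosB sin_pihalf cos_pihalf !mul0r !mul1r subr0 add0r.
  by rewrite invf_div.
rewrite -[leLHS](@tanK R); last first.
  by rewrite in_itv /=; apply/andP; split; lra.
by rewrite phi atan_le // divr_ge0 // ltW.
Qed.

Lemma integral_gapd (kap eps L : R) : 0 < kap -> 0 < eps -> 0 <= L ->
  \int[leb]_(y in `[- L, L]) (2 / gapd kap eps y) =
  4 / (Num.sqrt eps * Num.sqrt kap) * atan (Num.sqrt kap / Num.sqrt eps * L).
Proof.
move=> k0 e0 L0; set k := Num.sqrt kap; set e := Num.sqrt eps; set c := k / e.
have kp : 0 < k by rewrite sqrtr_gt0.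
have ep : 0 < e by rewrite sqrtr_gt0.
have kE : k ^+ 2 = kap by rewrite sqr_sqrtr // ltW.
have eE : e ^+ 2 = eps by rewrite sqr_sqrtr // ltW.
have LL : - L <= L by lra.
have dF (t : R) : is_derive t 1 (fun y : R => 2 / (e * k) * atan (c * y)) (2 / gapd kap eps t).
  have d1 : is_derive t 1 (fun y : R => c * y) c.
    by have := is_derive_scaler c (is_derive_id t (1 : R)); rewrite mulr1.
  have d2 := is_derive_scaler (2 / (e * k)) (is_derive1_comp (g := fun y : R => c * y) (is_derive1_atan (c * t)) d1).
  apply: (is_derive_eq d2); rewrite /gapd -kE -eE /c; field.
  have := sqr_ge0 (k * t); have : 0 < e ^+ 2 by rewrite exprn_gt0.
  by move=> h1 h2; rewrite !gt_eqF //; nra.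
have cd : continuous (fun y : R => 2 / gapd kap eps y).
  move=> y; apply: cvgM; first exact: cvg_cst.
  apply: cvgV; first by rewrite gt_eqF // gapd_gt0.
  apply: cvgD; first exact: cvg_cst.
  by apply: cvgM; [exact: cvg_cst|exact: exprn_continuous].
have := ftc_segment LL dF cd; rewrite -integ_EFin //; last exact: integ_continuous.
by case=> ->; rewrite mulrN atanN mulrN opprK -mulrDl -mulrDl; congr (_ * _); congr (_ / _); ring.
Qed.

Lemma integral_gapd_asymp (kap eps L : R) : 0 < kap -> 0 < eps -> 0 < L ->
  `| \int[leb]_(y in `[- L, L]) (2 / gapd kap eps y) - 2 * (pi / Num.sqrt kap) * (1 / Num.sqrt eps) | <= 4 / (kap * L).
Proof.
move=> k0 e0 L0; rewrite integral_gapd //; last exact: ltW.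
set k := Num.sqrt kap; set e := Num.sqrt eps.
have kp : 0 < k by rewrite sqrtr_gt0.
have ep : 0 < e by rewrite sqrtr_gt0.
have kE : k ^+ 2 = kap by rewrite sqr_sqrtr // ltW.
have z0 : 0 < k / e * L by rewrite mulr_gt0 // divr_gt0.
have l1 := atan_compl z0; have l2 := atan_ltpi2 (k / e * L).
rewrite (_ : _ - _ = - (4 / (e * k) * (pi / 2 - atan (k / e * L)))); last by field; rewrite !gt_eqF.
have f0 : 0 < 4 / (e * k) by rewrite divr_gt0 // mulr_gt0.
rewrite normrN ger0_norm; last by rewrite mulr_ge0 ?(ltW f0) // subr_ge0 ltW.
apply: (@le_trans _ _ (4 / (e * k) * (1 / (k / e * L)))); first by rewrite ler_pM2l.
by rewrite le_eqVlt; apply/orP; left; apply/eqP; rewrite -kE; field; rewrite !gt_eqF.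
Qed.

End Arctan.

Section RampEnergy.
Context {R : realType} (D : set (R * R)) (gamma : R -> R * R) (T L2 kap K C h : R).
Hypothesis H : gap_data D gamma T L2 kap K C h.
Variables eps s : R.
Hypothesis eps0 : 0 < eps.
Hypothesis hs : s = 1 \/ s = -1.
Notation leb := (@lebesgue_measure R).
Notation mu2 := (@plane_measure R).
Notation RR := (measurableTypeR R * measurableTypeR R)%type.
Notation Om := (matrix_part D L2 eps).
Notation b := (xmax D).
Notation L1 := (half_width D eps).
Notation g := (profile kap K).
Notation q := (width kap K eps).
Notation f := (ramp_arg b kap K eps s).

Let hD := gap_inclusion H.
Let kap0 : 0 < kap := gap_kap H.
Let K0 : 0 < K := gap_K H.
Let L20 : 0 < L2 := lt_trans (gap_height H).1 (gap_L2 H).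
Let q0 y : 0 < q y := width_gt0 kap0 K0 eps0 y.
Let mO := @matrix_part_measurable _ D L2 eps.

Lemma ramp_region x y : (Om (x, y) /\ 0 < f (x, y)) <-> [/\ - L2 < y < L2, b - g y < s * x & s * x < L1].
Proof.
rewrite (ramp_pos H s eps0); split => [[Op fp]|[yL xb xL]] /=.
  by have [[_ /= yL] _] := Op; split => //; exact: (matrix_part_side hs Op).
have gl := profile_le_lim kap0 K0 y; have gK := gap_profile_lt H.
split => //; split.
  split => //=; apply/(sided_range hs) => //; lra.
move=> /(gap_support H); rewrite ler_norml => /andP[n1 n2].
by case: hs xb => ->; rewrite ?mul1r ?mulN1r => xb; lra.
Qed.

(** On the section at height [y] the square is the constant [(1 / q y) ^+ 2], over an interval of
    length [q y]. *)
Lemma integral_ramp_grad0 : \int[mu2]_(p in Om) ramp_grad0 D kap K eps s p ^+ 2 =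
  \int[leb]_(y in `[- L2, L2]) (1 / q y).
Proof.
have [[_ iG] _] := ramp_grad_sqint H eps0 hs.
have cq : continuous (fun y : R => 1 / q y).
  have sV : smooth (fun p : R * R => (q p.2)^-1).
    by apply: smoothV; [move=> p; rewrite gt_eqF|exact: smooth_width].
  move=> y; apply: cvgM; first exact: cvg_cst.
  exact: (@continuous_section_y _ _ 0 (smooth_continuous sV) y).
suff : (\int[mu2]_(p in Om) ramp_grad0 D kap K eps s p ^+ 2)%:E = (\int[leb]_(y in `[- L2, L2]) (1 / q y))%:E.
  by case.
rewrite !integ_EFin //; last exact: integ_continuous.
rewrite plane_integral_y // -integral_oo_cc // [RHS]integral_mkcond.
apply: eq_integral => y _; rewrite patchE.
have sE (I : set (measurableTypeR R)) : (forall x, (Om (x, y) /\ 0 < f (x, y)) <-> I x) ->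
    (\int[leb]_x (((fun p => ramp_grad0 D kap K eps s p ^+ 2) \_ Om) (x, y))%:E)%E =
    (\int[leb]_(x in I) ((1 / q y) ^+ 2)%:E)%E.
  move=> hI; rewrite [RHS]integral_mkcond; apply: eq_integral => x _; rewrite !patchE.
  have s2 : s ^+ 2 = 1 by case: hs => ->; rewrite ?sqrrN expr1n.
  case: ifPn => [/set_mem Op|nO].
    rewrite /ramp_grad0; case: (boolP (0 < f (x, y))) => fp.
      rewrite mem_set; last exact/hI.
      have -> : true%:R * (s / q (x, y).2) = s * (1 / q y) by rewrite /= !mul1r.
      by congr EFin; rewrite exprMn s2; exact: mul1r.
    by rewrite memNset ?mul0r ?expr0n // => /hI[_ fp']; move/negP: fp.
  by rewrite memNset // => /hI[Op _]; move/negP: nO; apply; apply/mem_set.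
case: ifPn => yL; last first.
  rewrite (sE set0) ?integral_set0 // => x; split => // /ramp_region[yL' _ _].
  by move/negP: yL; apply; rewrite inE /= in_itv.
have {}yL : - L2 < y < L2 by move: yL; rewrite inE /= in_itv.
have gE : L1 - (b - g y) = q y by rewrite /half_width /width; ring.
have gl : b - g y < L1 by have := q0 y; lra.
have fin : (((1 / q y) ^+ 2)%:E * (q y)%:E = (1 / q y)%:E)%E.
  by rewrite -EFinM; congr EFin; field; rewrite gt_eqF.
case: (hs) => s1.
  rewrite (sE `](b - g y), L1[%classic); last first.
    move=> x; rewrite ramp_region s1 mul1r /= in_itv /=.
    by split => [[_ -> ->]|/andP[]].
  by rewrite integral_cst //= lebesgue_measure_itv /= lte_fin gl -EFinB gE.
rewrite (sE `](- L1), (- (b - g y))[%classic); last first.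
  move=> x; rewrite ramp_region s1 mulN1r /= in_itv /=.
  by split => [[_ h1 h2]|/andP[h1 h2]]; [apply/andP; split; lra|split => //; lra].
rewrite integral_cst //= lebesgue_measure_itv /= lte_fin ltrN2 gl -EFinB.
by rewrite opprK addrC gE.
Qed.

Lemma integral_width_asymp :
  `| \int[leb]_(y in `[- L2, L2]) (1 / q y) - 2 * (pi / Num.sqrt kap) * (1 / Num.sqrt eps) | <=
  2 * K / kap * (2 * L2) + 4 / (kap * L2).
Proof.
have cq : continuous (fun y : R => 1 / q y).
  have sV : smooth (fun p : R * R => (q p.2)^-1).
    by apply: smoothV; [move=> p; rewrite gt_eqF|exact: smooth_width].
  move=> y; apply: cvgM; first exact: cvg_cst.
  exact: (@continuous_section_y _ _ 0 (smooth_continuous sV) y).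
have cd : continuous (fun y : R => 2 / gapd kap eps y).
  move=> y; apply: cvgM; first exact: cvg_cst.
  exact: (@continuous_section_y _ _ 0 (smooth_continuous (smooth_gapd_inv kap0 eps0)) y).
have a2 := integral_gapd_asymp kap0 eps0 L20.
set A := \int[leb]_(y in _) _; set B := \int[leb]_(y in _) (2 / _) in a2.
have a1 : `|A - B| <= 2 * K / kap * (2 * L2).
  have iq := integ_continuous (- L2) L2 cq; have id := integ_continuous (- L2) L2 cd.
  rewrite /A /B -RintegralB //; apply: (le_trans (le_normr_Rintegral _ _)) => //; first exact: integB.
  have LL : - L2 <= L2 by have := L20; lra.
  apply: (@le_trans _ _ (\int[leb]_(y in `[- L2, L2]) (2 * K / kap))).
    apply: le_Rintegral => //.
    - by apply: integ_norm => //; exact: integB.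
    - by apply: integ_continuous => y; exact: cvg_cst.
    - by move=> y _; exact: (width_gapd H eps0).
  rewrite Rintegral_cst //= lebesgue_measure_segment //= ler_pM2l; first by lra.
  by rewrite divr_gt0 // mulr_gt0.
rewrite (_ : A - _ = (A - B) + (B - 2 * (pi / Num.sqrt kap) * (1 / Num.sqrt eps))); last by ring.
by apply: (le_trans (ler_normD _ _)); exact: lerD.
Qed.

End RampEnergy.

(** * Energy pairing and fluxes *)

Section EnergyForm.
Context {R : realType} (lam mu : R) (D : set (R * R)) (L2 eps : R).
Notation mu2 := (@plane_measure R).
Notation Om := (matrix_part D L2 eps).
Implicit Types v w z : 'I_2 -> H1 Om.
Let mO := @matrix_part_measurable _ D L2 eps.

Definition divergence v (p : R * R) : R := H1_grad (v ord0) ord0 p + H1_grad (v ord_max) ord_max p.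
(** Twice the off-diagonal strain, hence the coefficient [mu] in [energy_density] against [2 * mu]
    for the diagonal entries. *)
Definition shear v (p : R * R) : R := H1_grad (v ord0) ord_max p + H1_grad (v ord_max) ord0 p.

Definition energy_density v w (p : R * R) : R :=
  lam * (divergence v p * divergence w p)
  + (2 * mu * (H1_grad (v ord0) ord0 p * H1_grad (w ord0) ord0 p)
  + (2 * mu * (H1_grad (v ord_max) ord_max p * H1_grad (w ord_max) ord_max p)
  + mu * (shear v p * shear w p))).

Lemma conormal_pairingE v w : conormal_pairing lam mu v w = \int[mu2]_(p in Om) energy_density v w p.
Proof.
apply: eq_Rintegral => p _.
by rewrite /stress /strain /elasticity_tensor /kron !sum_ord2 /= /energy_density /divergence /shear; field.
Qed.

Lemma divergence_sqint v : sqint mu2 Om (divergence v).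
Proof. by apply: sqintD => //; exact: H1_grad_sqint. Qed.

Lemma shear_sqint v : sqint mu2 Om (shear v).
Proof. by apply: sqintD => //; exact: H1_grad_sqint. Qed.

Lemma energy_density_integ v w : integ mu2 Om (energy_density v w).
Proof.
have gs (u : 'I_2 -> H1 Om) k i : sqint mu2 Om (H1_grad (u k) i) by exact: H1_grad_sqint.
have h0 := integZ mO lam (sqint_mul mO (divergence_sqint v) (divergence_sqint w)).
have h1 := integZ mO (2 * mu) (sqint_mul mO (gs v ord0 ord0) (gs w ord0 ord0)).
have h2 := integZ mO (2 * mu) (sqint_mul mO (gs v ord_max ord_max) (gs w ord_max ord_max)).
have h3 := integZ mO mu (sqint_mul mO (shear_sqint v) (shear_sqint w)).
exact: (integD mO h0 (integD mO h1 (integD mO h2 h3))).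
Qed.

Lemma conormal_pairing_sym v w : conormal_pairing lam mu v w = conormal_pairing lam mu w v.
Proof.
rewrite !conormal_pairingE; apply: eq_Rintegral => p _; rewrite /energy_density; ring.
Qed.

Definition comb (a b : R) v w : 'I_2 -> H1 Om := fun k => H1_comb a b (v k) (w k).

Lemma conormal_pairing_comb a b v w z :
  conormal_pairing lam mu (comb a b v w) z = a * conormal_pairing lam mu v z + b * conormal_pairing lam mu w z.
Proof.
rewrite !conormal_pairingE -!RintegralZl //; [|exact: energy_density_integ|exact: energy_density_integ].
rewrite -RintegralD //; last 2 first.
- by apply: integZ => //; exact: energy_density_integ.
- by apply: integZ => //; exact: energy_density_integ.
apply: eq_Rintegral => p _; rewrite /energy_density /divergence /shear !H1_comb_grad; ring.
Qed.

Definition strain_sq v (p : R * R) : R :=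
  H1_grad (v ord0) ord0 p ^+ 2 + (H1_grad (v ord_max) ord_max p ^+ 2 + shear v p ^+ 2).

Lemma strain_sq_integ v : integ mu2 Om (strain_sq v).
Proof.
have [_ h1] := H1_grad_sqint (v ord0) ord0; have [_ h2] := H1_grad_sqint (v ord_max) ord_max.
have [_ h3] := shear_sqint v.
exact: (integD mO h1 (integD mO h2 h3)).
Qed.

(** In the diagonal entries [x], [y] and the shear [t] the density is [(lam + mu) * (x + y) ^+ 2 +
    mu * (x - y) ^+ 2 + mu * t ^+ 2], so the two ellipticity conditions appear as coefficients. *)
Lemma energy_coercive v : 0 < mu -> 0 < lam + mu ->
  Num.min mu (lam + mu) * \int[mu2]_(p in Om) strain_sq v p <= conormal_pairing lam mu v v.
Proof.
move=> m0 lm0; rewrite conormal_pairingE -RintegralZl //; last exact: strain_sq_integ.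
apply: le_Rintegral => //.
- by apply: integZ => //; exact: strain_sq_integ.
- exact: energy_density_integ.
move=> p _; rewrite /strain_sq /energy_density /divergence.
set x := H1_grad _ _ p; set y := H1_grad _ _ p; set t := shear v p; set c := Num.min _ _.
have [c1 c2] : c <= mu /\ c <= lam + mu by rewrite /c !ge_min !lexx ?orbT.
have c0 : 0 < c by rewrite /c lt_min m0.
rewrite [leRHS](_ : _ = (lam + mu) * (x + y) ^+ 2 + (mu * (x - y) ^+ 2 + mu * t ^+ 2)); last by ring.
apply: (@le_trans _ _ (c * (x + y) ^+ 2 + (c * (x - y) ^+ 2 + c * t ^+ 2))).
  have x2 := mulr_ge0 (ltW c0) (sqr_ge0 x); have y2 := mulr_ge0 (ltW c0) (sqr_ge0 y); nra.
by apply: lerD; [|apply: lerD]; apply: ler_wpM2r => //; exact: sqr_ge0.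
Qed.

(** Young's inequality with a free weight [t], so that the strain term can later be absorbed by
    coercivity. *)
Lemma pairing_bound v (P N O : R * R -> R) (t M : R) : 0 < t ->
  sqint mu2 Om P -> sqint mu2 Om N -> sqint mu2 Om O ->
  \int[mu2]_(p in Om) (P p ^+ 2 + (N p ^+ 2 + O p ^+ 2)) <= M ->
  `| \int[mu2]_(p in Om) (P p * H1_grad (v ord0) ord0 p + (N p * H1_grad (v ord_max) ord_max p + O p * shear v p)) |
  <= t * \int[mu2]_(p in Om) strain_sq v p + M / (4 * t).
Proof.
move=> t0 sP sN sO hM.
have iE : integ mu2 Om (fun p => P p * H1_grad (v ord0) ord0 p + (N p * H1_grad (v ord_max) ord_max p + O p * shear v p)).
  apply: integD => //; first by apply: sqint_mul => //; exact: H1_grad_sqint.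
  apply: integD => //; first by apply: sqint_mul => //; exact: H1_grad_sqint.
  by apply: sqint_mul => //; exact: shear_sqint.
have iS : integ mu2 Om (fun p => P p ^+ 2 + (N p ^+ 2 + O p ^+ 2)).
  by apply: integD => //; [case: sP|apply: integD => //; [case: sN|case: sO]].
have iR := strain_sq_integ v.
apply: (le_trans (le_normr_Rintegral _ _)) => //.
apply: (@le_trans _ _ (\int[mu2]_(p in Om) (t * strain_sq v p + (4 * t)^-1 * (P p ^+ 2 + (N p ^+ 2 + O p ^+ 2))))).
  apply: le_Rintegral => //; first exact: integ_norm.
    by apply: integD => //; exact: integZ.
  move=> p _; rewrite /strain_sq; set x := H1_grad _ _ p; set y := H1_grad _ _ p; set w := shear v p.
  have am (a e : R) : `|a * e| <= t * e ^+ 2 + (4 * t)^-1 * a ^+ 2.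
    have t4 : 0 < 4 * t by lra.
    rewrite -(ler_pM2l t4) mulrDr mulrA mulVKf ?gt_eqF //.
    rewrite normrM -(real_normK (num_real a)) -(real_normK (num_real e)).
    by have := sqr_ge0 (2 * t * `|e| - `|a|); nra.
  apply: (le_trans (ler_normD _ _)); have a1 := am (P p) x; have := ler_normD (N p * y) (O p * w).
  have := am (N p) y; have := am (O p) w; lra.
rewrite RintegralD //; [|exact: integZ|exact: integZ].
rewrite !RintegralZl // lerD2l mulrC ler_pM2r // invr_gt0; lra.
Qed.

Lemma Rintegral_sub0 (F G : R * R -> R) (c : R) : integ mu2 Om F -> integ mu2 Om G ->
  \int[mu2]_(p in Om) G p = 0 -> \int[mu2]_(p in Om) F p = \int[mu2]_(p in Om) (F p - c * G p).
Proof.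
move=> iF iG G0; rewrite RintegralB //; last exact: integZ.
by rewrite RintegralZl // G0 mulr0 subr0.
Qed.

End EnergyForm.

(** * Evaluation of the flux by one test field *)

Section FluxEvaluation.
Context {R : realType} (lam mu : R) (D : set (R * R)) (gamma : R -> R * R) (T L2 eps : R).
Notation Om := (matrix_part D L2 eps).
Notation L1 := (half_width D eps).
Hypothesis cgamma : continuous gamma.
Implicit Types v w z : 'I_2 -> H1 Om.

Lemma continuous_vertical (x : R) : continuous (fun y : R => (x, y) : R * R).
Proof. by apply: continuous_pair => y; [exact: cvg_cst|exact: cvg_id]. Qed.

(** Two admissible test fields differ by a field with zero traces on the inclusion and both vertical
    sides, on which the pairing with [v] vanishes. So the common value exists and the default of
    [xget] is not taken. *)
Lemma right_fluxE j v w0 : cell_solution lam mu gamma T j v ->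
  trace_inclusion gamma T w0 zero_vec -> trace_left w0 zero_vec -> trace_right w0 (kron j) ->
  right_flux lam mu gamma T j v = conormal_pairing lam mu v w0.
Proof.
move=> sol i0 l0 r0; rewrite /right_flux; set A := [set q | _].
have AP : A (xget 0 A).
  apply: xgetPex; exists (conormal_pairing lam mu v w0) => w i1 l1 r1.
  have := @cell_horizontal _ _ _ _ _ _ _ _ _ _ sol (comb 1 (-1) w w0).
  rewrite conormal_pairing_sym conormal_pairing_comb !(conormal_pairing_sym _ _ _ v) mul1r mulN1r.
  move=> E; apply/eqP; rewrite -subr_eq0; apply/eqP; apply: E => k.
  - by have := has_trace_comb 1 (-1) cgamma (i1 k) (i0 k); rewrite /zero_vec !mulr0 addr0.
  - by have := has_trace_comb 1 (-1) (@continuous_vertical _) (l1 k) (l0 k); rewrite /zero_vec !mulr0 addr0.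
  - by have := has_trace_comb 1 (-1) (@continuous_vertical _) (r1 k) (r0 k); rewrite /zero_vec mul1r mulN1r subrr.
by rewrite (AP w0).
Qed.

End FluxEvaluation.

(** * The residual stress of a ramp *)

Section RampResidual.
Context {R : realType} (lam mu : R) (D : set (R * R)) (gamma : R -> R * R) (T L2 kap K C h : R).
Hypothesis H : gap_data D gamma T L2 kap K C h.
Notation mu2 := (@plane_measure R).

Section OneSide.
Variables eps s : R.
Hypothesis eps0 : 0 < eps.
Hypothesis eps1 : eps <= 1.
Hypothesis hs : s = 1 \/ s = -1.
Notation Om := (matrix_part D L2 eps).
Notation L1 := (half_width D eps).
Notation Q := (gap D s h L1).
Notation Z := (zeta kap eps h).
Notation G0 := (ramp_grad0 D kap K eps s).
Notation G1 := (ramp_grad1 D kap K eps s).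
Notation R0 := (resid0 D kap K h eps s).
Notation R2 := (resid2 D kap h eps s).
Notation R3 := (resid3 D kap h eps s).
Implicit Types (u W : H1 Om) (r : 'I_2 -> H1 Om).
Let mO := @matrix_part_measurable _ D L2 eps.
Let QO : Q `<=` Om := gap_sub eps0 hs (gap_height H) (gap_L2 H).

(** The integrands of the three gap identities, carried over to the whole cell by the indicator of
    the gap. *)
Definition null0 u p := (\1_Q p * Z p.2) * H1_grad u ord0 p.
Definition null1 u p := (\1_Q p * Z p.2) * H1_grad u ord_max p - R2 p * H1_grad u ord0 p.
Definition null2 u p := (1 / 2 * R3 p) * H1_grad u ord0 p - R2 p * H1_grad u ord_max p.

Let sZ : sqint mu2 Om (fun p => \1_Q p * Z p.2).
Proof. by apply: indic_sqint; exact: (smooth_zeta h (gap_kap H) eps0). Qed.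

Lemma null_integ u : [/\ integ mu2 Om (null0 u), integ mu2 Om (null1 u) & integ mu2 Om (null2 u)].
Proof.
have [_ s2 s3] := resid_sqint H eps0 hs; have gs i := H1_grad_sqint u i.
split; first exact: sqint_mul.
  by apply: integB => //; exact: sqint_mul.
by apply: integB => //; apply: sqint_mul => //; exact: sqintZ.
Qed.

Lemma null_integral u : has_trace gamma 0 T u 0 -> has_trace (fun y => (s * L1, y)) (- L2) L2 u 0 ->
  [/\ \int[mu2]_(p in Om) null0 u p = 0, \int[mu2]_(p in Om) null1 u p = 0 & \int[mu2]_(p in Om) null2 u p = 0].
Proof.
move=> t1 t2; split.
- rewrite -(gap_identity0 H eps0 hs t1 t2) -(Rintegral_indic mu2 _ QO).
  by apply: eq_Rintegral => p _; rewrite /null0; ring.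
- rewrite -(gap_identity1 H eps0 hs t1 t2) -(Rintegral_indic mu2 _ QO).
  by apply: eq_Rintegral => p _; rewrite /null1 /resid2; ring.
- rewrite -(gap_identity2 H eps0 hs t1 t2) -(Rintegral_indic mu2 _ QO).
  by apply: eq_Rintegral => p _; rewrite /null2 /resid2 /resid3; field.
Qed.

Variable W : H1 Om.
Hypothesis W0 : forall p, H1_grad W ord0 p = G0 p.
Hypothesis W1 : forall p, H1_grad W ord_max p = G1 p.

(** The field [W] times the unit vector of direction [j]; the second slot of [H1_comb] is filled
    with coefficient 0 to express a scalar multiple. *)
Definition ramp_vec (j : 'I_2) : 'I_2 -> H1 Om := fun k => H1_comb (kron j k) 0 W W.

(* The stress subtracted from that of the ramp has, for [j = ord0], the components
   [s ((lam + 2 mu) zeta + lam zeta'' X^2 / 2)] (xx), [- s lam zeta' X] (xy), [s lam zeta] (yy), and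
   for [j = ord_max], [- s mu zeta' X] (xx), [s mu zeta] (xy), [0] (yy). *)
Lemma ramp_residual j r : trace_inclusion gamma T r zero_vec ->
  (forall k, has_trace (fun y => (s * L1, y)) (- L2) L2 (r k) 0) ->
  exists P N O : R * R -> R, [/\ sqint mu2 Om P, sqint mu2 Om N & sqint mu2 Om O] /\
  (forall p, P p ^+ 2 + (N p ^+ 2 + O p ^+ 2) <=
    (2 * (lam + 2 * mu) ^+ 2 + 3 * lam ^+ 2 + 2 * mu ^+ 2) * (R0 p ^+ 2 + (G1 p ^+ 2 + (R2 p ^+ 2 + R3 p ^+ 2)))) /\
  conormal_pairing lam mu (ramp_vec j) r = \int[mu2]_(p in Om)
    (P p * H1_grad (r ord0) ord0 p + (N p * H1_grad (r ord_max) ord_max p + O p * shear r p)).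
Proof.
move=> ti ts; have [s0 s2 s3] := resid_sqint H eps0 hs; have [_ s1] := ramp_grad_sqint H eps0 hs.
have [i00 i01 i02] := null_integ (r ord0); have [i10 i11 i12] := null_integ (r ord_max).
have [z00 z01 z02] := null_integral (ti ord0) (ts ord0).
have [z10 z11 z12] := null_integral (ti ord_max) (ts ord_max).
have ss : s * s = 1 by case: hs => ->; rewrite ?mulrNN mulr1.
have lin (a c : R) F F' : sqint mu2 Om F -> sqint mu2 Om F' -> sqint mu2 Om (fun p => a * F p + c * F' p).
  by move=> h1 h2; apply: sqintD => //; exact: sqintZ.
have iD := energy_density_integ lam mu (ramp_vec j) r.
have [jE|jE] := ord2_cases j.
- exists (fun p => (lam + 2 * mu) * R0 p + (- (lam * s / 2)) * R3 p), (fun p => lam * R0 p),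
    (fun p => mu * G1 p + (lam * s) * R2 p); split.
    by split; [exact: lin|exact: sqintZ|exact: lin].
  split.
    move=> p; set a := R0 p; set e := G1 p; set c := R2 p; set d := R3 p.
    (* Nonnegativity of the square with the opposite sign bounds the square of a two-term entry by
       twice the sum of the squares. *)
    have q1 := sqr_ge0 ((lam + 2 * mu) * a + (lam * s / 2) * d).
    have q2 := sqr_ge0 (mu * e - lam * s * c).
    have sl : (lam * s) ^+ 2 = lam ^+ 2 by rewrite exprMn (_ : s ^+ 2 = 1) ?mulr1 // expr2.
    set m := lam + 2 * mu in q1 *; set l := lam * s in q1 q2 sl *.
    have pp (x y : R) : 0 <= (x * y) ^+ 2 by exact: sqr_ge0.
    have p1 := pp m e; have p2 := pp m c; have p3 := pp m d; have p4 := pp lam a; have p5 := pp lam e.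
    have p6 := pp lam c; have p7 := pp lam d; have p8 := pp mu a; have p9 := pp mu e; have p10 := pp mu c.
    have p11 := pp mu d; have p12 := pp m a.
    apply: (@le_trans _ _ (2 * m ^+ 2 * a ^+ 2 + lam ^+ 2 / 2 * d ^+ 2 + lam ^+ 2 * a ^+ 2 + 2 * mu ^+ 2 * e ^+ 2 + 2 * lam ^+ 2 * c ^+ 2)).
      have sd : l ^+ 2 * d ^+ 2 = lam ^+ 2 * d ^+ 2 by rewrite sl.
      have sc : l ^+ 2 * c ^+ 2 = lam ^+ 2 * c ^+ 2 by rewrite sl.
      by lra.
    by lra.
  (* [null0] of the first component removes [(lam + 2 * mu) * s * zeta] from xx. [null1] of the
     second component removes [lam * s * zeta] from yy and leaves a one-sided shear entry, which
     [null2] of the first component completes to a multiple of [shear r]. *)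
  rewrite conormal_pairingE (Rintegral_sub0 ((lam + 2 * mu) * s) iD i00 z00).
  have j1 := integB mO iD (integZ mO ((lam + 2 * mu) * s) i00).
  rewrite (Rintegral_sub0 (lam * s) j1 i11 z11).
  have j2 := integB mO j1 (integZ mO (lam * s) i11).
  rewrite (Rintegral_sub0 (lam * s) j2 i02 z02).
  apply: eq_Rintegral => p _; rewrite /energy_density /divergence /shear /null0 /null1 /null2 /ramp_vec.
  by rewrite !H1_comb_grad jE /kron /= W0 W1 /resid0; field.
- exists (fun p => lam * G1 p + (mu * s) * R2 p), (fun p => (lam + 2 * mu) * G1 p), (fun p => mu * R0 p); split.
    by split; [exact: lin|exact: sqintZ|exact: sqintZ].
  split.
    move=> p; set a := R0 p; set e := G1 p; set c := R2 p; set d := R3 p.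
    have q1 := sqr_ge0 (lam * e - mu * s * c).
    have sl : (mu * s) ^+ 2 = mu ^+ 2 by rewrite exprMn (_ : s ^+ 2 = 1) ?mulr1 // expr2.
    set m := lam + 2 * mu; set l := mu * s in q1 sl *.
    have pp (x y : R) : 0 <= (x * y) ^+ 2 by exact: sqr_ge0.
    have p1 := pp m e; have p2 := pp m c; have p3 := pp m d; have p4 := pp lam a; have p5 := pp lam e.
    have p6 := pp lam c; have p7 := pp lam d; have p8 := pp mu a; have p9 := pp mu e; have p10 := pp mu c.
    have p11 := pp mu d; have p12 := pp m a.
    apply: (@le_trans _ _ (2 * lam ^+ 2 * e ^+ 2 + 2 * mu ^+ 2 * c ^+ 2 + m ^+ 2 * e ^+ 2 + mu ^+ 2 * a ^+ 2)).
      have sc : l ^+ 2 * c ^+ 2 = mu ^+ 2 * c ^+ 2 by rewrite sl.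
      by lra.
    by lra.
  (* [null0] of the second component and [null1] of the first, equally weighted, combine to [zeta]
     times the shear, up to an xx entry [resid2]. *)
  rewrite conormal_pairingE (Rintegral_sub0 (mu * s) iD i10 z10).
  have j1 := integB mO iD (integZ mO (mu * s) i10).
  rewrite (Rintegral_sub0 (mu * s) j1 i01 z01).
  apply: eq_Rintegral => p _; rewrite /energy_density /divergence /shear /null0 /null1 /null2 /ramp_vec.
  by rewrite !H1_comb_grad jE /kron /= W0 W1 /resid0; field.
Qed.

Lemma ramp_self_energy j : conormal_pairing lam mu (ramp_vec j) (ramp_vec j) =
  (if j == ord0 then lam + 2 * mu else mu) * \int[mu2]_(p in Om) G0 p ^+ 2 +
  (if j == ord0 then mu else lam + 2 * mu) * \int[mu2]_(p in Om) G1 p ^+ 2.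
Proof.
have [[_ i0] [_ i1]] := ramp_grad_sqint H eps0 hs.
rewrite conormal_pairingE -!RintegralZl // -RintegralD //; [|exact: integZ|exact: integZ].
apply: eq_Rintegral => p _; rewrite /energy_density /divergence /shear /ramp_vec !H1_comb_grad W0 W1.
by have [->|->] := ord2_cases j; rewrite /kron /=; ring.
Qed.

End OneSide.

Lemma resid_total : exists M, forall eps s, 0 < eps -> eps <= 1 -> s = 1 \/ s = -1 ->
  integ mu2 (matrix_part D L2 eps) (fun p => resid0 D kap K h eps s p ^+ 2 + (ramp_grad1 D kap K eps s p ^+ 2
    + (resid2 D kap h eps s p ^+ 2 + resid3 D kap h eps s p ^+ 2))) /\
  \int[mu2]_(p in matrix_part D L2 eps) (resid0 D kap K h eps s p ^+ 2 + (ramp_grad1 D kap K eps s p ^+ 2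
    + (resid2 D kap h eps s p ^+ 2 + resid3 D kap h eps s p ^+ 2))) <= M.
Proof.
(* The bound is a metavariable created before [eps] and [s], so its value cannot depend on them. *)
eexists => eps s e0 e1 hs; have mO := @matrix_part_measurable _ D L2 eps.
have [[_ i0] b0] := resid0_bounded H e0 e1 hs; have [[_ i1] b1] := ramp_grad1_bounded H e0 e1 hs.
have [[_ i2] b2] := resid2_bounded H e0 e1 hs; have [[_ i3] b3] := resid3_bounded H e0 e1 hs.
have i23 := integD mO i2 i3; have i123 := integD mO i1 i23.
split; first exact: integD.
rewrite RintegralD // RintegralD // RintegralD //.
by apply: (lerD b0); apply: (lerD b1); exact: (lerD b2 b3).
Qed.

Lemma ramp_grad1_total : exists M, forall eps s, 0 < eps -> eps <= 1 -> s = 1 \/ s = -1 ->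
  \int[mu2]_(p in matrix_part D L2 eps) ramp_grad1 D kap K eps s p ^+ 2 <= M.
Proof. by eexists => eps s e0 e1 hs; exact: (ramp_grad1_bounded H e0 e1 hs).2. Qed.

End RampResidual.

(** * Asymptotics of the flux *)

Section FluxAsymptotics.
Context {R : realType} (lam mu : R) (D : set (R * R)) (gamma : R -> R * R) (T L2 kap K C h : R).
Hypothesis hmu : 0 < mu.
Hypothesis hlm : 0 < lam + mu.
Hypothesis H : gap_data D gamma T L2 kap K C h.
Notation mu2 := (@plane_measure R).

(** [stiffness] and [costiffness] are the coefficients of the squared x- and y-derivative in the
    energy of a scalar profile times the unit vector [j]. *)
Definition stiffness (j : 'I_2) : R := if j == ord0 then lam + 2 * mu else mu.
Definition costiffness (j : 'I_2) : R := if j == ord0 then mu else lam + 2 * mu.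

Lemma stiffness_gt0 j : 0 < stiffness j /\ 0 < costiffness j.
Proof. by have m0 := hmu; have l0 := hlm; rewrite /stiffness /costiffness; case: ifP => _; split; lra. Qed.

Section Fixed.
Variables (eps M N : R).
Hypothesis eps0 : 0 < eps.
Hypothesis eps1 : eps <= 1.
Notation Om := (matrix_part D L2 eps).
Notation L1 := (half_width D eps).
Notation pairing := (conormal_pairing lam mu).
Hypothesis resM : forall s, s = 1 \/ s = -1 ->
  integ mu2 Om (fun p => resid0 D kap K h eps s p ^+ 2 + (ramp_grad1 D kap K eps s p ^+ 2
    + (resid2 D kap h eps s p ^+ 2 + resid3 D kap h eps s p ^+ 2))) /\
  \int[mu2]_(p in Om) (resid0 D kap K h eps s p ^+ 2 + (ramp_grad1 D kap K eps s p ^+ 2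
    + (resid2 D kap h eps s p ^+ 2 + resid3 D kap h eps s p ^+ 2))) <= M.
Hypothesis gradN : forall s, s = 1 \/ s = -1 ->
  \int[mu2]_(p in Om) ramp_grad1 D kap K eps s p ^+ 2 <= N.

Let hD := gap_inclusion H.
Let cgamma : continuous gamma := continuous_curve (gap_param H).
Let mO := @matrix_part_measurable _ D L2 eps.
Let L20 : 0 < L2 := lt_trans (gap_height H).1 (gap_L2 H).

Definition resid_const : R := (2 * (lam + 2 * mu) ^+ 2 + 3 * lam ^+ 2 + 2 * mu ^+ 2) * M.

Lemma ramp_pairing_bound s (W : H1 Om) j (r : 'I_2 -> H1 Om) (t : R) : s = 1 \/ s = -1 ->
  (forall p, H1_grad W ord0 p = ramp_grad0 D kap K eps s p) ->
  (forall p, H1_grad W ord_max p = ramp_grad1 D kap K eps s p) ->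
  trace_inclusion gamma T r zero_vec ->
  (forall k, has_trace (fun y => (s * L1, y)) (- L2) L2 (r k) 0) -> 0 < t ->
  `|pairing (ramp_vec W j) r| <= t * \int[mu2]_(p in Om) strain_sq r p + resid_const / (4 * t).
Proof.
move=> hs W0 W1 ti ts t0.
have [F0 [F1 [F2 repr]]] := ramp_residual lam mu H eps0 hs W0 W1 j ti ts.
have [[sP sN sO] [bd pE]] := repr; rewrite pE.
have [iR bR] := resM hs.
apply: pairing_bound => //.
set c := 2 * _ + _ + _ in bd; have c0 : 0 <= c.
  by rewrite /c; have := sqr_ge0 (lam + 2 * mu); have := sqr_ge0 lam; have := sqr_ge0 mu; lra.
apply: (@le_trans _ _ (\int[mu2]_(p in Om) (c * (resid0 D kap K h eps s p ^+ 2 + (ramp_grad1 D kap K eps s p ^+ 2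
    + (resid2 D kap h eps s p ^+ 2 + resid3 D kap h eps s p ^+ 2)))))).
  apply: le_Rintegral => //; last exact: integZ.
  by apply: integD => //; [case: sP|apply: integD => //; [case: sN|case: sO]].
by rewrite RintegralZl //; apply: ler_wpM2l.
Qed.

(** The profile stays below [b], so the left ramp is active only for negative x and the right one
    only for positive x. *)
Lemma ramp_disjoint (WR WL : H1 Om) j :
  (forall p, H1_grad WR ord0 p = ramp_grad0 D kap K eps 1 p) ->
  (forall p, H1_grad WR ord_max p = ramp_grad1 D kap K eps 1 p) ->
  (forall p, H1_grad WL ord0 p = ramp_grad0 D kap K eps (-1) p) ->
  (forall p, H1_grad WL ord_max p = ramp_grad1 D kap K eps (-1) p) ->
  pairing (ramp_vec WL j) (ramp_vec WR j) = 0.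
Proof.
move=> r0 r1 l0 l1; rewrite conormal_pairingE.
rewrite (_ : \int[mu2]_(p in Om) _ = \int[mu2]_(p in Om) 0); first by rewrite Rintegral_cst // mul0r.
apply: eq_Rintegral => p _.
rewrite /energy_density /divergence /shear /ramp_vec !H1_comb_grad r0 r1 l0 l1.
rewrite /ramp_grad0 /ramp_grad1 !(ramp_pos H _ eps0) mul1r mulN1r.
have gK := gap_profile_lt H; have gl := profile_le_lim (gap_kap H) (gap_K H) p.2.
case: (boolP (xmax D - profile kap K p.2 < p.1)) => [h1|_].
  have -> : (xmax D - profile kap K p.2 < - p.1) = false by apply/negP => h2; lra.
  by rewrite /= !(mul0r, mulr0, addr0).
by rewrite /= !(mul0r, mulr0, addr0).
Qed.

Lemma ramp_vec_trace (W : H1 Om) j c t1 t2 g k : continuous c -> has_trace c t1 t2 W g ->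
  has_trace c t1 t2 (ramp_vec W j k) (kron j k * g).
Proof. by move=> cc tW; have := has_trace_comb (kron j k) 0 cc tW tW; rewrite mul0r addr0. Qed.

(** Write [a] for the energy pairing. Since the two ramps are orthogonal, the flux [a(v, wR)] equals
    [a(r, wR) + a(wR, wR) / 2]. The first term is bounded by absorption; in the second the integral
    of [1 / width] is about 2 pi / sqrt(kap eps), and the half restores the stated constant. *)
Lemma flux_bound j (v : 'I_2 -> H1 Om) : cell_solution lam mu gamma T j v ->
  `| right_flux lam mu gamma T j v - stiffness j * (pi / Num.sqrt kap) * (1 / Num.sqrt eps) | <=
  resid_const / Num.min mu (lam + mu) +
  (stiffness j * (2 * K / kap * (2 * L2) + 4 / (kap * L2)) + costiffness j * N) / 2.
Proof.
move=> sol; have h1 : (1 : R) = 1 \/ 1 = -1 :> R by left.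
have hN1 : (-1 : R) = 1 \/ -1 = -1 :> R by right.
have [WR [R0 R1 Ri Rr Rl]] := ramp_exists hD (gap_param H) (gap_kap H) (gap_K H) eps0 L20 h1
  (gap_profile_lt H) (gap_support H).
have [WL [LL0 LL1 Li Ll Lr]] := ramp_exists hD (gap_param H) (gap_kap H) (gap_K H) eps0 L20 hN1
  (gap_profile_lt H) (gap_support H).
rewrite mul1r in Rr Rl; rewrite mulN1r in Ll Lr; rewrite opprK in Lr.
have cv := @continuous_vertical R.
pose wR := ramp_vec WR j; pose wL := ramp_vec WL j.
have iR k : has_trace gamma 0 T (wR k) 0 by have := ramp_vec_trace j k cgamma Ri; rewrite mulr0.
have iL k : has_trace gamma 0 T (wL k) 0 by have := ramp_vec_trace j k cgamma Li; rewrite mulr0.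
have rR k : has_trace (fun y => (L1, y)) (- L2) L2 (wR k) (kron j k).
  by have := ramp_vec_trace j k (cv _) Rr; rewrite mulr1.
have lR k : has_trace (fun y => (- L1, y)) (- L2) L2 (wR k) 0.
  by have := ramp_vec_trace j k (cv _) Rl; rewrite mulr0.
have lL k : has_trace (fun y => (- L1, y)) (- L2) L2 (wL k) (kron j k).
  by have := ramp_vec_trace j k (cv _) Ll; rewrite mulr1.
have rL k : has_trace (fun y => (L1, y)) (- L2) L2 (wL k) 0.
  by have := ramp_vec_trace j k (cv _) Lr; rewrite mulr0.
(* This [V] carries a minus sign, so that the error is the sum [v + V]. *)
pose V := comb (-1 / 2) (1 / 2) wR wL; pose r := comb 1 1 v V.
have tr c t1 t2 g g1 g2 k : continuous c -> has_trace c t1 t2 (v k) g -> has_trace c t1 t2 (wR k) g1 ->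
    has_trace c t1 t2 (wL k) g2 -> g + (-1 / 2 * g1 + 1 / 2 * g2) = 0 -> has_trace c t1 t2 (r k) 0.
  move=> cc tv t1' t2' e; have t3 := has_trace_comb (-1 / 2) (1 / 2) cc t1' t2'.
  have t4 := has_trace_comb 1 1 cc tv t3.
  have e4 : 1 * g + 1 * (-1 / 2 * g1 + 1 / 2 * g2) = 0 by rewrite !(mul1r (_ + _)) (mul1r g).
  by rewrite e4 in t4.
have ri k : has_trace gamma 0 T (r k) 0.
  by apply: (tr _ _ _ _ _ _ _ cgamma (cell_inclusion sol k) (iR k) (iL k)); rewrite /zero_vec; ring.
have rr k : has_trace (fun y => (L1, y)) (- L2) L2 (r k) 0.
  by apply: (tr _ _ _ _ _ _ _ (cv _) (cell_right sol k) (rR k) (rL k)); field.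
have rl k : has_trace (fun y => (- L1, y)) (- L2) L2 (r k) 0.
  by apply: (tr _ _ _ _ _ _ _ (cv _) (cell_left sol k) (lR k) (lL k)); field.
have vr : pairing v r = 0 by exact: (cell_horizontal sol ri rl rr).
have flux : right_flux lam mu gamma T j v = pairing v wR.
  by apply: (right_fluxE cgamma sol) => k; [exact: iR|exact: lR|exact: rR].
have rexp z : pairing r z = pairing v z + (-1 / 2 * pairing wR z + 1 / 2 * pairing wL z).
  by rewrite /r conormal_pairing_comb conormal_pairing_comb !mul1r.
have dis : pairing wL wR = 0 by exact: ramp_disjoint.
pose c0 := Num.min mu (lam + mu).
have c00 : 0 < c0 by rewrite /c0 lt_min hmu hlm.
pose S := \int[mu2]_(p in Om) strain_sq r p.
have co : c0 * S <= pairing r r := energy_coercive r hmu hlm.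
(* [a(r, r)] is half the difference of the pairings of [r] with the two ramps, hence at most
   [c0 / 2 * S] plus a constant. Half of the coercivity bound absorbs this, and [c0 / 2 * S] is
   bounded in turn. *)
have t0 : 0 < c0 / 2 by rewrite divr_gt0.
have bR : `|pairing wR r| <= c0 / 2 * S + resid_const / (4 * (c0 / 2)).
  have ts k : has_trace (fun y => (1 * L1, y)) (- L2) L2 (r k) 0 by rewrite mul1r.
  exact: (@ramp_pairing_bound 1 WR j r _ h1 R0 R1 ri ts t0).
have bL : `|pairing wL r| <= c0 / 2 * S + resid_const / (4 * (c0 / 2)).
  have ts k : has_trace (fun y => (-1 * L1, y)) (- L2) L2 (r k) 0 by rewrite mulN1r.
  exact: (@ramp_pairing_bound (-1) WL j r _ hN1 LL0 LL1 ri ts t0).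
have cE : resid_const / (4 * (c0 / 2)) = resid_const / c0 / 2 by field; rewrite gt_eqF.
rewrite cE in bR bL.
have rrE := rexp r; rewrite vr in rrE.
have rw : `|pairing wR r| <= resid_const / c0.
  move: bR bL co; rewrite rrE !ler_norml => /andP[a1 a2] /andP[a3 a4] a5.
  by apply/andP; split; lra.
have fl := rexp wR; rewrite dis mulr0 addr0 (conormal_pairing_sym _ _ r) in fl.
have [st0 ct0] := stiffness_gt0 j.
have self := ramp_self_energy lam mu H eps0 h1 R0 R1 j.
rewrite -/wR -/(stiffness j) -/(costiffness j) (integral_ramp_grad0 H eps0 h1) in self.
have as_ := integral_width_asymp H eps0.
have gN := gradN h1.
have g0 : 0 <= \int[mu2]_(p in Om) ramp_grad1 D kap K eps 1 p ^+ 2.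
  by apply: Rintegral_ge0 => p _; exact: sqr_ge0.
rewrite flux.
set I := \int[_]_(y in _) _ in self as_; set B := \int[mu2]_(p in Om) _ in self gN g0.
set P0 := pi / Num.sqrt kap; set E0 := 1 / Num.sqrt eps.
rewrite -/P0 -/E0 in as_.
set e1 := 2 * K / kap * (2 * L2) + 4 / (kap * L2) in as_ *.
rewrite (_ : pairing v wR - _ = pairing wR r + (stiffness j * (I - 2 * P0 * E0) + costiffness j * B) / 2); last first.
  have -> : pairing v wR = pairing wR r + 1 / 2 * pairing wR wR by rewrite fl; field.
  by rewrite self; field.
apply: (le_trans (ler_normD _ _)); apply: lerD => //.
rewrite normrM [X in _ * X]gtr0_norm ?invr_gt0 //; apply: ler_wpM2r; first by rewrite invr_ge0.
apply: (le_trans (ler_normD _ _)); rewrite !normrM (gtr0_norm st0) (gtr0_norm ct0) (ger0_norm g0).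
by apply: lerD; rewrite ler_pM2l.
Qed.

End Fixed.

Lemma flux_asymp j (v : forall eps : R, 'I_2 -> H1 (matrix_part D L2 eps)) :
  (forall eps, 0 < eps -> cell_solution lam mu gamma T j (v eps)) ->
  exists M, forall eps, 0 < eps -> eps <= 1 ->
  `| right_flux lam mu gamma T j (v eps) - stiffness j * (pi / Num.sqrt kap) * (1 / Num.sqrt eps) | <= M.
Proof.
move=> hv; have [M hM] := resid_total H; have [N hN] := ramp_grad1_total H.
eexists => eps e0 e1; apply: flux_bound => //; last exact: hv.
- by move=> s hs; exact: hM.
- by move=> s hs; exact: hN.
Qed.

End FluxAsymptotics.

Lemma gap_data_exists {R : realType} (D : set (R * R)) (gamma : R -> R * R) (T t0 kap L2 : R) :
  inclusion D -> boundary_param D gamma T -> gamma t0 = (xmax D, 0) -> kap = curvature gamma t0 ->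
  0 < kap -> ymax D < L2 -> exists K C h, gap_data D gamma T L2 kap K C h.
Proof.
move=> hD hg ht hk k0 hL; have hb := xmax_closure hD hg ht.
have [a a0 ha] := gap_trace hD hg hb (or_introl erefl : (1 : R) = 1 \/ 1 = -1 :> R).
have [c c0 hc] := gap_trace hD hg hb (or_intror erefl : (-1 : R) = 1 \/ -1 = -1 :> R).
have m0 : 0 < Num.min a c by rewrite lt_min a0.
have [K [C [h [[K0 C0 gh] [hh hK sup df]]]]] := profile_exists hD hg ht hk k0 m0.
have [ha' hc'] : h <= a /\ h <= c by move: hh; rewrite le_min => /andP[].
exists K, C, h; split => //.
- have [_ /inclusion_closure Kh] := gh; apply: le_lt_trans hL; exact: (closure_ymax hD Kh).
- by move=> s [->|->]; [exact: ha|exact: hc].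
Qed.

(** The factor [L1 / L2] is bounded by [(b + 1) / L2] for [eps <= 1], so it preserves a bounded
    error; it is kept unexpanded in the leading term. [a] converts the stiffness [k] into the
    modulus [E]. *)
Lemma scaled_asymp {R : realType} (F : R -> R) (k A E b L2 M : R) : 0 <= b -> 0 < L2 ->
  (forall eps, 0 < eps -> eps <= 1 -> `|F eps - k * A * (1 / Num.sqrt eps)| <= M) ->
  exists C, forall a, a * k = E -> \forall eps \near 0^'+,
    `| a * ((b + eps / 2) / L2) * F eps - E * ((b + eps / 2) / L2) * A * (1 / Num.sqrt eps) | <= `|a| * C.
Proof.
move=> b0 L0 hF; exists ((b + 1) / L2 * M) => a aE; near=> eps.
have e0 : 0 < eps by [].
have e1 : eps <= 1 by near: eps; exact: nbhs_right_le.
have M0 : 0 <= M by exact: le_trans (normr_ge0 _) (hF _ e0 e1).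
rewrite -aE (_ : _ - _ = a * ((b + eps / 2) / L2 * (F eps - k * A * (1 / Num.sqrt eps)))); last by ring.
have w0 : 0 <= (b + eps / 2) / L2 by rewrite divr_ge0 ?(ltW L0) //; lra.
rewrite normrM; apply: ler_wpM2l => //; rewrite [leLHS]normrM (ger0_norm w0).
apply: ler_pM => //; last exact: hF.
by apply: ler_wpM2r; [rewrite invr_ge0 ltW|lra].
Unshelve. all: by end_near. Qed.

Theorem theorem2p1 (R : realType) (lam mu : R) (hmu : 0 < mu) (hlammu : 0 < lam + mu)
  (D : set (R * R)) (hD : inclusion D)
  (gamma : R -> R * R) (T : R) (hgamma : boundary_param D gamma T)
  (t0 kappa0 : R) (ht0 : gamma t0 = (xmax D, 0))
  (hkappa0 : kappa0 = curvature gamma t0) (hkappa0_gt0 : 0 < kappa0)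
  (L2 : R) (hL2 : ymax D < L2)
  (v1 v2 : forall eps : R, 'I_2 -> H1 (matrix_part D L2 eps))
  (hv1 : forall eps : R, 0 < eps -> cell_solution lam mu gamma T ord0 (v1 eps))
  (hv2 : forall eps : R, 0 < eps -> cell_solution lam mu gamma T ord_max (v2 eps)) :
  (exists C : R, \forall eps \near 0^'+,
    `| extensional_modulus lam mu gamma T (v1 eps)
       - young_modulus lam mu * (half_width D eps / L2)
         * (pi / Num.sqrt kappa0) * (1 / Num.sqrt eps) | <= C)
  /\
  (exists C : R, \forall eps \near 0^'+,
    `| shear_modulus lam mu gamma T (v2 eps)
       - mu * (half_width D eps / L2)
         * (pi / Num.sqrt kappa0) * (1 / Num.sqrt eps) | <= C).
Proof.
have [K [C [h H]]] := gap_data_exists hD hgamma ht0 hkappa0 hkappa0_gt0 hL2.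
have b0 := ltW (xmax_gt0 hD (gap_xmax H)).
have L20 : 0 < L2 := lt_trans (gap_height H).1 (gap_L2 H).
have [M1 h1] := flux_asymp hmu hlammu H hv1.
have [M2 h2] := flux_asymp hmu hlammu H hv2.
have l2 : 0 < lam + 2 * mu by lra.
split.
- have [C1 hC1] := scaled_asymp (young_modulus lam mu) b0 L20 h1.
  pose a := (1 + poisson_ratio lam mu) * (1 - 2 * poisson_ratio lam mu) / (1 - poisson_ratio lam mu).
  exists (`|a| * C1); apply: hC1.
  (* The elastic prefactor times [lam + 2 * mu] is Young's modulus: [1 - rho] contributes
     [lam + 2 * mu] in the denominator, [1 + rho] gives [3 * lam + 2 * mu] and [1 - 2 * rho] gives
     [mu], up to multiples of [lam + mu]. *)
  rewrite /a /stiffness /young_modulus /poisson_ratio /=; field.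
  by rewrite !gt_eqF //; lra.
- have [C2 hC2] := scaled_asymp mu b0 L20 h2.
  exists (`|1| * C2); have := hC2 1; rewrite mul1r => /(_ erefl).
  by apply: filterS => eps; rewrite mul1r.
Qed.
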